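(* Let $k$ be a positive integer and let $G$ be a $50k$-connected graph. At least one of the following holds: (i) $G$ is parity-$k$-linked restricted to independent sets; (ii) there is a set $X$ of at most $2k-2$ vertices such that $G - X$ is bipartite.
   Context: All graphs are finite and simple. $G$ is parity-$k$-linked restricted to independent sets if for every independent set $\{s_1,\dots,s_k,t_1,\dots,t_k\}$ of $2k$ distinct vertices of $G$ and every choice of parities $p_1,\dots,p_k \in\{\text{odd},\text{even}\}$ there are pairwise vertex-disjoint paths $P_1,\dots,P_k$ such that $P_i$ joins $s_i$ and $t_i$ and has length of parity $p_i$. *)

(* Defs.v *)
From mathcomp Require Import all_boot.
Set Implicit Arguments. Unset Strict Implicit. Unset Printing Implicit Defensive.

Definition simple_graph (T : finType) (e : rel T) : Prop :=
  symmetric e /\ irreflexive e.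

Definition is_path (T : finType) (e : rel T) (P : seq T) (s t : T) : Prop :=
  exists q : seq T, [/\ P = s :: q, path e s q, last s q = t & uniq P].

Definition path_length (T : Type) (P : seq T) : nat := (size P).-1.

Definition connected_minus (T : finType) (e : rel T) (X : {set T}) : Prop :=
  forall x y, x \notin X -> y \notin X ->
    connect [rel a b | [&& e a b, a \notin X & b \notin X]] x y.

Definition k_connected (T : finType) (e : rel T) (m : nat) : Prop :=
  m < #|T| /\ forall X : {set T}, #|X| < m -> connected_minus e X.

Definition bipartite_minus (T : finType) (e : rel T) (X : {set T}) : Prop :=
  exists c : T -> bool, forall x y, x \notin X -> y \notin X -> e x y -> c x != c y.

Definition parity_linked_indep (T : finType) (e : rel T) (k : nat) : Prop :=
  forall (s t : 'I_k -> T) (p : 'I_k -> bool),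
    injective s -> injective t -> (forall i j, s i != t j) ->
    (forall x y, (x \in codom s) || (x \in codom t) ->
                 (y \in codom s) || (y \in codom t) -> ~~ e x y) ->
    exists P : 'I_k -> seq T,
      (forall i, is_path e (P i) (s i) (t i) /\ odd (path_length (P i)) = p i) /\
      (forall i j, i != j -> [disjoint P i & P j]).

(* Main.v *)
Require Import Defs.
From mathcomp Require Import all_boot zify.
From Stdlib Require Import Classical.

(** Call a path between two vertices of [W] breaking for a 2-colouring [c] if it
    avoids [W] in its interior and its length has the parity that no path along
    bichromatic edges has. A maximum cut gives a colouring whose bichromatic edges
    span a graph of minimum degree at least 25k, and Mader's and Thomas-Wollan's
    arguments find in it a set [W] that links any 4k of its vertices. Matching
    theory in a doubled graph gives either 2k disjoint breaking [W]-paths or a set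
    [Z] of at most 4k-2 vertices whose deletion leaves a bipartite graph.

    In the first case, link the terminals to [W] by 2k disjoint paths using as few
    edges off the breaking paths as possible. Counting the breaking paths they touch
    leaves one untouched for every pair of terminals whose parity cannot be chosen
    by switching along a touched one; pairs of wrong parity go through theirs.

    In the second case, extend the colouring of [G - Z] by majority and identify
    [t_i] with [s_i]. If the monochromatic edges then contain a matching of size k,
    its edges correct the parities and the rest of [G - Z] does the linking.
    Otherwise the Tutte-Berge formula yields 2k-2 vertices meeting every
    monochromatic edge, because the terminals are independent. *)

Set Implicit Arguments. Unset Strict Implicit. Unset Printing Implicit Defensive.

(** * Paths *)

(** The obstacle is the size of the exceptional set. If [f] pairs are served by a breaking path that
    their own route touches, a cheapest linkage may touch [k + f] breaking paths, so [2k] of them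
    are needed to leave one for each of the other [k - f] pairs. Matching theory, asked for [2k]
    disjoint paths, answers with up to [4k - 2] vertices when it fails. This is twice too many, and
    the rest of the proof has to exploit the near-bipartite structure to halve the set.

    Constants. A pair may enter [W] at four vertices: the ends of its two terminal paths and those
    of a breaking path. Hence [W] must link [4k] vertices. For [2K] terminals the theorem on massed
    pairs wants more than [12K] arcs per vertex, an edge being two arcs; with [K = 2k] this is
    [24k]. The passage to a smallest dense subgraph preserves [25k] arcs per vertex, the spare [k]
    paying for the arcs inside the terminal set. A maximum cut keeps at least half of every degree,
    whence [50k]. *)

Section Paths.
Variables (T : finType) (e : rel T).
Implicit Types (p q : seq T) (a b v z : T).

Lemma is_path_mem p a b : is_path e p a b -> a \in p /\ b \in p.
Proof. by case=> q [-> _ <- _]; rewrite mem_head mem_last. Qed.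

Lemma is_path_uniq p a b : is_path e p a b -> uniq p.
Proof. by case=> q []. Qed.

Lemma is_path1 a : is_path e [:: a] a a.
Proof. by exists [::]. Qed.

Lemma is_path_sub (e' : rel T) p a b :
  {in p &, forall x y, e x y -> e' x y} -> is_path e p a b -> is_path e' p a b.
Proof.
move=> sub [q [E pq lq uq]]; rewrite E in sub uq *; exists q; split => //.
have al : all [in a :: q] (a :: q) by apply/allP.
exact: (sub_in_path sub al).
Qed.

Lemma walk_is_path a q : path e a q ->
  exists2 p, is_path e p a (last a q) & {subset p <= a :: q}.
Proof.
case/shortenP => q' pq' uq' sub; exists (a :: q'); first by exists q'.
move=> z; rewrite !inE => /predU1P[->|/sub ->]; by rewrite ?eqxx ?orbT.
Qed.

Lemma is_path_cat_edge p q a b c d :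
  is_path e p a b -> is_path e q c d -> e b c -> [disjoint p & q] ->
  is_path e (p ++ q) a d.
Proof.
move=> [p' [-> pp lp up]] [q' [-> pq lq uq]] ebc dis.
exists (p' ++ c :: q'); split => //.
- by rewrite cat_path pp lp /= ebc.
- by rewrite last_cat.
- by rewrite cat_uniq up uq andbT -disjoint_has disjoint_sym.
Qed.

(** A path is the list of its vertices, so gluing two paths at a common end would list that end
    twice; [behead] drops the second copy. All splittings below have the same form
    [p1 ++ behead p2]. *)
Lemma is_path_join p q a b d :
  is_path e p a b -> is_path e q b d -> (forall z, z \in p -> z \in q -> z = b) ->
  is_path e (p ++ behead q) a d.
Proof.
move=> [p' [-> pp lp up]] [q' [-> pq lq uq]] dis.
exists (p' ++ q'); split => //.
- by rewrite cat_path pp lp.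
- by rewrite last_cat lp.
- have /andP[bq uq'] : (b \notin q') && uniq q' by [].
  rewrite cat_uniq up [behead _]/= uq' andbT; apply/hasPn => z zq /=.
  by apply/negP => /dis; rewrite inE zq orbT => /(_ isT) zb; rewrite -zb zq in bq.
Qed.

Lemma is_path_split p a b v : is_path e p a b -> v \in p ->
  exists p1 p2, [/\ is_path e p1 a v, is_path e p2 v b, p = p1 ++ behead p2
    & forall z, z \in p1 -> z \in p2 -> z = v].
Proof.
case=> q [-> pq lq uq] vp.
case: (splitPl vp) pq lq uq => q1 q2 l1; rewrite cat_path last_cat l1.
move=> /andP[pq1 pq2] lq uq.
have [u1 h2 u2] : [/\ uniq (a :: q1), ~~ has [in a :: q1] q2 & uniq q2].
  by apply/and3P; rewrite -cat_uniq.
exists (a :: q1), (v :: q2); split=> //.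
- by exists q1.
- exists q2; split => //=; rewrite u2 andbT.
  by apply/negP => vq2; case/hasP: h2; exists v => //; rewrite -l1; apply: mem_last.
- move=> z z1; rewrite inE => /predU1P[//|z2].
  by case/hasP: h2; exists z.
Qed.

Lemma mem_join p1 p2 v b z : is_path e p2 v b -> v \in p1 ->
  (z \in p1 ++ behead p2) = (z \in p1) || (z \in p2).
Proof.
case=> q [-> _ _ _] vp1; rewrite mem_cat /= inE.
by case: eqVneq => [->|]; rewrite ?vp1.
Qed.

Lemma is_path_cons p a b x : is_path e p a b -> e x a -> x \notin p ->
  is_path e (x :: p) x b.
Proof. by case=> q [-> pq lq uq] exa xq; exists (a :: q); rewrite /= exa pq lq xq. Qed.

Lemma is_path_first (A : pred T) p a b : is_path e p a b -> has A p ->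
  exists v p1 p2, [/\ is_path e p1 a v, is_path e p2 v b, p = p1 ++ behead p2,
    A v & forall z, z \in p1 -> A z -> z = v].
Proof.
elim: p a => [|x p IH] a; first by case.
move=> pp; have [q [[ax eq]]] := pp; subst x q.
case: (boolP (A a)) => [Aa _ _ _ _|nAa pq lq uq hA].
  exists a, [:: a], (a :: p); split => //; first exact: is_path1.
  by move=> z; rewrite inE => /eqP.
case: p IH pp pq lq uq hA => [|y p] IH pp pq lq uq /=; first by rewrite (negbTE nAa).
rewrite (negbTE nAa) /= => hA.
have /andP[eay pq'] : e a y && path e y p by [].
have /andP[ap uq'] : (a \notin y :: p) && uniq (y :: p) by [].
have [v [p1 [p2 [P1 P2 E Av fA]]]] := IH y (ex_intro _ p (And4 erefl pq' lq uq')) hA.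
exists v, (a :: p1), p2; split => //; last 1 first.
- by move=> z; rewrite inE => /predU1P[->|/fA//]; rewrite (negbTE nAa).
- apply: is_path_cons P1 eay _; apply: contra ap; rewrite E mem_cat => ->//.
- by rewrite E.
Qed.

Lemma is_path_last (A : pred T) p a b : is_path e p a b -> has A p ->
  exists v p1 p2, [/\ is_path e p1 a v, is_path e p2 v b, p = p1 ++ behead p2,
    A v & forall z, z \in p2 -> A z -> z = v].
Proof.
elim: p a => [|x p IH] a; first by case.
move=> pp; have [q [[ax eq]]] := pp; subst x q.
case: (boolP (has A p)) => [hA|nA] pq lq uq /=.
  case: p IH pp pq lq uq hA => [//|y p] IH pp pq lq uq hA _.
  have /andP[eay pq'] : e a y && path e y p by [].
  have /andP[ap uq'] : (a \notin y :: p) && uniq (y :: p) by [].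
  have [v [p1 [p2 [P1 P2 E Av fA]]]] := IH y (ex_intro _ p (And4 erefl pq' lq uq')) hA.
  exists v, (a :: p1), p2; split => //; last by rewrite E.
  by apply: is_path_cons P1 eay _; apply: contra ap; rewrite E mem_cat => ->.
rewrite (negbTE nA) orbF => Aa.
exists a, [:: a], (a :: p); split => //; first exact: is_path1.
move=> z; rewrite inE => /predU1P[//|zp Az].
by case/hasP: nA; exists z.
Qed.

Lemma is_path_connect (C : {set T}) p a b : is_path e p a b -> {subset p <= C} ->
  connect [rel x y | [&& e x y, x \in C & y \in C]] a b.
Proof.
case=> q [-> pq <- _] sub; apply/connectP; exists q => //.
have: all [in C] (a :: q) by apply/allP.
elim: q a pq {sub} => //= x q IH a /andP[eax pq] /and3P[aC xC qC].
by rewrite eax aC xC IH //= xC.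
Qed.

End Paths.

Definition rstr (T : finType) (e : rel T) (C : {set T}) : rel T :=
  [rel x y | [&& e x y, x \in C & y \in C]].

Lemma is_path_rev (T : finType) (e : rel T) p a b : symmetric e ->
  is_path e p a b -> is_path e (rev p) b a.
Proof.
move=> se [q [-> pq lq uq]]; exists (behead (rev (a :: q))).
have E : rev (a :: q) = b :: rev (belast a q) by rewrite lastI lq rev_rcons.
have uE : uniq (b :: rev (belast a q)) by rewrite -E rev_uniq.
rewrite E [behead _]/=; split => //.
- rewrite -lq rev_path; by rewrite (eq_path (e' := e)) // => x y; rewrite se.
- have := congr1 (last a) E; rewrite rev_cons last_rcons /= => {2}->.
  by [].
Qed.

(** The condition [a != b] matters: [connect] is reflexive, so it holds at [a = b] even when [a]
    lies outside [C]. *)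
Lemma connect_rstr (T : finType) (e : rel T) (C : {set T}) a b :
  connect (rstr e C) a b -> a != b -> exists2 p, is_path e p a b & {subset p <= C}.
Proof.
case/connectP => q pq -> ab.
have {pq} : path e a q /\ {subset a :: q <= C}.
  case: q pq ab => [|x q]; first by rewrite eqxx.
  move=> /= /andP[/and3P[eax aC xC] pq] _; rewrite eax andTb.
  have al : path e x q /\ all [in C] q.
    elim: q x {eax} xC pq => //= y q IH x xC /andP[/and3P[-> _ yC] pq].
    by rewrite yC; have [-> ->] := IH y yC pq.
  by case: al => -> /allP al; split => // z; rewrite !inE => /or3P[/eqP->|/eqP->|/al].
move=> [pq sub]; have [p pp sp] := walk_is_path pq.
by exists p => // z /sp/sub.
Qed.

(** * Menger's theorem *)

Definition separates (T : finType) (e : rel T) (A B S : {set T}) :=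
  forall p a b, is_path e p a b -> a \in A -> b \in B -> exists2 z, z \in p & z \in S.

Definition linkage (T : finType) (e : rel T) (A B : {set T}) (I : eqType) (P : I -> seq T) :=
  (forall i, exists a b, [/\ is_path e (P i) a b, a \in A, b \in B,
     (forall z, z \in P i -> z \in A -> z = a) & (forall z, z \in P i -> z \in B -> z = b)])
  /\ (forall i j z, z \in P i -> z \in P j -> i = j).

Lemma injK_onto (I T : finType) (f : I -> T) (S : {set T}) :
  injective f -> (forall i, f i \in S) -> #|S| <= #|I| -> forall z, z \in S -> exists i, z = f i.
Proof.
move=> inj fS le z zS.
have sub : [set f i | i in I] \subset S by apply/subsetP => _ /imsetP[i _ ->].
have/eqP E : [set f i | i in I] == S by rewrite eqEcard sub card_imset.
by move: zS; rewrite -E => /imsetP[i _ ->]; exists i.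
Qed.

(** Start at the last vertex in [A] and stop at the first vertex in [B] after it. *)
Lemma trim_path (T : finType) (e : rel T) (A B : {set T}) p a b :
  is_path e p a b -> a \in A -> b \in B ->
  exists q a' b', [/\ is_path e q a' b', a' \in A, b' \in B &
    [/\ {subset q <= p}, (forall z, z \in q -> z \in A -> z = a')
      & (forall z, z \in q -> z \in B -> z = b')]].
Proof.
move=> pp aA bB.
have [ap bp] := is_path_mem pp.
have [v [p1 [p2 [P1 P2 E vA fA]]]] := is_path_last (A := mem A) pp ltac:(by apply/hasP; exists a).
have [vp2 bp2] := is_path_mem P2; have [_ vp1] := is_path_mem P1.
have [w [q1 [q2 [Q1 Q2 E' wB fB]]]] := is_path_first (A := mem B) P2 ltac:(by apply/hasP; exists b).
have [_ wq1] := is_path_mem Q1.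
exists q1, v, w; split=> //; split => //; last by move=> z zq zA; apply: fA; rewrite // E' mem_cat zq.
by move=> z zq; rewrite E (mem_join _ P2 vp1) E' mem_cat zq orbT.
Qed.

(** Induction on the number of arcs, for digraphs; [hall] relies on the directed form. Delete an arc
    [(x, y)]. If some [S] with fewer than [k] vertices now separates, then [x |: S] and [y |: S]
    separate in [e], so both have exactly [k] vertices. Induction links [A] to the first and the
    second to [B]; the two linkages are glued at [S] and along the deleted arc. *)
Lemma menger (T : finType) (e : rel T) (A B : {set T}) k :
  (forall S, separates e A B S -> k <= #|S|) ->
  exists P : 'I_k -> seq T, linkage e A B P.
Proof.
have [n] := ubnP #|[set xy : T * T | e xy.1 xy.2]|.
elim: n e A B => // n IH e A B len sep.
case: (classic (exists x y, e x y)) => [[x [y exy]]|nE]; last first.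
  have /subset_leqif_cards [] : A :&: B \subset A by apply: subsetIl.
  have kI : k <= #|A :&: B|.
    apply: sep => p a b [q [-> pq lq uq]] aA bB; exists a; first exact: mem_head.
    case: q pq lq {uq} => [_ /= ab|z q /= /andP[eaz]]; first by rewrite inE aA ab.
    by case: nE; exists a, z.
  move=> _ _.
  pose f (i : 'I_k) := enum_val (widen_ord kI i).
  have fP i : f i \in A :&: B by apply: enum_valP.
  exists (fun i => [:: f i]); split => [i|i j z].
    have /setIP[fA fB] := fP i.
    exists (f i), (f i); split => //; first exact: is_path1.
    by move=> z; rewrite inE => /eqP.
    by move=> z; rewrite inE => /eqP.
  rewrite !inE => /eqP-> /eqP/enum_val_inj/(congr1 val)/= h; exact: val_inj.
pose e' := [rel a b | e a b && ((a, b) != (x, y))].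
have sub : subrel e' e by move=> a b /andP[].
have lte : #|[set xy : T * T | e' xy.1 xy.2]| < n.
  rewrite -ltnS; apply: leq_trans len; rewrite ltnS; apply: proper_card; apply/properP; split.
    by apply/subsetP => -[a b]; rewrite !inE => /sub.
  by exists (x, y); rewrite !inE /= ?eqxx ?andbF.
case: (classic (forall S, separates e' A B S -> k <= #|S|)) => [|].
  move=> /(IH _ _ _ lte)[P [hP dP]]; exists P; split => // i.
  have [a [b [p1 p2 p3 p4 p5]]] := hP i; exists a, b; split => //.
  by apply: is_path_sub p1 => u v _ _ /sub.
move=> /not_all_ex_not [S nS]; have [sepS /negP] := imply_to_and _ _ nS; rewrite -ltnNge => ltS.
have noxy p a b : is_path e p a b -> (x \notin p) || (y \notin p) -> is_path e' p a b.
  move=> pp np; apply: is_path_sub pp => u v up vp /= ->; apply/eqP => -[ux vy].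
  by move: np; rewrite -ux -vy up vp.
have sepz z : z \in [:: x; y] -> separates e A B (z |: S).
  move=> zxy p a b pp aA bB; case: (boolP (z \in p)) => zp; first by exists z; rewrite ?setU11.
  have pp' : is_path e' p a b.
    by apply: noxy pp _; move: zxy; rewrite !inE => /orP[]/eqP<-; rewrite zp ?orbT.
  by have [w wp wS] := sepS _ _ _ pp' aA bB; exists w; rewrite // inE wS orbT.
have cz z : z \in [:: x; y] -> z \notin S /\ #|z |: S| = k.
  move=> /sepz /sep; rewrite cardsU1; case: (z \in S) => /=; lia.
have [|xS cx] := cz x; first by rewrite inE eqxx.
have [|yS cy] := cz y; first by rewrite !inE eqxx orbT.
(* Up to its first vertex in [x |: S] a path from [A] cannot use the deleted arc, which starts at
   [x]. So a separator for the smaller problem also separates [A] from [B] in [e]. *)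
have [] := IH e' A (x |: S) lte.
  move=> S' sepS'; apply: sep => p a b pp aA bB.
  have [z zp zS] := sepz x (mem_head _ _) _ _ _ pp aA bB.
  have [v [p1 [p2 [P1 P2 E vS fA]]]] := is_path_first (A := mem (x |: S)) pp ltac:(by apply/hasP; exists z).
  have P1' : is_path e' p1 a v.
    have [q [E1 pq lq uq]] := P1; exists q; split => //.
    move: fA uq; rewrite E1 -lq; elim: (q) a {E1 pq lq P1 aA pp} (pq) => //= c r IHr a /andP[-> pr] fA /andP[aa ur].
    rewrite {1}IHr //; first 1 last.
      by move=> w wr; apply: fA; rewrite inE wr orbT.
    rewrite andbT /=; apply/eqP => -[ax cy'].
    move: (fA a); rewrite mem_head ax setU11 => /(_ isT isT) E2.
    by case/negP: aa; rewrite ax E2 mem_last.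
  have [w wp wS] := sepS' _ _ _ P1' aA vS; exists w => //.
  by rewrite E mem_cat wp.
move=> P [hP dP].
have [] := IH e' (y |: S) B lte.
  move=> S' sepS'; apply: sep => p a b pp aA bB.
  have [z zp zS] := sepz y ltac:(by rewrite !inE eqxx orbT) _ _ _ pp aA bB.
  have [v [p1 [p2 [P1 P2 E vS fA]]]] := is_path_last (A := mem (y |: S)) pp ltac:(by apply/hasP; exists z).
  have [_ vp1] := is_path_mem P1.
  have P2' : is_path e' p2 v b.
    have [q [E1 pq lq uq]] := P2; exists q; split => //.
    have {}fA w : w \in q -> w \notin y |: S.
      move=> wq; apply/negP => wS; have wv : w = v by apply: fA; rewrite // E1 inE wq orbT.
      by move: uq; rewrite E1 -wv /= wq.
    elim: (q) v {E1 lq uq P1 P2 vS E vp1} pq fA => //= c r IHr v /andP[-> pr] fA.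
    rewrite IHr //; last by move=> w wr; apply: fA; rewrite inE wr orbT.
    rewrite andbT /=; apply/eqP => -[_ cy'].
    by move: (fA c); rewrite mem_head cy' setU11 => /(_ isT).
  have [w wp wS] := sepS' _ _ _ P2' vS bB; exists w => //.
  by rewrite E (mem_join _ P2 vp1) wp orbT.
move=> Q [hQ dQ].
have {}hP i : exists ab : T * T, [/\ is_path e' (P i) ab.1 ab.2, ab.1 \in A, ab.2 \in x |: S,
     (forall z, z \in P i -> z \in A -> z = ab.1) & (forall z, z \in P i -> z \in x |: S -> z = ab.2)].
  by have [a [b h]] := hP i; exists (a, b).
have {}hQ i : exists ab : T * T, [/\ is_path e' (Q i) ab.1 ab.2, ab.1 \in y |: S, ab.2 \in B,
     (forall z, z \in Q i -> z \in y |: S -> z = ab.1) & (forall z, z \in Q i -> z \in B -> z = ab.2)].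
  by have [a [b h]] := hQ i; exists (a, b).
have [F {}hP] := fin_all_exists hP.
have [G {}hQ] := fin_all_exists hQ.
have injF : injective (fun i => (F i).2).
  move=> i j E; have [/is_path_mem[_ h1] _ _ _ _] := hP i; have [/is_path_mem[_ h2] _ _ _ _] := hP j.
  by apply: dP h1 _; rewrite E.
have injG : injective (fun i => (G i).1).
  move=> i j E; have [/is_path_mem[h1 _] _ _ _ _] := hQ i; have [/is_path_mem[h2 _] _ _ _ _] := hQ j.
  by apply: dQ h1 _; rewrite E.
have ontoG z : z \in y |: S -> exists j, z = (G j).1.
  apply: (injK_onto injG); last by rewrite card_ord cy.
  by move=> i; case: (hQ i).
(* The vertex at which the continuation of [P i] starts; from [x] it is reached along the deleted
   arc. *)
pose w i := if (F i).2 == x then y else (F i).2.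
have wS i : w i \in y |: S.
  rewrite /w; case: eqP => [_|/eqP nx]; first exact: setU11.
  have [_ _ h _ _] := hP i; move: h; rewrite !inE (negbTE nx) /= => ->; exact: orbT.
have [J hJ] := fin_all_exists (fun i => ontoG _ (wS i)).
(* If the meeting point were not in [S], then [P i] up to it and [Q j] after it would form a walk of
   [e'] from [A] to [B] that avoids [S]. *)
have cross i j v : v \in P i -> v \in Q j -> [/\ (F i).2 = v, (G j).1 = v & v \in S].
  move=> vP vQ; have [P1 P2 P3 P4 P5] := hP i; have [Q1 Q2 Q3 Q4 Q5] := hQ j.
  case: (boolP (v \in S)) => vS.
    split => //; apply/esym; first by apply: P5; rewrite // inE vS orbT.
    by apply: Q4; rewrite // inE vS orbT.
  exfalso.
  have [p1 [p2 [R1 R2 E1 D1]]] := is_path_split P1 vP.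
  have [q1 [q2 [T1 T2 E2 D2]]] := is_path_split Q1 vQ.
  have [_ vp1] := is_path_mem R1; have [_ vq1] := is_path_mem T1.
  have [_ fp2] := is_path_mem R2; have [gq1 _] := is_path_mem T1.
  have nS1 z : z \in p1 -> z \notin S.
    move=> zp; apply/negP => zS; have zF : z = (F i).2 by apply: P5; rewrite ?inE ?zS ?orbT // E1 mem_cat zp.
    by move: vS; rewrite -(D1 z) ?zF -?zF ?zS //; rewrite zF.
  have nS2 z : z \in q2 -> z \notin S.
    move=> zp; apply/negP => zS; have zG : z = (G j).1.
      by apply: Q4; rewrite ?inE ?zS ?orbT // E2 (mem_join _ T2 vq1) zp orbT.
    by move: vS; rewrite -(D2 z) ?zS // zG.
  have [r pr lr] : exists2 r, path e' (F i).1 r & last (F i).1 r = (G j).2 /\ {subset (F i).1 :: r <= p1 ++ q2}.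
    case: R1 => r1 [E3 pr1 lr1 _]; case: T2 => r2 [E4 pr2 lr2 _].
    exists (r1 ++ r2); first by rewrite cat_path pr1 lr1.
    rewrite last_cat lr1 lr2; split => // z.
    by rewrite E3 E4 !(inE, mem_cat) => /or3P[] ->; rewrite ?orbT.
  case: lr => lr sr; have [p pp sp] := walk_is_path pr.
  have [z zp zS] := sepS _ _ _ pp P2 ltac:(by rewrite lr).
  by move/sp/sr: zp; rewrite mem_cat => /orP[/nS1|/nS2]; rewrite zS.
pose R i := P i ++ (if (F i).2 == x then Q (J i) else behead (Q (J i))).
have memR i z : (z \in R i) = (z \in P i) || (z \in Q (J i)).
  rewrite /R; case: ifP => [_|nx]; first by rewrite mem_cat.
  have [Q1 _ _ _ _] := hQ (J i); rewrite -hJ /w nx in Q1.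
  by apply: (mem_join _ Q1); have [/is_path_mem[]] := hP i.
have injJ : injective J.
  move=> i j E; have : w i = w j by rewrite !hJ E.
  rewrite /w; case: eqP => [E1|/eqP ni]; case: eqP => [E2|/eqP nj].
  - by move=> _; apply: injF; rewrite /= E2.
  - move=> ye; have [_ _ h _ _] := hP j; move: h; rewrite !inE (negbTE nj) -ye; by rewrite (negbTE yS).
  - move=> ye; have [_ _ h _ _] := hP i; move: h; rewrite !inE (negbTE ni) ye; by rewrite (negbTE yS).
  - exact: injF.
have RP i : is_path e (R i) (F i).1 (G (J i)).2.
  have [P1 P2 P3 P4 P5] := hP i; have [Q1 Q2 Q3 Q4 Q5] := hQ (J i).
  have P1' := is_path_sub (fun u v _ _ h => sub u v h) P1.
  have Q1' := is_path_sub (fun u v _ _ h => sub u v h) Q1.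
  rewrite /R; case: ifP => [/eqP Ex|nx].
    apply: is_path_cat_edge P1' Q1' _ _; first by rewrite -hJ /w Ex eqxx.
    rewrite disjoint_has; apply/hasPn => z zP /=; apply/negP => zQ.
    by have [E1 E2 zS] := cross _ _ _ zP zQ; move: xS; rewrite -Ex E1 zS.
  have E : (G (J i)).1 = (F i).2 by rewrite -hJ /w nx.
  rewrite -E in P1'; apply: is_path_join P1' Q1' _.
  by move=> z zP zQ; have [_ -> _] := cross _ _ _ zP zQ.
have keyc i j z : z \in P i -> z \in Q (J j) -> i = j.
  move=> zP zQ; have [E1 E2 zS] := cross _ _ _ zP zQ.
  rewrite -hJ /w in E2; move: E2; case: eqP => [_ yz|_ E2].
    by rewrite yz zS in yS.
  by apply: injF; rewrite /= E1 E2.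
(* The second half of a glued path may return to [A] and the first may have met [B], while [linkage]
   allows only the ends there. *)
have RR i : exists q a b, [/\ is_path e q a b, a \in A, b \in B &
    [/\ {subset q <= R i}, (forall z, z \in q -> z \in A -> z = a)
      & (forall z, z \in q -> z \in B -> z = b)]].
  by apply: trim_path (RP i) _ _; [case: (hP i)|case: (hQ (J i))].
have [R' {}RR] := fin_all_exists RR.
exists R'; split=> [i|i j z].
  by have [a [b [h1 h2 h3 [h4 h5 h6]]]] := RR i; exists a, b.
have [a [b [_ _ _ [h _ _]]]] := RR i; have [a' [b' [_ _ _ [h' _ _]]]] := RR j.
move=> /h + /h'; rewrite !memR => /orP[zi|zi] /orP[zj|zj].
- exact: dP zi zj.
- exact: keyc zi zj.
- exact/esym/(keyc _ _ _ zj zi).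
- exact/injJ/(dQ _ _ _ zi zj).
Qed.

(** * Routings *)

(* [lia] becomes very slow when it preprocesses large contexts. *)
Ltac arith :=
  repeat match goal with
  | H : is_true (leq _ _) |- _ => revert H
  | H : is_true (leq _ _ && leq _ _) |- _ => revert H
  | H : @eq nat _ _ |- _ => revert H
  | H : is_true (leq _ _) \/ is_true (leq _ _) |- _ => revert H
  end; clear; intros; lia.

Lemma disjP (T : finType) (A B : {set T}) :
  reflect (forall z, z \in A -> z \in B -> False) [disjoint A & B].
Proof.
rewrite -setI_eq0; apply: (iffP eqP) => [E z zA zB|h].
  by have := in_set0 z; rewrite -E inE zA zB.
by apply/setP => z; rewrite !inE; apply/negP => /andP[]; apply: h.
Qed.

(** Menger's theorem in the digraph with an arc from [i] to every member of [N i]: a separator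
    contains all of the neighbourhood of the indices that it misses. [f0] supplies the values
    outside [R]. *)
Lemma hall (I T : finType) (f0 : I -> T) (N : I -> {set T}) (R : {set I}) :
  (forall J : {set I}, J \subset R -> #|J| <= #|\bigcup_(i in J) N i|) ->
  exists f : I -> T, {in R, forall i, f i \in N i} /\ {in R &, injective f}.
Proof.
move=> hN.
pose e := [rel x y : I + T | match x, y with inl i, inr z => z \in N i | _, _ => false end].
pose A : {set I + T} := [set inl i | i in R].
pose B : {set I + T} := [set inr z | z in T].
have [S sepS|P [hP dP]] := @menger _ e A B #|R|.
  pose J := [set i in R | inl i \notin S].
  have JR : J \subset R by apply/subsetP => i; rewrite inE => /andP[].
  pose S1 : {set I + T} := inl @: (R :\: J); pose S2 : {set I + T} := inr @: \bigcup_(i in J) N i.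
  have c1 : #|S1| = #|R| - #|J|.
    by rewrite card_imset ?cardsDS // => i j [].
  have c2 : #|S2| = #|\bigcup_(i in J) N i| by rewrite card_imset // => i j [].
  have d12 : [disjoint S1 & S2].
    by apply/disjP => z /imsetP[i _ ->] /imsetP[].
  have sub : S1 :|: S2 \subset S.
    apply/subsetP => z /setUP[/imsetP[i]|/imsetP[y]].
      by rewrite !inE => /andP[/nandP[/negPf->//|/negPn iS] _] ->.
    move/bigcupP => [i iJ yN] ->; have := iJ; rewrite inE => /andP[iR iS].
    have [|||w] := sepS [:: inl i; inr y] (inl i) (inr y).
    - by exists [:: inr y]; rewrite /= yN.
    - exact: imset_f.
    - exact: imset_f.
    - by rewrite !inE => /orP[/eqP->|/eqP->//]; rewrite (negbTE iS).
  have := subset_leq_card sub; rewrite cardsU disjoint_setI0 // cards0 subn0 c1 c2.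
  have := hN _ JR; have := subset_leq_card JR => h1 h2 h3; apply: leq_trans h3; lia.
have key (j : 'I_#|R|) : exists iz : I * T, [/\ iz.1 \in R, iz.2 \in N iz.1, inl iz.1 \in P j & inr iz.2 \in P j].
  have [a [b [[q [E pq lq uq]] /imsetP[i iR ai] /imsetP[z _ bz] _ _]]] := hP j.
  rewrite ai in E pq lq; rewrite bz in lq; case: q E pq lq {uq} => [//|[//|y] q] E /= /andP[yN].
  case: q E => [|[]//] E _ [yz].
  by exists (i, y); rewrite E !inE !eqxx orbT.
have [F hF] := fin_all_exists key.
have injF : injective (fun j => (F j).1).
  move=> j j' E; have [_ _ h1 _] := hF j; have [_ _ h2 _] := hF j'.
  by apply: dP h1 _; rewrite E.
have onto i : i \in R -> exists j, i = (F j).1.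
  by apply: (injK_onto injF); rewrite ?card_ord // => j; case: (hF j).
pose f i := if [pick j | (F j).1 == i] is Some j then (F j).2 else f0 i.
have fE i : i \in R -> exists2 j, (F j).1 = i & f i = (F j).2.
  move/onto => [j ij]; rewrite /f; case: pickP => [j' /eqP|/(_ j)]; first by exists j'.
  by rewrite ij eqxx.
exists f; split => [i /fE[j <- ->]|i i' /fE[j <- ->] /fE[j' <- ->] E]; first by case: (hF j).
have [_ _ _ h1] := hF j; have [_ _ _ h2] := hF j'.
by congr (F _).1; apply: dP h1 _; rewrite E.
Qed.

Lemma sdr_large (I T : finType) (f0 : I -> T) (N : I -> {set T}) (R : {set I}) :
  {in R, forall i, #|R| <= #|N i|} ->
  exists f : I -> T, {in R, forall i, f i \in N i} /\ {in R &, injective f}.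
Proof.
move=> h; apply: (hall f0) => J JR; have [->|[i iJ]] := set_0Vmem J; first by rewrite cards0.
apply: leq_trans (subset_leq_card JR) _; apply: leq_trans (h _ (subsetP JR _ iJ)) _.
exact/subset_leq_card/bigcup_sup.
Qed.

Definition nb (T : finType) (e : rel T) (V : {set T}) x := [set y in V | e x y].

Definition pairing (T I : finType) (X : {set T}) (s t : I -> T) :=
  [/\ injective s, injective t, forall i j, s i != t j & forall i, s i \in X /\ t i \in X].

(** A route is recorded as a vertex set in which its ends are connected, not as a path: sets can be
    enlarged when a contraction or an added clique is undone. Routes avoid all of [X] except their
    own ends, including the members of [X] that belong to no pair. *)
Definition routing (T I : finType) (e : rel T) (V X : {set T}) (s t : I -> T) (C : I -> {set T}) :=
  [/\ forall i, C i \subset V, forall i, C i :&: X = [set s i; t i],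
      forall i, connect (rstr e (C i)) (s i) (t i)
    & forall i j, i != j -> [disjoint C i & C j]].

Definition linked (T : finType) (e : rel T) (V X : {set T}) :=
  forall (I : finType) (s t : I -> T), pairing X s t -> exists C, routing e V X s t C.

Definition klinked (T : finType) (e : rel T) (V : {set T}) n :=
  forall X : {set T}, X \subset V -> #|X| <= n -> linked e V X.

Lemma card_pairing (T I : finType) (X : {set T}) (s t : I -> T) :
  pairing X s t -> #|[set s i | i in I] :|: [set t i | i in I]| = #|I|.*2 /\ #|I|.*2 <= #|X|.
Proof.
case=> is_ it st sX.
have E : #|[set s i | i in I] :|: [set t i | i in I]| = #|I|.*2.
  rewrite cardsU !card_imset // disjoint_setI0 ?cards0 ?subn0 ?addnn //.
  apply/disjP => z /imsetP[i _ ->] /imsetP[j _ E].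
  by have := st i j; rewrite E eqxx.
split=> //; rewrite -E; apply/subset_leq_card/subsetP => z /setUP[]/imsetP[i _ ->]; by case: (sX i).
Qed.

Lemma routing_extra (T I : finType) (e : rel T) (V X : {set T}) (s t : I -> T) (E : I -> {set T}) :
  X \subset V -> pairing X s t -> (forall i, E i \subset V :\: X) ->
  (forall i, connect (rstr e ([set s i; t i] :|: E i)) (s i) (t i)) ->
  (forall i j, i != j -> [disjoint E i & E j]) ->
  routing e V X s t (fun i => [set s i; t i] :|: E i).
Proof.
move=> XV [is_ it st sX] EV con dis; split=> //.
- move=> i; rewrite subUset (subset_trans (EV i) (subsetDl _ _)) andbT.
  by apply/subsetP => z /set2P[]->; apply: (subsetP XV); case: (sX i).
- move=> i; apply/setP => z; rewrite inE inE; have := subsetP (EV i) z.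
  case: (z \in E i) => [/(_ isT)/setDP[_ zX]|_].
    rewrite (negbTE zX) andbF; apply/esym/negbTE; apply: contra zX => /set2P[]->; by case: (sX i).
  by rewrite orbF andb_idr // => /set2P[]->; case: (sX i).
- move=> i j ij; apply/disjP => z; rewrite !inE.
  have nE k (u : T) : u \in X -> u \in E k -> False by move=> uX /(subsetP (EV k))/setDP[_]; rewrite uX.
  have [[si ti] [sj tj]] := (sX i, sX j).
  move=> /orP[/orP[]/eqP->|zi] /orP[/orP[]/eqP h|zj].
  - by move/is_: h ij => ->; rewrite eqxx.
  - by have := st i j; rewrite h eqxx.
  - exact: nE zj.
  - by have := st j i; rewrite h eqxx.
  - by move/it: h ij => ->; rewrite eqxx.
  - exact: nE zj.
  - by rewrite h in zi; apply: nE zi.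
  - by rewrite h in zi; apply: nE zi.
  - by have /disjP := dis _ _ ij; apply; eauto.
Qed.

Lemma nbP (T : finType) (e : rel T) (V : {set T}) x y : (y \in nb e V x) = (y \in V) && e x y.
Proof. by rewrite inE. Qed.

Lemma common_nb (T : finType) (e : rel T) (V : {set T}) a b :
  symmetric e -> irreflexive e -> a \in V -> b \in V -> a != b -> ~~ e a b ->
  #|nb e V a| + #|nb e V b| + 2 <= #|V| + #|nb e V a :&: nb e V b|.
Proof.
move=> se ie aV bV ab nab; rewrite -cardsUI addnAC leq_add2r.
have <- : #|[set a; b]| = 2 by rewrite cards2 ab.
have dis : [disjoint nb e V a :|: nb e V b & [set a; b]].
  apply/disjP => z; rewrite !inE => h /orP[]/eqP E; move: h; rewrite E ?ie ?(negbTE nab) ?andbF //=.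
  by rewrite se (negbTE nab) andbF.
rewrite -[X in X <= _]subn0 -(@cards0 T) -(disjoint_setI0 dis) -cardsU.
apply/subset_leq_card/subsetP => z; rewrite !inE => /orP[/orP[]/andP[]//|/orP[]/eqP->//].
Qed.

Lemma connect_step (T : finType) (e : rel T) (C : {set T}) a b :
  e a b -> a \in C -> b \in C -> connect (rstr e C) a b.
Proof. by move=> eab aC bC; apply: connect1; rewrite /rstr /= eab aC bC. Qed.

Lemma klinked_dense (T : finType) (e : rel T) (F : {set T}) d K :
  symmetric e -> irreflexive e -> {in F, forall x, d <= #|nb e F x|} ->
  3 * K <= d + 2 -> 7 * K + 3 * #|F| <= 6 * d + 10 -> klinked e F (2 * K).
Proof.
move=> se ie hd Kd num X XF cX I s t pr; have [is_ it st sX] := pr.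
have [_ cI] := card_pairing pr.
have sF i : s i \in F /\ t i \in F by have [h1 h2] := sX i; split; apply: (subsetP XF).
pose com V a b := nb e V a :&: nb e V b.
pose D := [set i | e (s i) (t i)].
pose ok (LM : {set I} * {ffun I -> T}) := [&& [disjoint LM.1 & D],
  [forall i in LM.1, LM.2 i \in com F (s i) (t i) :\: X] &
  [forall i in LM.1, forall j in LM.1, (LM.2 i == LM.2 j) ==> (i == j)]].
have ok0 : ok (set0, [ffun i => s i]).
  by apply/and3P; split; [apply/disjP => z; rewrite inE|apply/forallP => z; rewrite inE|apply/forallP => z; rewrite inE].
have [[L M] /= okLM hmax] := arg_maxnP (fun LM : {set I} * {ffun I -> T} => #|LM.1|) ok0.
have okI (L' : {set I}) (M' : I -> T) : (forall i, i \in L' -> [/\ i \notin D, M' i \in com F (s i) (t i) & M' i \notin X]) ->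
   {in L' &, injective M'} -> #|L'| <= #|L|.
  move=> h1 h2; apply: (hmax (L', [ffun i => M' i])); apply/and3P; split => /=.
  - by apply/disjP => z /h1[/negP].
  - by apply/forallP => i; apply/implyP => /h1[_ h3 h4]; rewrite ffunE inE h3 h4.
  - apply/forallP => i; apply/implyP => iL; apply/forallP => j; apply/implyP => jL.
    by rewrite !ffunE; apply/implyP => /eqP/h2->.
have [LD LM inL] : [/\ forall i, i \in L -> i \notin D,
   forall i, i \in L -> M i \in com F (s i) (t i) /\ M i \notin X & {in L &, injective M}].
  case/and3P: okLM => /= /disjP h1 /forallP h2 /forallP h3; split => [i iL|i iL|i j iL jL E].
  - by apply/negP; apply: h1.
  - by have /implyP/(_ iL)/setDP[] := h2 i.
  - have /implyP/(_ iL)/forallP/(_ j) := h3 i.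
    by rewrite jL E eqxx /= => /eqP.
clear ok0 okLM hmax ok.
pose R := ~: D :\: L; pose Ms := M @: L; pose U := F :\: (X :|: Ms).
have cMs : #|Ms| = #|L| by rewrite card_in_imset.
have RL i : i \in R -> i \notin L /\ i \notin D by rewrite !inE => /andP.
have MsF z : z \in Ms -> z \in F /\ z \notin X.
  by case/imsetP => i iL ->; have [] := LM i iL; rewrite !inE => /andP[/andP[->]].
have cU : #|F| = #|U| + #|X| + #|L|.
  rewrite -cMs -addnA; have -> : #|X| + #|Ms| = #|X :|: Ms|.
    rewrite cardsU disjoint_setI0 ?cards0 ?subn0 //; apply/disjP => z zX /MsF[_]; by rewrite zX.
  have sub : X :|: Ms \subset F by rewrite subUset XF; apply/subsetP => z /MsF[].
  by rewrite cardsDS // subnK // subset_leq_card.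
have UP z : z \in U -> [/\ z \in F, z \notin X & z \notin Ms].
  by rewrite !inE negb_or => /andP[/andP[-> ->] ->].
(* A common neighbour elsewhere could serve [i] and enlarge [L]. *)
have factA i : i \in R -> com F (s i) (t i) \subset X :|: Ms.
  move=> iR; have [iL iD] := RL i iR; apply/subsetP => z zc; apply/negPn/negP; rewrite inE negb_or => /andP[zX zM].
  have : #|i |: L| <= #|L|; last by rewrite cardsU1 iL; lia.
  apply: (okI _ (fun j => if j == i then z else M j)).
    by move=> j /setU1P[->|jL]; rewrite ?eqxx //; case: eqP => [->//|_]; case: (LM _ jL) => h1 h2; split; rewrite ?LD.
  have sp k : k \in L -> (k == i) = false by move=> kL; apply: contraNF iL => /eqP<-.
  move=> j k /setU1P[->|jL] /setU1P[->|kL]; rewrite ?eqxx ?(sp _ jL) ?(sp _ kL) //.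
  - by move=> E; case/negP: zM; rewrite E imset_f.
  - by move=> E; case/negP: zM; rewrite -E imset_f.
  - exact: inL.
(* Otherwise [M j] passes to [i] and [j] takes its common neighbour in [U] instead. *)
have factB i j : i \in R -> j \in L -> M j \in com F (s i) (t i) -> com U (s j) (t j) = set0.
  move=> iR jL Mc; have [iL iD] := RL i iR; apply/setP => z; rewrite in_set0; apply/negbTE/negP => zc.
  have [zU zcF] : z \in U /\ z \in com F (s j) (t j).
    move: zc; rewrite !inE => /andP[/andP[/andP[/norP[z1 z2] z3] z4] /andP[_ z5]].
    by rewrite z3 z4 z5 (negbTE z1) z2.
  have [zF zX zM] := UP z zU.
  have : #|i |: L| <= #|L|; last by rewrite cardsU1 iL; lia.
  have ji : j != i by apply: contraNneq iL => <-.
  apply: (okI _ (fun k => if k == i then M j else if k == j then z else M k)).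
    move=> k /setU1P[->|kL]; first by rewrite eqxx; have [_ h] := LM j jL.
    case: eqP => [E|_]; first by rewrite -E kL in iL.
    by case: eqP => [->|_]; have [] := LM k kL; split; rewrite ?LD.
  have Mz k : k \in L -> M k <> z by move=> kL E; case/negP: zM; rewrite -E imset_f.
  have sp k : k \in L -> (k == i) = false by move=> kL; apply: contraNF iL => /eqP<-.
  move=> k l /setU1P[->|kL] /setU1P[->|lL]; rewrite ?eqxx ?(sp _ kL) ?(sp _ lL) //.
  - by case: eqP => [_ /Mz//|nl /inL]; move=> /(_ jL lL) E; rewrite E in nl.
  - by case: eqP => [_ /esym/Mz//|nl /inL]; move=> /(_ kL jL) E; rewrite E in nl.
  - case: eqP => [->|nk]; case: eqP => [->|nl] //; [by move/esym/Mz|by move/Mz|exact: inL].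
have cRL : #|R| + #|L| <= #|I|.
  rewrite -cardsUI (_ : R :&: L = set0) ?cards0 ?addn0 ?max_card //.
  by apply/setP => i; rewrite !inE; case: (i \in L); rewrite ?andbF.
have nadj i : i \in R -> ~~ e (s i) (t i) by case/RL => _; rewrite inE.
have nLadj i : i \in L -> ~~ e (s i) (t i) by move/LD; rewrite inE.
have cX2 i : #|X :\: [set s i; t i]| + 2 = #|X|.
  have <- : #|[set s i; t i]| = 2 by rewrite cards2 st.
  have sub : [set s i; t i] \subset X by apply/subsetP => z /set2P[]->; case: (sX i).
  by rewrite cardsDS // subnK // subset_leq_card.
(* Since [#|X| <= 2 * K] and [#|R| + #|L| <= K], this is what [3 * K <= d + 2] provides. *)
have foot i a : i \in R -> a \in [set s i; t i] -> #|R| <= #|nb e U a|.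
  move=> iR ai; have aF : a \in F by case/set2P: ai => ->; case: (sF i).
  have nb2 : [set s i; t i] :&: nb e F a = set0.
    apply/setP => z; rewrite !inE; apply/negbTE/negP => /andP[/orP[]/eqP-> /andP[_]];
    by case/set2P: ai => ->; rewrite ?ie // ?(negbTE (nadj _ iR)) // se (negbTE (nadj _ iR)).
  have : #|nb e F a| <= #|nb e U a| + #|X :\: [set s i; t i]| + #|Ms|.
    apply: leq_trans (_ : #|nb e U a :|: (X :\: [set s i; t i]) :|: Ms| <= _); last first.
      apply: leq_trans (leq_card_setU _ _) _; rewrite leq_add2r; exact: leq_card_setU.
    apply/subset_leq_card/subsetP => z za; have := in_set0 z; rewrite -nb2 inE za andbT => z2.
    rewrite inE; case: (boolP (z \in Ms)) => zM; rewrite ?orbT // orbF inE in_setD z2 /=.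
    case: (boolP (z \in X)) => zX; rewrite ?orbT // orbF; move: za; rewrite !nbP => /andP[zF ->].
    by rewrite andbT !inE negb_or zX zM.
  have := hd _ aF; have := cX2 i; rewrite cMs; lia.
have comU a b z : z \in com U a b -> z \in U /\ z \in com F a b.
  by rewrite !inE => /andP[/andP[/andP[-> ->] ->] /andP[_ ->]].
have [R0|[i0 i0R]] := set_0Vmem R; last first.
  (* The pairs that could hand their middle vertex to [i0]. By [factB] they have no common neighbour
     in [U] either, so a vertex of [U] misses a terminal of each of them. *)
  pose J1 := [set j in L | M j \in com F (s i0) (t i0)].
  have c0 := common_nb se ie (proj1 (sF i0)) (proj2 (sF i0)) (st i0 i0) (nadj _ i0R).
  have cJ1 : #|com F (s i0) (t i0)| + 2 <= #|X| + #|J1|.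
    rewrite -(cX2 i0) addnAC leq_add2r.
    apply: leq_trans (_ : #|(X :\: [set s i0; t i0]) :|: M @: J1| <= _); last first.
      apply: leq_trans (leq_card_setU _ _) _; rewrite leq_add2l; exact: leq_imset_card.
    apply/subset_leq_card/subsetP => z zc; have /setUP[zX|/imsetP[j jL zM]] := subsetP (factA _ i0R) z zc.
      rewrite inE in_setD zX andbT; apply/orP; left; apply/negP => /set2P[]E; move: zc; rewrite E !inE ie ?andbF //.
    by rewrite inE zM imset_f ?orbT // inE jL -zM.
  have noc u i : u \in U -> i \in R :|: J1 -> ~~ (e u (s i) && e u (t i)).
    move=> uU iRJ; apply/negP => /andP[e1 e2]; have uc : u \in com U (s i) (t i).
      by rewrite inE !nbP uU (se (s i)) (se (t i)) e1 e2.
    case/setUP: iRJ => [iR|]; last by rewrite inE => /andP[iL /(factB _ _ i0R iL) E]; rewrite E inE in uc.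
    have [_ /(subsetP (factA _ iR))] := comU _ _ _ uc; have [_ h1 h2] := UP u uU.
    by rewrite inE (negbTE h1) (negbTE h2).
  have cRJ : #|R :|: J1| = #|R| + #|J1|.
    rewrite cardsU (_ : R :&: J1 = set0) ?cards0 ?subn0 //.
    by apply/setP => i; rewrite !inE; case: (i \in L); rewrite ?andbF.
  have degU u : u \in U -> d + #|R| + #|J1| <= #|nb e U u| + #|X| + #|L|.
    move=> uU; have [uF uX uM] := UP u uU.
    pose g i := if e u (s i) then t i else s i.
    have ig : injective g.
      move=> i j; rewrite /g; case: ifP => _; case: ifP => _; [exact: it|move=> E|move=> E|exact: is_].
        by have := st j i; rewrite E eqxx.
      by have := st i j; rewrite E eqxx.
    have c1 : #|R :|: J1| <= #|X :\: nb e F u|.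
      rewrite -(card_imset _ ig); apply/subset_leq_card/subsetP => _ /imsetP[i iRJ ->].
      have := noc u i uU iRJ; rewrite /g; case: ifP => [e1 /= h|e1 _].
        by rewrite inE nbP (negbTE h) andbF; case: (sX i).
      by rewrite inE nbP e1 andbF; case: (sX i).
    have c2 : #|nb e F u| <= #|nb e U u| + #|X :&: nb e F u| + #|Ms|.
      apply: leq_trans (_ : #|nb e U u :|: (X :&: nb e F u) :|: Ms| <= _); last first.
        apply: leq_trans (leq_card_setU _ _) _; rewrite leq_add2r; exact: leq_card_setU.
      apply/subset_leq_card/subsetP => z za.
      rewrite inE; case: (boolP (z \in Ms)) => zM; rewrite ?orbT // orbF in_setU in_setI za.
      case: (boolP (z \in X)) => zX; rewrite ?orbT // orbF; move: za; rewrite !nbP => /andP[zF ->].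
      by rewrite andbT !inE negb_or zX zM.
    have := hd _ uF; have := cardsID (nb e F u) X; rewrite cRJ in c1; rewrite cMs in c2; lia.
  (* Two vertices per pair of [R] will be taken as neighbours of its terminals; [#|R|] common
     neighbours must survive that, one for each pair. *)
  have comlarge u w : u \in U -> w \in U -> u != w -> ~~ e u w -> 3 * #|R| <= #|com U u w|.
    move=> uU wU uw nuw; have := common_nb se ie uU wU uw nuw; rewrite -/(com U u w).
    have := degU u uU; have := degU w wU.
    have := hd _ (proj1 (sF i0)); have := hd _ (proj2 (sF i0)).
    rewrite -/(com F (s i0) (t i0)) in c0; lia.
  pose N (ib : I * bool) := nb e U (if ib.2 then s ib.1 else t ib.1).
  pose RB := setX R [set: bool].
  have cRB : #|RB| = 2 * #|R| by rewrite cardsX cardsT card_bool mulnC.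
  have [f [fN fI]] : exists f : I * bool -> T, {in RB, forall i, f i \in N i} /\ {in RB &, injective f}.
    apply: (hall (fun ib => s ib.1)) => J JRB.
    have JR i b : (i, b) \in J -> i \in R by move/(subsetP JRB)/setXP=> [].
    (* If [J] contains both demands of a pair, their neighbourhoods in [U] are disjoint by [noc] and
       already offer [2 * #|R|] vertices. Otherwise [J] has at most [#|R|] elements and one
       neighbourhood is enough. *)
    case: (boolP [exists i, ((i, true) \in J) && ((i, false) \in J)]) => [/existsP[i /andP[i1 i2]]|].
      have iR := JR _ _ i1.
      apply: leq_trans (subset_leq_card JRB) _; rewrite cRB.
      apply: leq_trans (_ : #|N (i, true) :|: N (i, false)| <= _); last first.
        by apply: subset_leq_card; rewrite subUset !bigcup_sup.
      rewrite cardsU disjoint_setI0 ?cards0 ?subn0.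
        have := foot i (s i) iR; have := foot i (t i) iR; rewrite !inE !eqxx orbT /N /=.
        by move=> /(_ isT) + /(_ isT); lia.
      apply/disjP => z; rewrite /N /= !nbP => /andP[zU z1] /andP[_ z2].
      have /negP := noc z i zU ltac:(by rewrite inE iR); by rewrite se z1 se z2.
    rewrite negb_exists => /forallP nJ.
    have [->|[[i b] ibJ]] := set_0Vmem J; first by rewrite cards0.
    apply: leq_trans (_ : #|R| <= _).
      rewrite -(@card_in_imset _ _ fst J).
        by apply/subset_leq_card/subsetP => _ /imsetP[[j c] /JR h ->].
      move=> [j c] [k l] jc kl /= E; subst k; congr (_, _); have := nJ j.
      by case: c jc; case: l kl => // -> ->.
    apply: leq_trans (_ : #|N (i, b)| <= _); last exact/subset_leq_card/bigcup_sup.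
    by apply: (foot i); rewrite ?(JR _ _ ibJ) //=; case: b {ibJ}; rewrite !inE eqxx ?orbT.
  pose u i := f (i, true); pose w i := f (i, false).
  have inRB i b : i \in R -> (i, b) \in RB by rewrite !inE => ->.
  have uP i : i \in R -> u i \in U /\ e (s i) (u i).
    by move=> iR; have := fN _ (inRB i true iR); rewrite /N nbP => /andP.
  have wP i : i \in R -> w i \in U /\ e (t i) (w i).
    by move=> iR; have := fN _ (inRB i false iR); rewrite /N nbP => /andP.
  have uw i j : i \in R -> j \in R -> u i != w j.
    by move=> iR jR; apply/eqP => /fI; rewrite !inRB // => /(_ isT isT).
  pose R' := [set i in R | ~~ e (u i) (w i)].
  have [m [mN mI]] : exists m : I -> T, {in R', forall i, m i \in com U (u i) (w i) :\: f @: RB} /\ {in R' &, injective m}.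
    apply: (@sdr_large _ _ s) => i; rewrite inE => /andP[iR nuw].
    have c1 := comlarge _ _ (proj1 (uP i iR)) (proj1 (wP i iR)) (uw i i iR iR) nuw.
    have c2 : #|f @: RB| <= 2 * #|R| by rewrite -cRB leq_imset_card.
    have c3 : #|R'| <= #|R| by apply/subset_leq_card/subsetP => j; rewrite inE => /andP[].
    have := cardsID (f @: RB) (com U (u i) (w i)).
    have : #|com U (u i) (w i) :&: f @: RB| <= #|f @: RB| by rewrite subset_leq_card ?subsetIr.
    lia.
  pose E i := if i \in D then set0 else if i \in L then [set M i] else
     [set u i; w i] :|: (if e (u i) (w i) then set0 else [set m i]).
  exists (fun i => [set s i; t i] :|: E i).
  have cases i : [\/ i \in D, (i \notin D) /\ (i \in L) | [/\ i \notin D, i \notin L & i \in R]].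
    rewrite !in_setD !in_setC; case: (i \in D); first by constructor 1.
    by case: (i \in L); [constructor 2|constructor 3].
  have mP i : i \in R -> ~~ e (u i) (w i) -> [/\ m i \in U, e (u i) (m i), e (w i) (m i) & forall b j, j \in R -> m i != f (j, b)].
    move=> iR nuw; have /mN : i \in R' by rewrite inE iR.
    rewrite in_setD => /andP[nf]; rewrite in_setI !nbP => /andP[/andP[-> ->] /andP[_ ->]]; split=> // b j jR.
    by apply: contraNneq nf => ->; rewrite imset_f // inRB.
  have EU i z : i \in R -> z \in [set u i; w i] :|: (if e (u i) (w i) then set0 else [set m i]) -> z \in U.
    move=> iR; case/setUP => [/set2P[]->|]; [by case: (uP i iR)|by case: (wP i iR)|].
    by case: ifP => h; rewrite ?inE // => /eqP->; case: (mP i iR (negbT h)); rewrite !inE.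
  apply: routing_extra => //.
  - move=> i; rewrite /E; case: (cases i) => [->|[/negbTE-> iL]|[/negbTE-> /negbTE iL iR]]; first exact: sub0set.
      by rewrite iL sub1set inE; case: (MsF (M i)) => [|-> ->//]; rewrite imset_f.
    rewrite iL; apply/subsetP => z /EU => /(_ iR)/UP[zF zX _]; by rewrite inE zX zF.
  - move=> i; have sE z : z \in E i -> z \in [set s i; t i] :|: E i by rewrite inE => ->; rewrite orbT.
    have sS : s i \in [set s i; t i] :|: E i by rewrite !inE eqxx.
    have sT : t i \in [set s i; t i] :|: E i by rewrite !inE eqxx orbT.
    case: (cases i) => [iD|[iD iL]|[iD iL iR]].
    + by apply: connect_step => //; rewrite inE in iD.
    + have ME : M i \in [set s i; t i] :|: E i by apply: sE; rewrite /E (negbTE iD) iL inE.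
      have [] := LM i iL; rewrite !inE => /andP[/andP[_ e1] /andP[_ e2]] _.
      by apply: connect_trans (connect_step e1 _ _) (connect_step _ _ _); rewrite 1?se.
    + have [uU e1] := uP i iR; have [wU e2] := wP i iR.
      have EE : E i = [set u i; w i] :|: (if e (u i) (w i) then set0 else [set m i]).
        by rewrite /E (negbTE iD) (negbTE iL).
      have uE : u i \in [set s i; t i] :|: E i by apply: sE; rewrite EE !inE eqxx.
      have wE : w i \in [set s i; t i] :|: E i by apply: sE; rewrite EE !inE eqxx orbT.
      apply: connect_trans (connect_step e1 sS uE) _.
      apply: connect_trans (_ : connect _ _ (w i)) (connect_step _ wE sT); last by rewrite se.
      case: (boolP (e (u i) (w i))) => [h|h]; first exact: connect_step.
      have [_ e3 e4 _] := mP i iR h.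
      have mE : m i \in [set s i; t i] :|: E i by apply: sE; rewrite EE (negbTE h) !inE eqxx !orbT.
      by apply: connect_trans (connect_step e3 uE mE) (connect_step _ mE wE); rewrite se.
  - move=> i j ij; apply/disjP => z; rewrite /E.
    case: (cases i) => [->|[/negbTE-> iL]|[/negbTE-> /negbTE iL iR]]; first by rewrite inE.
      rewrite iL inE => /eqP zM.
      case: (cases j) => [->|[/negbTE-> jL]|[/negbTE-> /negbTE jL jR]]; first by rewrite inE.
        by rewrite jL inE zM => /eqP/inL h; rewrite h ?eqxx in ij.
      by rewrite jL => /EU => /(_ jR)/UP[_ _]; rewrite zM imset_f.
    rewrite iL => zi.
    case: (cases j) => [->|[/negbTE-> jL]|[/negbTE-> /negbTE jL jR]]; first by rewrite inE.
      by rewrite jL inE => /eqP zM; have /UP[_ _] := EU _ _ iR zi; rewrite zM imset_f.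
    rewrite jL; move: zi.
    have ff b c : f (i, b) <> f (j, c).
      by move/fI; rewrite !inRB // => /(_ isT isT)[Eij]; rewrite Eij eqxx in ij.
    have mm k b l : k \in R -> ~~ e (u k) (w k) -> l \in R -> m k <> f (l, b).
      by move=> kR h lR Ek; have [_ _ _ /(_ b l lR)] := mP k kR h; rewrite Ek eqxx.
    case: ifP => hi; case: ifP => hj; rewrite !inE ?orbF => zi zj.
    + by case/orP: zi zj => /eqP-> /orP[]/eqP/ff.
    + case/orP: zj => [|/eqP zm]; first by case/orP: zi => /eqP-> /orP[]/eqP/ff.
      by case/orP: zi; rewrite zm => /eqP/(mm _ _ _ jR (negbT hj) iR).
    + case/orP: zi => [|/eqP zm]; first by move=> h; case/orP: zj h => /eqP-> /orP[]/eqP/esym/ff.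
      by case/orP: zj; rewrite zm => /eqP/(mm _ _ _ iR (negbT hi) jR).
    + case/orP: zi => [zi|/eqP zm].
        case/orP: zj => [zj|/eqP zm]; first by case/orP: zi zj => /eqP-> /orP[]/eqP/ff.
        by case/orP: zi; rewrite zm => /eqP/(mm _ _ _ jR (negbT hj) iR).
      case/orP: zj => [|/eqP zm']; first by case/orP; rewrite zm => /eqP/(mm _ _ _ iR (negbT hi) jR).
      have /mI h : m i = m j by rewrite -zm.
      by move: ij; rewrite h ?eqxx // inE ?iR ?jR ?hi ?hj.
exists (fun i => [set s i; t i] :|: (if i \in D then set0 else [set M i])).
have cases i : i \in D \/ (i \notin D) /\ (i \in L).
  have := in_set0 i; rewrite -R0 !inE; case: (e _ _); first by left.
  by case: (i \in L) => //; right.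
apply: routing_extra => //.
- move=> i; case: (cases i) => [->|[/negbTE-> iL]]; first exact: sub0set.
  by rewrite sub1set inE; case: (MsF (M i)) => [|-> ->//]; rewrite imset_f.
- move=> i; case: (cases i) => [iD|[/negbTE-> iL]].
    by apply: connect_step; rewrite ?inE ?eqxx ?orbT //; rewrite inE in iD.
  have [] := LM i iL; rewrite !inE => /andP[/andP[_ e1] /andP[_ e2]] _.
  by apply: connect_trans (connect_step e1 _ _) (connect_step _ _ _); rewrite ?inE ?eqxx ?orbT // se.
- move=> i j ij; apply/disjP => z.
  case: (cases i) => [->|[/negbTE-> iL]]; first by rewrite inE.
  case: (cases j) => [->|[/negbTE-> jL]]; first by rewrite in_set0.
  by rewrite !inE => /eqP-> /eqP/inL h; rewrite h ?eqxx in ij.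
Qed.

(** * Dense graphs *)

Lemma ex_min (A : Type) (Q : A -> Prop) (f : A -> nat) :
  (exists a, Q a) -> exists a, Q a /\ forall b, Q b -> f a <= f b.
Proof.
case=> a Qa; have [n] := ubnP (f a); elim: n a Qa => // n IH a Qa le.
case: (classic (exists b, Q b /\ f b < f a)) => [[b [Qb lt]]|no].
  by apply: IH Qb _; lia.
exists a; split=> // b Qb; rewrite leqNgt; apply/negP => lt; apply: no; by exists b.
Qed.

Lemma ex_max (A : Type) (Q : A -> Prop) (f : A -> nat) B :
  (exists a, Q a) -> (forall a, Q a -> f a <= B) -> exists a, Q a /\ forall b, Q b -> f b <= f a.
Proof.
move=> ex bd; have [a [Qa h]] := ex_min (fun a => B - f a) ex.
by exists a; split=> // b Qb; have := h b Qb; have := bd a Qa; have := bd b Qb; lia.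
Qed.

Lemma leq_sum_gap (I : finType) (F G : I -> nat) i0 c :
  (forall i, F i <= G i) -> F i0 + c <= G i0 -> \sum_i F i + c <= \sum_i G i.
Proof.
move=> le h; rewrite (bigD1 i0) //= [X in _ <= X](bigD1 i0) //=.
have : \sum_(i < 0) 0 = 0 by rewrite big_ord0.
have : \sum_(i | i != i0) F i <= \sum_(i | i != i0) G i by apply: leq_sum.
lia.
Qed.

Lemma card_bigcup_disj (I T : finType) (F : I -> {set T}) :
  (forall i j, i != j -> [disjoint F i & F j]) -> #|\bigcup_i F i| = \sum_i #|F i|.
Proof.
move=> dis; rewrite -sum1_card partition_disjoint_bigcup //.
by apply: eq_bigr => i _; rewrite sum1_card.
Qed.

Lemma card_bigcup_le (I T : finType) (F : I -> {set T}) : #|\bigcup_i F i| <= \sum_i #|F i|.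
Proof.
elim/big_rec2: _ => [|i n A _ le]; first by rewrite cards0.
by apply: leq_trans (leq_card_setU _ _) _; rewrite leq_add2l.
Qed.

(** * Partial linkages of the prescribed pairs *)

Section Config.
Variables (T I : finType) (e : rel T) (V X : {set T}) (s t : I -> T).
Hypotheses (se : symmetric e) (ie : irreflexive e) (XV : X \subset V) (pr : pairing X s t).
Implicit Types (P : I -> seq T) (p : seq T) (i j : I).

Definition vpath i p := [/\ is_path e p (s i) (t i), {subset p <= V} &
  forall z, z \in p -> z \in X -> z \in [set s i; t i]].
(* [P i = [::]] means that the pair [i] is not joined. *)
Definition conf P := (forall i, P i = [::] \/ vpath i (P i)) /\
  (forall i j z, z \in P i -> z \in P j -> i = j).
Definition upd P i p j := if j == i then p else P j.
(** At most one inner vertex. The number of such paths is maximised before anything else is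
    optimised. *)
Definition short p := 0 < size p < 4.
Definition long p := 3 < size p.
Definition sg P := \sum_i nat_of_bool (short (P i)).
Definition rh P := \sum_i nat_of_bool (long (P i)).
(** The number of inner vertices in use; by truncated subtraction an unjoined pair contributes
    nothing. *)
Definition mu P := \sum_i (size (P i) - 2).
(** The terminals count as occupied even while the pair is not joined. *)
Definition Qs P i := [set s i; t i] :|: [set z in P i].
Definition Xb := X :\: \bigcup_i [set s i; t i].
Definition free P := V :\: (X :|: \bigcup_i [set z in P i]).

Lemma upd_eq P i p : upd P i p i = p. Proof. by rewrite /upd eqxx. Qed.
Lemma upd_ne P i p j : j != i -> upd P i p j = P j. Proof. by rewrite /upd => /negbTE->. Qed.

Lemma sum_upd (f : seq T -> nat) P i p :
  \sum_j f (upd P i p j) + f (P i) = \sum_j f (P j) + f p.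
Proof.
rewrite (bigD1 i) //= upd_eq [in RHS](bigD1 i) //=.
rewrite (eq_bigr (fun j => f (P j))); first (clear; lia).
by move=> j ji; rewrite upd_ne.
Qed.

Lemma sg_upd P i p : sg (upd P i p) + short (P i) = sg P + short p.
Proof. exact: (sum_upd (fun p => nat_of_bool (short p))). Qed.
Lemma rh_upd P i p : rh (upd P i p) + long (P i) = rh P + long p.
Proof. exact: (sum_upd (fun p => nat_of_bool (long p))). Qed.
Lemma mu_upd P i p : mu (upd P i p) + (size (P i) - 2) = mu P + (size p - 2).
Proof. exact: (sum_upd (fun p => size p - 2)). Qed.

Lemma conf_nil : conf (fun _ => [::]).
Proof. by split => [i|i j z]; [left|rewrite in_nil]. Qed.

Lemma conf_upd P i p : conf P -> p = [::] \/ vpath i p ->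
  (forall j z, j != i -> z \in p -> z \in P j -> False) -> conf (upd P i p).
Proof.
move=> [c1 c2] vp av; split=> [j|j k z].
  by rewrite /upd; case: eqP => [->|_].
rewrite /upd; case: eqP => [->|/eqP ji]; case: eqP => [->|/eqP ki] //.
- by move=> zp zk; case: (av _ _ ki zp zk).
- by move=> zj zp; case: (av _ _ ji zp zj).
- exact: c2.
Qed.

Lemma vpath_size i p : vpath i p -> 1 < size p.
Proof.
have [_ _ st _] := pr; case=> -[q [-> _ lq _]] _ _; case: q lq => //= st'.
by have := st i i; rewrite st' eqxx.
Qed.

Lemma vpath_mem i p : vpath i p -> s i \in p /\ t i \in p.
Proof. by case=> /is_path_mem. Qed.

Lemma vpath_uniq i p : vpath i p -> uniq p.
Proof. by case=> /is_path_uniq. Qed.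

Lemma vpath_E i p j : vpath i p -> (s j \in p -> j = i) /\ (t j \in p -> j = i).
Proof.
have [is_ it st sX] := pr; case=> _ _ h; split=> /h.
  by case: (sX j) => -> _ /(_ isT)/set2P[/is_|] // E; have := st j i; rewrite E eqxx.
by case: (sX j) => _ -> /(_ isT)/set2P[|/it] // E; have := st i j; rewrite E eqxx.
Qed.

Lemma freeP P u : conf P -> u \in free P -> [/\ u \in V, u \notin X & forall i, u \notin P i].
Proof.
move=> _; rewrite !inE negb_or => /andP[/andP[uX uP] uV]; split=> // i.
by apply: contra uP => ui; apply/bigcupP; exists i; rewrite ?inE.
Qed.

Lemma in_free P u : u \in V -> u \notin X -> (forall i, u \notin P i) -> u \in free P.
Proof.
move=> uV uX uP; rewrite !inE negb_or uX uV !andbT; apply/bigcupP => -[i _].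
by rewrite inE (negbTE (uP i)).
Qed.

Lemma Qs_cases P i : conf P -> (P i = [::] /\ Qs P i = [set s i; t i] /\ #|Qs P i| = 2) \/
  [/\ vpath i (P i), Qs P i = [set z in P i] & #|Qs P i| = size (P i)].
Proof.
have [_ _ st _] := pr; move=> [c1 _]; case: (c1 i) => [E|vp]; [left|right].
  rewrite /Qs E; split=> //; have -> : [set z in [::]] = set0 :> {set T} by apply/setP => z; rewrite !inE.
  by rewrite setU0 cards2 st.
have E : Qs P i = [set z in P i].
  by apply/setUidPr/subsetP => z /set2P[]->; rewrite inE; case: (vpath_mem vp).
by split=> //; rewrite E cardsE (card_uniqP (vpath_uniq vp)).
Qed.

Lemma card_Qs P i : conf P -> #|Qs P i| = 2 + (size (P i) - 2).
Proof.
by clear XV; move=> c; case: (Qs_cases i c) => [[-> [_ ->]]//|[vp _ ->]]; have := vpath_size vp; lia.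
Qed.

Lemma Qs_disj P i j : conf P -> i != j -> [disjoint Qs P i & Qs P j].
Proof.
have [is_ it st sX] := pr.
move=> c ij; apply/disjP => z zi zj; have [c1 c2] := c.
have key k l : z \in [set s k; t k] -> z \in P l -> k = l.
  move=> zk zl; case: (c1 l) => [E|vp]; first by rewrite E in zl.
  by have [h1 h2] := vpath_E k vp; case/set2P: zk zl => -> => [/h1|/h2].
move: zi zj; rewrite ![z \in Qs _ _]inE ![z \in [set z in _]]inE => /orP[zi|zi] /orP[zj|zj].
- case/set2P: zi zj => -> /set2P[] E.
  + by move/is_: E ij => ->; rewrite eqxx.
  + by have := st i j; rewrite E eqxx.
  + by have := st j i; rewrite E eqxx.
  + by move/it: E ij => ->; rewrite eqxx.
- by move: ij; rewrite (key _ _ zi zj) eqxx.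
- by move: ij; rewrite (key _ _ zj zi) eqxx.
- by move: ij; rewrite (c2 _ _ _ zi zj) eqxx.
Qed.

Lemma Qs_sub P i : conf P -> Qs P i \subset V.
Proof.
move=> c; have [_ _ _ sX] := pr; case: (Qs_cases i c) => [[_ [-> _]]|[[_ h _] -> _]].
  by apply/subsetP => z /set2P[]->; apply: (subsetP XV); case: (sX i).
by apply/subsetP => z; rewrite inE; apply: h.
Qed.

Lemma card_Xb : #|X| = #|Xb| + #|I|.*2.
Proof.
have [E _] := card_pairing pr; have [_ _ _ sX] := pr; rewrite -E.
have -> : [set s i | i in I] :|: [set t i | i in I] = \bigcup_i [set s i; t i].
  apply/setP => z; apply/setUP/bigcupP => [[]/imsetP[i _ ->]|[i _ /set2P[]->]].
  - by exists i; rewrite ?set21.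
  - by exists i; rewrite ?set22.
  - by left; rewrite imset_f.
  - by right; rewrite imset_f.
rewrite /Xb cardsDS ?subnK //; last first.
  by apply/bigcupsP => i _; apply/subsetP => z /set2P[]->; case: (sX i).
by apply/subset_leq_card/bigcupsP => i _; apply/subsetP => z /set2P[]->; case: (sX i).
Qed.

Lemma mem_V P z : conf P -> z \in V -> [\/ z \in free P, z \in Xb | exists i, z \in Qs P i].
Proof.
move=> c zV; case: (boolP (z \in free P)) => [|zf]; first by constructor 1.
case: (boolP (z \in \bigcup_i Qs P i)) => [/bigcupP[i _ zi]|zQ]; first by constructor 3; exists i.
constructor 2; rewrite inE; apply/andP; split.
  apply: contra zQ => /bigcupP[i _ zi]; apply/bigcupP; exists i => //.
  by rewrite inE zi.
apply: contraR zf => zX; apply: in_free => // i; apply: contra zQ => zi.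
by apply/bigcupP; exists i => //; rewrite !inE zi orbT.
Qed.

Lemma card_V P : conf P -> #|V| = #|free P| + #|Xb| + \sum_i #|Qs P i|.
Proof.
move=> c; rewrite -card_bigcup_disj; last by move=> i j; apply: Qs_disj.
have [_ _ _ sX] := pr.
have d1 : [disjoint free P & Xb].
  by apply/disjP => z /freeP-/(_ c)[_ zX _]; rewrite inE (negbTE zX) andbF.
have d2 : [disjoint free P :|: Xb & \bigcup_i Qs P i].
  apply/disjP => z + /bigcupP[i _ zi]; case/setUP => [/freeP-/(_ c)[_ zX zP]|].
    by move: zi; rewrite !inE (negbTE (zP i)) orbF => /orP[]/eqP E; move: zX; rewrite E; have [h1 h2] := sX i; rewrite ?h1 ?h2.
  rewrite inE => /andP[/negP nz zX]; apply: nz.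
  case: (Qs_cases i c) => [[_ [E _]]|[vp E _]]; rewrite E in zi; first by apply/bigcupP; exists i.
  by rewrite inE in zi; apply/bigcupP; exists i => //; case: vp => _ _; apply.
have cU (A B : {set T}) : [disjoint A & B] -> #|A| + #|B| = #|A :|: B|.
  by move=> d; rewrite cardsU disjoint_setI0 // cards0 subn0.
rewrite !cU //; apply: eq_card => z; apply/idP/idP.
  move/(mem_V c) => [h|h|[i h]]; rewrite !in_setU ?h ?orbT //.
  by apply/orP; right; apply/bigcupP; exists i.
case/setUP => [/setUP[/freeP-/(_ c)[]//|/setDP[/(subsetP XV)//]]|/bigcupP[i _]].
exact/subsetP/Qs_sub.
Qed.

Lemma sum_Qs P : conf P -> \sum_i #|Qs P i| = #|I|.*2 + mu P.
Proof.
move=> c; rewrite (eq_bigr (fun i => 2 + (size (P i) - 2))); last by move=> i _; apply: card_Qs.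
by rewrite big_split /= sum_nat_const -muln2.
Qed.

Lemma card_free P : conf P -> #|V| = #|free P| + #|X| + mu P.
Proof. by move=> c; rewrite (card_V c) (sum_Qs c) card_Xb; lia. Qed.

Lemma deg_split P u : conf P ->
  #|nb e V u| <= #|nb e (free P) u| + #|Xb| + \sum_i #|nb e (Qs P i) u|.
Proof.
move=> c; apply: leq_trans (_ : #|nb e (free P) u :|: Xb :|: \bigcup_i nb e (Qs P i) u| <= _).
  apply/subset_leq_card/subsetP => z; rewrite nbP => /andP[/(mem_V c)h ez].
  rewrite !in_setU nbP ez andbT; case: h => [->//|->|[i zi]]; rewrite ?orbT //.
  by apply/orP; right; apply/bigcupP; exists i; rewrite // nbP zi.
apply: leq_trans (leq_card_setU _ _) _; apply: leq_add (card_bigcup_le _).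
exact: leq_card_setU.
Qed.

(* The long paths that meet [p] are simply discarded. *)
Lemma short_max P i p : conf P -> (forall P', conf P' -> sg P' <= sg P) ->
  ~~ short (P i) -> vpath i p -> short p ->
  (forall j z, j != i -> short (P j) -> z \in p -> z \in P j -> False) -> False.
Proof.
move=> c mx ns vp sp av; have [c1 c2] := c.
pose P' j := if j == i then p else if has [in p] (P j) then [::] else P j.
have c' : conf P'.
  split=> [j|j k z]; first by rewrite /P'; case: eqP => [->|_]; [right|case: ifP => _; [left|]].
  rewrite /P'; case: eqP => [->|_]; case: eqP => [->|_] //.
  - by case: ifP => // /hasPn h zp /h; rewrite /= zp.
  - by case: ifP => // /hasPn h /h /= /negbTE->.
  - by do 2 case: ifP => // _; apply: c2.
have := mx _ c'; rewrite leqNgt => /negP; apply.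
rewrite -addn1 /sg; apply: (leq_sum_gap (i0 := i)).
  move=> j; rewrite /P'; case: eqP => [->|/eqP ji]; first by rewrite (negbTE ns).
  case: ifP => // /hasP[z zj zp]; case: (boolP (short (P j))) => // sj.
  by case: (av j z ji sj zp zj).
by rewrite (negbTE ns) /P' eqxx sp.
Qed.

Lemma connect_vpath i (S : {set T}) : S \subset V ->
  (forall z, z \in S -> z \in X -> z \in [set s i; t i]) ->
  connect (rstr e S) (s i) (t i) ->
  exists p, [/\ vpath i p, {subset p <= S} & size p <= #|S|].
Proof.
have [_ _ st _] := pr; move=> SV SX con; have [p pp ps] := connect_rstr con (st i i).
exists p; split=> //; last by rewrite -(card_uniqP (is_path_uniq pp)); apply/subset_leq_card/subsetP.
by split=> // z /ps; [apply: (subsetP SV)|apply: SX].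
Qed.

End Config.

Lemma is_path_size (T : finType) (e : rel T) p a b :
  is_path e p a b -> size p = (size (behead p)).+1.
Proof. by case=> q [-> _ _ _]. Qed.

Lemma join_inter (T : finType) (e : rel T) p1 p2 v b z :
  uniq (p1 ++ behead p2) -> is_path e p2 v b -> z \in p1 -> z \in p2 -> z = v.
Proof.
rewrite cat_uniq => /and3P[_ /hasPn h _] [q [E _ _ _]] z1.
by rewrite E inE => /predU1P[//|zq]; have := h z; rewrite E /= zq z1 => /(_ isT).
Qed.

Lemma is_path_loop (T : finType) (e : rel T) p a : is_path e p a a -> p = [:: a].
Proof.
by case=> -[|x q] [-> _ //= lq /andP[aq _]]; case/negP: aq; rewrite -[X in X \in _]lq mem_last.
Qed.

Lemma card_nb_seq (T : finType) (e : rel T) (l : seq T) u : uniq l ->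
  #|nb e [set z in l] u| = count (e u) l.
Proof.
move=> ul; rewrite -size_filter -(card_uniqP (filter_uniq (e u) ul)).
by apply: eq_card => z; rewrite !inE mem_filter andbC.
Qed.

(** * Joining every pair when the order is at most twice the minimum degree plus one *)

Section Dense.
Variables (T I : finType) (e : rel T) (V X : {set T}) (s t : I -> T) (delta K sigma : nat).
Hypotheses (se : symmetric e) (ie : irreflexive e) (XV : X \subset V) (pr : pairing X s t).
Hypothesis hdeg : {in V, forall x, delta <= #|nb e V x|}.
Hypotheses (hV : #|V| <= 2 * delta + 1) (hdelta : 6 * K <= delta) (hX : #|X| <= 2 * K).
(** The case in which [klinked_dense] does not already provide a linked set. *)
Hypothesis hno : forall (F : {set T}) d, F \subset V -> 0 < #|F| -> {in F, forall x, d <= #|nb e F x|} ->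
  3 * K <= d + 2 -> 7 * K + 3 * #|F| <= 6 * d + 10 -> False.
Local Notation conf := (conf e V X s t).
Local Notation vpath := (vpath e V X s t).
Local Notation free := (free V X).
Local Notation Qs := (Qs s t).
Local Notation Xb := (Xb X s t).
Hypothesis mx : forall P, conf P -> sg P <= sigma.

(** The minimum is taken with the numbers of short and of long paths both fixed, so an exchange is
    excluded as soon as it preserves these numbers and saves a vertex. *)
Definition minc P := [/\ conf P, sg P = sigma &
  forall P', conf P' -> sg P' = sigma -> rh P' = rh P -> mu P <= mu P'].

Let a P i u := #|nb e (Qs P i) u|.

Lemma cI : #|I| <= K.
Proof. by have [_ h] := card_pairing pr; arith. Qed.

Lemma minc_conf P : minc P -> conf P. Proof. by case. Qed.

(** A shortcut either preserves the numbers of short and long paths and lowers [mu], or it turns a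
    long path into a short one and exceeds [sigma]. *)
Lemma cut_path P i p : minc P -> P i <> [::] -> vpath i p ->
  (forall z, z \in p -> z \in P i \/ z \in free P) -> size p < size (P i) -> False.
Proof.
move=> [c sgP mn] nn vp sub lt; have [c1 c2] := c.
have c' : conf (upd P i p).
  apply: conf_upd => //; first by right.
  move=> j z ji /sub[zi zj|/(freeP c)[_ _ /(_ j)/negP]//].
  by rewrite (c2 _ _ _ zi zj) eqxx in ji.
have h1 := vpath_size pr vp.
have := sg_upd P i p; have := rh_upd P i p; have := mu_upd P i p.
have := mx c'; have := mn _ c'; rewrite /short /long; arith.
Qed.

Lemma nil_nshort (P : I -> seq T) i : P i = [::] -> ~~ short (P i). Proof. by move->. Qed.

(** The path through [z] would be one more short path, disjoint from the existing ones. *)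
Lemma nocommon P i z : conf P -> sg P = sigma -> ~~ short (P i) -> z \in V -> z \notin X ->
  (forall j, short (P j) -> z \notin P j) -> e (s i) z -> e (t i) z -> False.
Proof.
have [_ _ st sX] := pr; have [si ti] := sX i.
move=> c sgP ns zV zX zs e1 e2.
have sz : s i != z by apply: contraNneq zX => <-.
have zt : z != t i by apply: contraNneq zX => ->.
have vp : vpath i [:: s i; z; t i].
  split; first by exists [:: z; t i]; rewrite /= e1 se e2 !inE negb_or sz st zt.
    by move=> y; rewrite !inE => /or3P[]/eqP->//; apply: (subsetP XV).
  by move=> y; rewrite !inE => /or3P[]/eqP->; rewrite ?eqxx ?orbT // (negbTE zX).
apply: (short_max c _ ns vp) => //; first by rewrite sgP.
move=> j y ji sj; rewrite !inE => /or3P[]/eqP-> h; last 1 first.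
- have [c1 _] := c; case: (c1 j) => [E|vj]; first by rewrite E in h.
  by have [_ /(_ h) E] := vpath_E pr i vj; rewrite E eqxx in ji.
- have [c1 _] := c; case: (c1 j) => [E|vj]; first by rewrite E in h.
  by have [/(_ h) E _] := vpath_E pr i vj; rewrite E eqxx in ji.
- by case/negP: (zs _ sj).
Qed.

Lemma nonadj P i : conf P -> sg P = sigma -> ~~ short (P i) -> ~~ e (s i) (t i).
Proof.
have [_ _ st sX] := pr; have [si ti] := sX i.
move=> c sgP ns; apply/negP => e1.
have vp : vpath i [:: s i; t i].
  split; first by exists [:: t i]; rewrite /= e1 !inE st.
    by move=> y; rewrite !inE => /orP[]/eqP->//; apply: (subsetP XV).
  by move=> y; rewrite !inE => /orP[]/eqP->; rewrite ?eqxx ?orbT.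
apply: (short_max c _ ns vp) => //; first by rewrite sgP.
move=> j y ji sj; rewrite !inE; have [c1 _] := c; case: (c1 j) => [->//|vj].
have [h1 h2] := vpath_E pr i vj.
by move=> /orP[]/eqP-> => [/h1|/h2] E; rewrite E eqxx in ji.
Qed.

Lemma free_nocommon P i u : conf P -> sg P = sigma -> ~~ short (P i) -> u \in free P ->
  e u (s i) -> e u (t i) -> False.
Proof.
move=> c sgP ns /(freeP c)[uV uX uP] e1 e2.
by apply: (@nocommon P i u) => //; rewrite se.
Qed.

Lemma a_nil P i u : conf P -> sg P = sigma -> u \in free P -> P i = [::] -> a P i u <= 1.
Proof.
move=> c sgP uf E; have [_ _ st _] := pr.
rewrite /a; have -> : Qs P i = [set z in [:: s i; t i]] by apply/setP => z; rewrite /Qs E !inE orbF.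
rewrite card_nb_seq /= ?inE ?st //.
have := @free_nocommon P i u c sgP (nil_nshort E) uf.
by case: (e u (s i)) => //; case: (e u (t i)) => // /(_ isT isT).
Qed.

Lemma Qs_path P i : conf P -> P i <> [::] -> vpath i (P i) /\ Qs P i = [set z in P i].
Proof. by move=> c nn; case: (Qs_cases pr i c) => [[]//|[]]. Qed.

Lemma a_size P i u : conf P -> P i <> [::] -> a P i u = count (e u) (P i).
Proof.
move=> c nn; have [vp E] := Qs_path c nn.
by rewrite /a E card_nb_seq // (vpath_uniq vp).
Qed.

(** Four neighbours of [u] span a segment of at least four vertices, and going through [u] between
    its ends takes only three. *)
Lemma window P i u : minc P -> u \in free P -> P i <> [::] -> a P i u <= 3.
Proof.
move=> mc uf nn; have c := minc_conf mc; have [vp EQ] := Qs_path c nn.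
rewrite leqNgt; apply/negP => big; have [uV uX uP] := freeP c uf.
have hu : has (e u) (P i) by rewrite has_count -(a_size _ c nn); arith.
have [pp vpV vpX] := vp.
have [v [p1 [p2 [P1 P2 E Av fA]]]] := is_path_first pp hu.
have [_ v1] := is_path_mem P1; have [v2 _] := is_path_mem P2.
have hu2 : has (e u) p2 by apply/hasP; exists v.
have [w [q1 [q2 [Q1 Q2 E2 Aw fA2]]]] := is_path_last P2 hu2.
have [vq1 wq1] := is_path_mem Q1; have [wq2 _] := is_path_mem Q2.
have memP z : (z \in P i) = [|| z \in p1, z \in q1 | z \in q2].
  by rewrite E (mem_join _ P2 v1) E2 (mem_join _ Q2 wq1).
have cq : a P i u <= size q1.
  rewrite /a EQ -(card_uniqP (is_path_uniq Q1)); apply/subset_leq_card/subsetP => z.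
  rewrite nbP inE memP => /andP[/or3P[zp|//|zq] ez]; first by rewrite (fA z zp ez).
  by rewrite (fA2 z zq ez).
have vw : v != w by apply/eqP => vw; move: Q1; rewrite vw => /is_path_loop E3; rewrite E3 /= in cq; arith.
have up := is_path_uniq pp; have up2 := is_path_uniq P2.
have dis : [disjoint p1 & u :: q2].
  rewrite disjoint_has; apply/hasPn => z z1 /=; rewrite inE negb_or.
  have -> /= : z != u by apply: contraNneq (uP i) => <-; rewrite memP z1.
  apply/negP => z2; have zv : z = v.
    by apply: join_inter P2 z1 _; [rewrite -E|rewrite E2 (mem_join _ Q2 wq1) z2 orbT].
  by move: vw; rewrite -zv (fA2 z z2) ?eqxx // zv.
have newP : is_path e (p1 ++ u :: q2) (s i) (t i).
  apply: is_path_cat_edge P1 _ _ dis; last by rewrite se; apply: Av.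
  by apply: is_path_cons Q2 Aw _; apply: contra (uP i); rewrite memP => ->; rewrite !orbT.
have mem' z : z \in p1 ++ u :: q2 -> z \in P i \/ z = u.
  by rewrite mem_cat inE memP => /or3P[->|/eqP->|->]; rewrite ?orbT; auto.
apply: (cut_path (p := p1 ++ u :: q2) mc nn).
- split=> // z /mem' [h|->] //; [exact: vpV|exact: vpX|by rewrite (negbTE uX)].
- by move=> z /mem'[|->]; auto.
- have := congr1 size E; rewrite !size_cat /= => ->.
  have := congr1 size E2; rewrite !size_cat.
  have := is_path_size P2; have := is_path_size Q2; have := is_path_size Q1; arith.
Qed.

(** Of three neighbours two lie on the same side of [z], and the edge to the farther one is a
    shortcut. *)
Lemma chordless P i z : minc P -> z \in P i -> count (e z) (P i) <= 2.
Proof.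
move=> mc zP; have c := minc_conf mc.
have nn : P i <> [::] by move=> E; rewrite E in zP.
have [vp EQ] := Qs_path c nn; have [pp vpV vpX] := vp.
rewrite leqNgt; apply/negP => big.
have [p1 [p2 [P1 P2 E D]]] := is_path_split pp zP.
have [_ z1] := is_path_mem P1; have [z2 _] := is_path_mem P2.
have up := is_path_uniq pp; have u1 := is_path_uniq P1; have u2 := is_path_uniq P2.
have memP x : (x \in P i) = (x \in p1) || (x \in p2) by rewrite E (mem_join _ P2 z1).
have cle : count (e z) (P i) <= count (e z) p1 + count (e z) p2.
  by rewrite E count_cat leq_add2l; case: (p2) => //= y q; rewrite leq_addl.
have sz := congr1 size E; rewrite size_cat in sz.
have s2 := is_path_size P2.
have fin p : is_path e p (s i) (t i) -> {subset p <= P i} -> size p < size (P i) -> False.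
  move=> pp' sub; apply: (cut_path mc nn); last by move=> x /sub; auto.
  by split=> // x /sub; [apply: vpV|apply: vpX].
have cnt (q : seq T) : uniq q -> z \in q -> count (e z) q < size q.
  move=> uq zq; rewrite -(count_predC (e z) q) -addn1 leq_add2l -has_count.
  by apply/hasP; exists z; rewrite //= ie.
have [b1|b2] : 1 < count (e z) p1 \/ 1 < count (e z) p2 by arith.
  have h : has (e z) p1 by rewrite has_count; arith.
  have [v [q1 [q2 [Q1 Q2 E2 Av fA]]]] := is_path_first P1 h.
  have [_ vq1] := is_path_mem Q1; have [vq2 zq2] := is_path_mem Q2.
  apply: (fin (q1 ++ p2)).
  - apply: is_path_cat_edge Q1 P2 _ _; first by rewrite se; apply: Av.
    rewrite disjoint_has; apply/hasPn => x x1 /=; apply/negP => x2.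
    have xz : x = z by apply: D => //; rewrite E2 mem_cat x1.
    have : x = v by apply: (join_inter (p1 := q1) _ Q2 x1); [rewrite -E2|rewrite xz].
    by move=> xv; move: Av; rewrite -xv xz /= ie.
  - by move=> x; rewrite mem_cat memP => /orP[xq|->]; rewrite ?orbT // E2 mem_cat xq.
  - have := congr1 size E2; rewrite !size_cat; have := is_path_size Q2.
    have : count (e z) p1 <= count (e z) q2.
      rewrite -(card_nb_seq _ _ u1) -(card_nb_seq _ _ (is_path_uniq Q2)).
      apply/subset_leq_card/subsetP => x; rewrite !nbP !inE => /andP[+ ex].
      by rewrite E2 (mem_join _ Q2 vq1) ex andbT => /orP[/fA->|].
    have := cnt _ (is_path_uniq Q2) zq2; arith.
have h : has (e z) p2 by rewrite has_count; arith.
have [v [q1 [q2 [Q1 Q2 E2 Av fA]]]] := is_path_last P2 h.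
have [zq1 vq1] := is_path_mem Q1; have [vq2 _] := is_path_mem Q2.
apply: (fin (p1 ++ q2)).
- apply: (is_path_cat_edge P1 Q2 Av).
  rewrite disjoint_has; apply/hasPn => x x1 /=; apply/negP => x2.
  have xz : x = z by apply: D => //; rewrite E2 (mem_join _ Q2 vq1) x2 orbT.
  have : x = v by apply: (join_inter (p1 := q1) _ Q2 _ x2); [rewrite -E2|rewrite xz].
  by move=> xv; move: Av; rewrite -xv xz /= ie.
- by move=> x; rewrite mem_cat memP => /orP[->//|xq]; rewrite E2 (mem_join _ Q2 vq1) xq !orbT.
- have := congr1 size E2; rewrite !size_cat; have := is_path_size Q2.
  have : count (e z) p2 <= count (e z) q1.
    rewrite -(card_nb_seq _ _ u2) -(card_nb_seq _ _ (is_path_uniq Q1)).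
    apply/subset_leq_card/subsetP => x; rewrite !nbP !inE => /andP[+ ex].
    by rewrite E2 (mem_join _ Q2 vq1) ex andbT => /orP[|/fA->].
  have := cnt _ (is_path_uniq Q1) zq1; arith.
Qed.

Lemma a_le3 P i u : minc P -> u \in free P -> a P i u <= 3.
Proof.
move=> mc uf; case: (classic (P i = [::])) => [E|nn]; last exact: window.
by case: mc => c sgP _; apply: leq_trans (a_nil c sgP uf E) _.
Qed.

Lemma degfree P u : conf P -> u \in free P ->
  delta <= #|nb e (free P) u| + #|Xb| + \sum_i a P i u.
Proof.
move=> c uf; have [uV _ _] := freeP c uf.
exact: leq_trans (hdeg uV) (deg_split u c).
Qed.

(** Add the three degrees. A pair absorbs at most [#|Qs P i| + 6] neighbours, since each of the
    three vertices sees at most three vertices of a path and no more than it has; the unjoined pair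
    [i0] absorbs five fewer. With [#|V| <= 2 * delta + 1] and [#|X| <= 2 * K] the sum gives
    [delta < 6 * K]. *)
Lemma three_far P i0 y1 y2 y3 : minc P -> P i0 = [::] ->
  y1 \in free P -> y2 \in free P -> y3 \in free P ->
  #|nb e (free P) y1| + #|nb e (free P) y2| + #|nb e (free P) y3| <= #|free P| + 3 -> False.
Proof.
move=> mc E0 f1 f2 f3 h; have [c sgP _] := mc.
have h1 := degfree c f1; have h2 := degfree c f2; have h3 := degfree c f3.
have hs : \sum_i (a P i y1 + a P i y2 + a P i y3) + 5 <= \sum_i (#|Qs P i| + 6).
  apply: (leq_sum_gap (i0 := i0)) => [i|].
    case: (Qs_cases pr i c) => [[E [_ ->]]|[vp _ Es]].
      by have := a_nil c sgP f1 E; have := a_nil c sgP f2 E; have := a_nil c sgP f3 E; arith.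
    have sub u : a P i u <= #|Qs P i| by apply/subset_leq_card/subsetP => z; rewrite nbP => /andP[].
    have := a_le3 i mc f1; have := a_le3 i mc f2; have := a_le3 i mc f3.
    have := vpath_size pr vp; have := sub y1; have := sub y2; have := sub y3; rewrite Es; arith.
  rewrite (card_Qs pr i0 c) E0 /=.
  by have := a_nil c sgP f1 E0; have := a_nil c sgP f2 E0; have := a_nil c sgP f3 E0; arith.
rewrite !big_split /= sum_nat_const in hs.
rewrite (_ : #|xpredT : pred I| = #|I|) in hs; last by apply: eq_card.
have := card_V XV pr c; have := card_Xb pr; have := cI; arith.
Qed.

Definition cn (U : {set T}) y := y |: nb e U y.

Lemma card_cn U y : #|cn U y| = #|nb e U y|.+1.
Proof. by rewrite cardsU1 nbP ie andbF. Qed.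

(** The [6] is the slack [3] of [three_far] plus the three vertices themselves, which closed
    neighbourhoods count. *)
Lemma far3 P i0 y1 y2 y3 : minc P -> P i0 = [::] ->
  y1 \in free P -> y2 \in free P -> y3 \in free P ->
  [disjoint cn (free P) y1 & cn (free P) y3] -> [disjoint cn (free P) y2 & cn (free P) y3] ->
  #|cn (free P) y1 :&: cn (free P) y2| <= 6 -> False.
Proof.
move=> mc E0 f1 f2 f3 d1 d2 c12; apply: (three_far mc E0 f1 f2 f3).
have sub : cn (free P) y1 :|: cn (free P) y2 :|: cn (free P) y3 \subset free P.
  by rewrite !subUset !sub1set f1 f2 f3 /=; rewrite -andbA; apply/and3P; split; apply/subsetP => z; rewrite nbP => /andP[].
have := subset_leq_card sub; rewrite cardsU disjoint_setI0; last first.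
  by apply/disjP => z /setUP[] z1 z3; [have /disjP := d1|have /disjP := d2]; apply; eauto.
rewrite cards0 subn0; have := cardsUI (cn (free P) y1) (cn (free P) y2); rewrite !card_cn; arith.
Qed.

(** The [+ 2] comes from the two terminals of [i0], which are occupied but not neighbours of [z]: an
    edge between them would be another short path. *)
Lemma deg_st P i0 z : conf P -> sg P = sigma -> ~~ short (P i0) -> z \in [set s i0; t i0] ->
  #|nb e V z| + 2 <= #|nb e (free P) z| + #|X| + mu P /\
  nb e V z \subset nb e (free P) z :|: (V :\: free P :\: [set s i0; t i0]) /\
  #|V :\: free P :\: [set s i0; t i0]| + 2 = #|X| + mu P.
Proof.
have [_ _ st sX] := pr; have [si ti] := sX i0.
move=> c sgP ns zst.
have fV : free P \subset V by apply: subsetDl.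
have sub2 : [set s i0; t i0] \subset V :\: free P.
  by apply/subsetP => y /set2P[]->; rewrite inE (subsetP XV) // andbT; apply/negP => /(freeP c)[_]; rewrite ?si ?ti.
have c2 : #|V :\: free P :\: [set s i0; t i0]| + 2 = #|X| + mu P.
  have E2 : #|[set s i0; t i0]| = 2 by rewrite cards2 st.
  have := subset_leq_card sub2; have := card_free XV pr c.
  have := cardsDS fV; have := subset_leq_card fV; rewrite (cardsDS sub2) E2; arith.
have sub : nb e V z \subset nb e (free P) z :|: (V :\: free P :\: [set s i0; t i0]).
  apply/subsetP => y; rewrite nbP => /andP[yV ey]; rewrite !in_setU nbP ey andbT in_setD in_setD yV andbT.
  case: (y \in free P) => //=; rewrite andbT; apply/negP => y2; have na := nonadj c sgP ns.
  by case/set2P: zst y2 ey => -> /set2P[]->; rewrite ?ie // ?(negbTE na) // se (negbTE na).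
split=> //; have := subset_leq_card sub; have := (leq_card_setU (nb e (free P) z) (V :\: free P :\: [set s i0; t i0])).1.
arith.
Qed.

(** The new path must be long, as there cannot be more than [sigma] short ones. Nine vertices
    include two terminals, whence the [7]. *)
Lemma link P i0 (S : {set T}) : conf P -> sg P = sigma -> P i0 = [::] -> S \subset V ->
  (forall z, z \in S -> z \in X -> z \in [set s i0; t i0]) ->
  (forall j z, z \in S -> z \notin P j) -> #|S| <= 9 -> connect (rstr e S) (s i0) (t i0) ->
  exists P', [/\ conf P', sg P' = sigma, rh P' = rh P + 1 & mu P' <= mu P + 7].
Proof.
move=> c sgP E0 SV SX SP cS con.
have [p [vp sub sz]] := connect_vpath pr SV SX con.
have c' : conf (upd P i0 p).
  apply: conf_upd; [by []|by right|move=> j z _ /sub/(SP j)/negP//].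
exists (upd P i0 p); have := sg_upd P i0 p; have := rh_upd P i0 p; have := mu_upd P i0 p.
have := mx c'; have := vpath_size pr vp; rewrite E0 /short /long /= => *; split => //; arith.
Qed.

(** A step may stay in place, so that a route can be written with a fixed list of stations although
    some of them may coincide. *)
Definition lz : rel T := [rel x y | (x == y) || e x y].

Lemma lz_sym x y : lz x y -> lz y x.
Proof. by rewrite /lz /= se eq_sym. Qed.

Lemma lz_edge x y : e x y -> lz x y.
Proof. by rewrite /lz /= => ->; rewrite orbT. Qed.

Lemma lz_connect (S : {set T}) x q : path lz x q -> x \in S -> {subset q <= S} ->
  connect (rstr e S) x (last x q).
Proof.
elim: q x => [|y q IH] x /=; first by move=> _ _ _; apply: connect0.
case/andP => xy pq xS sub; have yS : y \in S by apply: sub; rewrite mem_head.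
apply: connect_trans (IH y pq yS _); last by move=> z zq; apply: sub; rewrite inE zq orbT.
by case/orP: xy => [/eqP->|exy]; [apply: connect0|apply: connect_step].
Qed.

Lemma cn_lz (U : {set T}) y y' : y' \in cn U y -> lz y y'.
Proof. by case/setU1P => [->|]; rewrite /lz /= ?eqxx // nbP => /andP[_ ->]; rewrite orbT. Qed.

Lemma cn_in (U : {set T}) y y' : y \in U -> y' \in cn U y -> y' \in U.
Proof. by move=> yU; case/setU1P => [->//|]; rewrite nbP => /andP[]. Qed.

Lemma terminal_notin P i0 j z : conf P -> P i0 = [::] -> z \in [set s i0; t i0] -> z \notin P j.
Proof.
move=> [c1 _] E0 z2; apply/negP => zj; case: (c1 j) => [E|vj]; first by rewrite E in zj.
have [h1 h2] := vpath_E pr i0 vj.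
have E : i0 = j by case/set2P: z2 zj => -> => [/h1|/h2].
by rewrite -E E0 in zj.
Qed.

Lemma link_free P i0 q : conf P -> sg P = sigma -> P i0 = [::] ->
  path lz (s i0) (rcons q (t i0)) -> {subset q <= free P} -> size q <= 7 ->
  exists P', [/\ conf P', sg P' = sigma, rh P' = rh P + 1 & mu P' <= mu P + 7].
Proof.
have [_ _ _ sX] := pr; have [si ti] := sX i0.
move=> c sgP E0 pq qf sz.
have sub z : z \in s i0 :: rcons q (t i0) -> (z \in [set s i0; t i0]) \/ (z \in free P).
  rewrite inE mem_rcons inE => /or3P[/eqP->|/eqP->|/qf]; rewrite ?set21 ?set22; auto.
apply: (link (i0 := i0) (S := [set z in s i0 :: rcons q (t i0)])) => //.
- apply/subsetP => z; rewrite inE => /sub [/set2P[]->|/(freeP c)[]//]; exact: (subsetP XV).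
- by move=> z; rewrite inE => /sub [//|/(freeP c)[_ /negbTE->]].
- by move=> j z; rewrite inE => /sub [|/(freeP c)[]//]; apply: terminal_notin.
- apply: leq_trans (_ : size (s i0 :: rcons q (t i0)) <= 9); last by rewrite /= size_rcons.
  apply: leq_trans (card_size _); by apply: subset_leq_card; apply/subsetP => z; rewrite inE.
- have := lz_connect (S := [set z in s i0 :: rcons q (t i0)]) pq; rewrite last_rcons; apply.
    by rewrite !inE eqxx.
  by move=> z zq; rewrite inE inE zq orbT.
Qed.

(** If seven free vertices never suffice, the free vertices split into a part [C] next to [s i0] and
    a part [D] next to [t i0] with no edges between them. By [hno] both parts have small minimum
    degree, attained at [u] and [w] say, and by [keyi] the paths absorb too few neighbours of [u]
    and [w] together to make up for it. *)
Lemma new_long_path P0 i0 : minc P0 -> P0 i0 = [::] -> #|X| + mu P0 <= delta ->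
  exists P', [/\ conf P', sg P' = sigma, rh P' = rh P0 + 1 & mu P' <= mu P0 + 7].
Proof.
have [_ _ st sX] := pr; have [si ti] := sX i0.
move=> mc0 E0 small; apply: NNPP => no.
pose good P := [/\ minc P, P i0 = [::], rh P = rh P0 & mu P = mu P0].
have good0 : good P0 by [].
have nolink P q : good P -> path lz (s i0) (rcons q (t i0)) -> all [in free P] q ->
    size q <= 7 -> False.
  case=> -[c sgP _] En rhP muP pq sub sz; apply: no; rewrite -rhP -muP.
  exact: link_free pq (allP sub) sz.
have two P z : good P -> z \in [set s i0; t i0] -> 1 < #|nb e (free P) z|.
  move=> [[c sgP _] En _ muP] z2; have [h _] := deg_st c sgP (nil_nshort En) z2.
  have zV : z \in V by case/set2P: z2 => ->; apply: (subsetP XV).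
  have := hdeg zV; arith.
have ex1 P z : good P -> z \in [set s i0; t i0] -> exists y, y \in nb e (free P) z.
  by move=> g z2; apply/card_gt0P; apply: ltn_trans (two P z g z2).
pose sepC (PC : (I -> seq T) * {set T}) := [/\ good PC.1, PC.2 \subset free PC.1,
  forall z, z \in nb e (free PC.1) (s i0) -> z \in PC.2,
  forall z, z \in nb e (free PC.1) (t i0) -> z \notin PC.2
  & forall x y, x \in PC.2 -> y \in free PC.1 -> y \notin PC.2 -> ~~ e x y].
have exC : exists PC, sepC PC.
  have [y1] := ex1 P0 _ good0 (set21 _ _); have [y3] := ex1 P0 _ good0 (set22 _ _).
  rewrite !nbP => /andP[f3 e3] /andP[f1 e1]; set U := free P0.
  have l1 := lz_edge e1; have l3 := lz_sym (lz_edge e3).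
  have d13 : [disjoint cn U y1 & cn U y3].
    apply/disjP => y yy1 yy3; apply: (nolink P0 [:: y1; y; y3]) => //=.
      by rewrite l1 (cn_lz yy1) (lz_sym (cn_lz yy3)) l3.
    by rewrite f1 f3 (cn_in f1 yy1).
  (* By [far3] every free vertex is within distance two of [y1] or of [y3]. An edge leaving [C]
     would therefore yield a connection through six free vertices. *)
  pose C := [set y in U | ~~ [disjoint cn U y1 & cn U y]].
  have CP y : y \in C -> exists2 b, b \in cn U y1 & b \in cn U y.
    rewrite inE => /andP[_ nd]; apply: NNPP => nb; case/negP: nd; apply/disjP => b b1 b2; apply: nb; by exists b.
  have DP y : y \in U -> y \notin C -> exists2 b, b \in cn U y3 & b \in cn U y.
    move=> yU; rewrite inE yU negbK /= => d; apply: NNPP => nb; apply: (far3 mc0 E0 f1 f3 yU d).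
      by apply/disjP => b b1 b2; apply: nb; exists b.
    by rewrite disjoint_setI0 // cards0.
  have CU : C \subset U by apply/subsetP => y; rewrite inE => /andP[].
  exists (P0, C); split => //=.
  - move=> z; rewrite nbP => /andP[zU ez]; apply/negPn/negP => /(DP _ zU)[b b3 bz].
    apply: (nolink P0 [:: z; b; y3]) => //=.
      by rewrite (lz_edge ez) (cn_lz bz) (lz_sym (cn_lz b3)) l3.
    by rewrite zU (cn_in zU bz) ?f1 ?f3.
  - move=> z; rewrite nbP => /andP[zU ez]; apply/negP => /CP[b b1 bz].
    apply: (nolink P0 [:: y1; b; z]) => //=.
      by rewrite l1 (cn_lz b1) (lz_sym (cn_lz bz)) (lz_sym (lz_edge ez)).
    by rewrite zU (cn_in zU bz) ?f1 ?f3.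
  - move=> x y xC yU /(DP _ yU)[d d3 dy]; apply/negP => exy; have [b b1 bx] := CP x xC.
    have xU := subsetP CU x xC.
    apply: (nolink P0 [:: y1; b; x; y; d; y3]) => //=.
      by rewrite l1 (cn_lz b1) (lz_sym (cn_lz bx)) (lz_edge exy) (cn_lz dy) (lz_sym (cn_lz d3)) l3.
    by rewrite f1 (cn_in xU bx) xU yU (cn_in yU dy) f3.
(* The minimum ranges over the configurations as well, because [freeing] exchanges a vertex of [C]
   for a vertex of a path. *)
have [[P C] [[g CU Cs Ct Ccl] hmin]] := ex_min (fun PC : (I -> seq T) * {set T} => #|PC.2|) exC.
clear exC; rewrite /= in g CU Cs Ct Ccl hmin; have [mc En rhP muP] := g; have [c sgP mn] := mc.
set U := free P in CU Cs Ct Ccl *; pose D := U :\: C.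
have DP y : (y \in D) = (y \in U) && (y \notin C) by rewrite inE andbC.
have cnC y z : y \in C -> z \in cn U y -> z \in C.
  move=> yC /setU1P[->//|]; rewrite nbP => /andP[zU ez]; apply/negPn/negP => zC.
  by have := Ccl y z yC zU zC; rewrite ez.
have cnD y z : y \in D -> z \in cn U y -> z \in D.
  rewrite DP => /andP[yU yC] /setU1P[->|]; first by rewrite DP yU.
  rewrite nbP DP => /andP[zU ez]; rewrite zU /=; apply/negP => zC.
  by have := Ccl z y zC yU yC; rewrite se ez.
have CD y z w : y \in C -> z \in D -> w \in cn U y -> w \in cn U z -> False.
  by move=> yC zD /(cnC _ _ yC) wC /(cnD _ _ zD); rewrite DP wC andbF.
have [z0] := ex1 P _ g (set21 _ _); have [w0] := ex1 P _ g (set22 _ _).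
move=> w0t z0s; have w0C := Ct _ w0t; have z0C := Cs _ z0s.
move: (w0t) (z0s); rewrite !nbP => /andP[w0U ew0] /andP[z0U ez0].
have w0D : w0 \in D by rewrite DP w0U.
have UC y : y \in C -> y \in U by move/(subsetP CU).
have UD y : y \in D -> y \in U by rewrite DP => /andP[].
(* The bound in [far3] leaves room for a forbidden vertex [u], the one that [freeing] moves onto a
   path. *)
have nearC y1 y2 u : y1 \in C -> y2 \in C -> exists y, [/\ y \in C, y != u, y \in cn U y1 & y \in cn U y2].
  move=> h1 h2; apply: NNPP => nx; apply: (far3 mc En (UC _ h1) (UC _ h2) w0U).
  - by apply/disjP => z; apply: CD h1 w0D.
  - by apply/disjP => z; apply: CD h2 w0D.
  - apply: leq_trans (_ : #|[set u]| <= 6); last by rewrite cards1.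
    apply/subset_leq_card/subsetP => y; case/setIP => k1 k2; rewrite in_set1.
    by apply/negPn/negP => yu; apply: nx; exists y; split=> //; apply: cnC k1.
have nearD y1 y2 : y1 \in D -> y2 \in D -> exists y, [/\ y \in D, y \in cn U y1 & y \in cn U y2].
  move=> h1 h2; apply: NNPP => nx; apply: (far3 mc En (UD _ h1) (UD _ h2) z0U).
  - by apply/disjP => z k1 k2; apply: CD z0C h1 k2 k1.
  - by apply/disjP => z k1 k2; apply: CD z0C h2 k2 k1.
  - rewrite disjoint_setI0 ?cards0 //; apply/disjP => y k1 k2; apply: nx; exists y; split=> //; exact: cnD k1.
(* Put [u] on the path in place of [x]. If [x] is adjacent to [s i0] or to a vertex of [C] other
   than [u], there is a connection through [x] and [w] with at most seven inner vertices. If not,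
   [C :\ u] is a smaller set of the same kind for the new configuration. *)
have freeing i u x w p' : u \in C -> w \in D -> x \in P i -> x \notin X -> vpath i p' ->
    size p' = size (P i) -> (forall z, (z \in p') = (z == u) || (z != x) && (z \in P i)) -> e x w -> False.
  move=> uC wD xP xX vp sz mp exw; have [c1 c2] := c; have uU := UC _ uC; have wU := UD _ wD.
  have [uV uX uP] := freeP c uU.
  have xV : x \in V.
    by case: (c1 i) => [E|[_ h _]]; [rewrite E in xP|apply: h].
  pose P1 := upd P i p'.
  have conf1 : conf P1.
    apply: conf_upd => //; first by right.
    move=> j z ji; rewrite mp => /orP[/eqP-> h|/andP[_ h1] h2]; first by case/negP: (uP j).
    by rewrite (c2 _ _ _ h1 h2) eqxx in ji.
  have E1 := mu_upd P i p'; have E2 := rh_upd P i p'; have E3 := sg_upd P i p'.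
  rewrite -/P1 /short /long sz in E1 E2 E3.
  have sg1 : sg P1 = sigma by arith.
  have rh1 : rh P1 = rh P by arith.
  have mu1 : mu P1 = mu P by arith.
  have mc1 : minc P1 by split=> // P' h1 h2; rewrite rh1 mu1; apply: mn.
  have ii0 : i0 != i by apply/eqP => E; rewrite -E En in xP.
  have g1 : good P1 by split=> //; rewrite ?rh1 ?mu1 // /P1 upd_ne.
  have xf : x \in free P1.
    apply: in_free => // j; rewrite /P1; case: (eqVneq j i) => [->|ji]; rewrite ?upd_eq ?upd_ne //.
      by rewrite mp eqxx /= orbF; apply: contraNneq (uP i) => <-.
    by apply/negP => xj; move: ji; rewrite (c2 _ _ _ xj xP) eqxx.
  have ff z : z \in U -> z != u -> z \in free P1.
    move=> /(freeP c)[zV zX zP] zu; apply: in_free => // j.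
    rewrite /P1; case: (eqVneq j i) => [->|ji]; rewrite ?upd_eq ?upd_ne //.
    by rewrite mp (negbTE zu) (negbTE (zP i)) andbF.
  have ff' z : z \in free P1 -> z = x \/ z \in U /\ z != u.
    move=> /(freeP conf1)[zV zX zP]; case: (eqVneq z x) => [|zx]; [by left|right].
    have := zP i; rewrite /P1 upd_eq mp zx /= negb_or => /andP[-> zi]; split=> //.
    apply: in_free => // j; case: (eqVneq j i) => [->//|ji].
    by have := zP j; rewrite /P1 upd_ne.
  have ffD z : z \in D -> z \in free P1.
    by move=> zD; apply: ff (UD _ zD) _; apply: contraTneq zD => ->; rewrite DP uC andbF.
  have [y' [y'D y'1 y'2]] := nearD w w0 wD w0D.
  have tailP : path lz x [:: w; y'; w0; t i0].
    by rewrite /= (lz_edge exw) (cn_lz y'1) (lz_sym (cn_lz y'2)) (lz_sym (lz_edge ew0)).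
  case: (boolP (e (s i0) x)) => [esx|nsx].
    apply: (nolink P1 [:: x; w; y'; w0]) => //.
      have : path lz (s i0) [:: x] by rewrite /= (lz_edge esx).
      by move=> /andP[k _]; rewrite [path _ _ _]/= k.
    by rewrite /= xf !ffD.
  case: (boolP [exists u' in C, (u' != u) && e x u']) => [/existsP[u' /and3P[u'C u'u exu]]|].
    have [z1 z1s z1u] : exists2 z, z \in nb e U (s i0) & z != u.
      have := two P _ g (set21 _ _); rewrite (cardsD1 u) => h.
      have /card_gt0P[z] : 0 < #|nb e U (s i0) :\ u| by move: h; rewrite -/U; case: (u \in _) => /=; arith.
      by rewrite in_setD1 => /andP[zu zs]; exists z.
    have z1C := Cs _ z1s; move: z1s; rewrite nbP => /andP[z1U ez1].
    have [y [yC yu y1 y2]] := nearC z1 u' u z1C u'C.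
    apply: (nolink P1 [:: z1; y; u'; x; w; y'; w0]) => //.
      have hd : path lz (s i0) [:: z1; y; u'; x].
        by rewrite /= (lz_edge ez1) (cn_lz y1) (lz_sym (cn_lz y2)) lz_edge // se.
      have := cat_path lz (s i0) [:: z1; y; u'; x] [:: w; y'; w0; t i0].
      by rewrite hd [last _ _]/= tailP; apply.
    by rewrite /= (ff z1) // (ff y) ?UC // (ff u') ?UC // xf !ffD.
  rewrite negb_exists => /forallP nx.
  have nxC u' : u' \in C -> u' != u -> ~~ e x u'.
    by move=> h1 h2; have := nx u'; rewrite h1 h2.
  have : #|C| <= #|C :\ u|; last by rewrite (cardsD1 u C) uC; arith.
  apply: (hmin (P1, C :\ u)); split => //=.
  - by apply/subsetP => z /setD1P[zu zC]; apply: ff; rewrite ?UC.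
  - move=> z; rewrite nbP => /andP[/ff'[->|[zU zu]] ez]; first by rewrite ez in nsx.
    by rewrite in_setD1 zu Cs // nbP zU.
  - move=> z; rewrite nbP => /andP[/ff'[->|[zU zu]] ez].
      rewrite in_setD1 negb_and orbC; apply/orP; left; apply/negP => /UC/(freeP c)[_ _ /(_ i)].
      by rewrite xP.
    by rewrite in_setD1 negb_and Ct ?orbT // nbP zU.
  - move=> z y /setD1P[zu zC] /ff'[->|[yU yu]]; first by rewrite se nxC.
    by rewrite in_setD1 yu => /= yC; apply: Ccl.
(* Since both counts are at most 3, only a path with three or four vertices could violate this, and
   only with both counts equal to 3. There [u] can replace a neighbour of [w] on the path, so
   [freeing] applies. *)
have keyi i u w : u \in C -> w \in D -> 2 * (a P i u + a P i w) <= #|Qs P i| + 7.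
  move=> uC wD; have uU := UC _ uC; have wU := UD _ wD.
  have [uV uX uP] := freeP c uU.
  have l1 := a_le3 i mc uU; have l2 := a_le3 i mc wU.
  case: (Qs_cases pr i c) => [[E [_ ->]]|[vp EQ Es]].
    by have := a_nil c sgP uU E; have := a_nil c sgP wU E; arith.
  have nn : P i <> [::] by move=> E; have := vpath_size pr vp; rewrite E.
  have [pp vpV vpX] := vp; have [q [Eq pq lq uq]] := pp.
  have mkX x : x \in P i -> x != s i -> x != t i -> x \notin X.
    by move=> xP xs xt; apply/negP => /(vpX _ xP) /set2P[]E; [move: xs|move: xt]; rewrite E eqxx.
  have us : s i != u by apply: contraNneq (uP i) => <-; case: (vpath_mem vp).
  have ut : u != t i by apply: contraNneq (uP i) => ->; case: (vpath_mem vp).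
  have mkv p : is_path e p (s i) (t i) -> (forall z, z \in p -> z = u \/ z \in P i) -> vpath i p.
    move=> ppp sub; split=> // z /sub[->|]; [by []|exact: vpV|by rewrite (negbTE uX)|exact: vpX].
  rewrite Es; have := a_size u c nn; have := a_size w c nn; rewrite Eq.
  case: q Eq pq lq uq => [|x [|y [|y1 [|y2 q]]]] Eq pq lq uq /=.
  - by arith.
  - rewrite !addn0 => -> ->; case: (e w _); case: (e w _); case: (e u _); case: (e u _) => /=; arith.
  - move: lq => /= lq; subst y; move: pq => /= /and3P[e1 e2 _] hw hu; rewrite leqNgt; apply/negP => big.
    have [a1 a2] : a P i u = 3 /\ a P i w = 3 by arith.
    rewrite hu in a1; rewrite hw in a2.
    have [eus eux eut] : [/\ e u (s i), e u x & e u (t i)] by move: a1; do 3 case: (e u _).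
    have ewx : e w x by move: a2; case: (e w x) => //; do 2 case: (e w _).
    have [sx xt] : s i != x /\ x != t i.
      by move: uq; rewrite Eq /= !inE negb_or => /and3P[/andP[-> _] -> _].
    have xP : x \in P i by rewrite Eq !inE eqxx orbT.
    have xu : x != u by apply: contraNneq (uP i) => <-.
    apply: (freeing i u x w [:: s i; u; t i]) => //.
    + by apply: mkX; rewrite // eq_sym.
    + apply: mkv; last by move=> z; rewrite Eq !inE => /or3P[/eqP->|/eqP->|/eqP->]; rewrite ?eqxx ?orbT; auto.
      exists [:: u; t i]; rewrite /= se eus eut !inE negb_or us ut.
      by rewrite st.
    + by rewrite Eq.
    + move=> z; rewrite Eq !inE; case: (eqVneq z u) => [->|zu]; rewrite ?orbT //=.
      case: (eqVneq z x) => [->|zx]; rewrite ?orbF //=.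
      by rewrite eq_sym (negbTE sx) (negbTE xt).
    + by rewrite se.
  - move: lq => /= lq; subst y1; move: pq => /= /and4P[e1 e2 e3 _] hw hu; rewrite leqNgt; apply/negP => big.
    have [a1 a2] : a P i u = 3 /\ a P i w = 3 by arith.
    rewrite hu in a1; rewrite hw in a2.
    have ns : ~~ short (P i) by rewrite Eq.
    have ncu := free_nocommon c sgP ns uU; have ncw := free_nocommon c sgP ns wU.
    have [ewx ewy] : e w x /\ e w y.
      move: ncw a2; case: (e w (s i)); case: (e w (t i)); case: (e w x); case: (e w y) => // h _; by case: h.
    have [[eux euy] eust] : (e u x /\ e u y) /\ (e u (s i) \/ e u (t i)).
      move: ncu a1; case: (e u (s i)); case: (e u (t i)); case: (e u x); case: (e u y) => // h _; auto; by case: h.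
    have [sx sy xy] : [/\ s i != x, s i != y & x != y].
      by move: uq; rewrite Eq /= !inE !negb_or => /and4P[/and3P[-> -> _] /andP[-> _] _ _].
    have [xt yt] : x != t i /\ y != t i.
      by move: uq; rewrite Eq /= !inE !negb_or => /and4P[_ /andP[_ ->] -> _].
    have xP : x \in P i by rewrite Eq !inE eqxx orbT.
    have yP : y \in P i by rewrite Eq !inE eqxx !orbT.
    have xu : x != u by apply: contraNneq (uP i) => <-.
    have yu : y != u by apply: contraNneq (uP i) => <-.
    have [ux uy] : u != x /\ u != y by rewrite ![u == _]eq_sym.
    case: eust => [eus|eut].
      apply: (freeing i u x w [:: s i; u; y; t i]) => //.
      + by apply: mkX; rewrite // eq_sym.
      + apply: mkv; last by move=> z; rewrite Eq !inE => /or4P[]/eqP->; rewrite ?eqxx ?orbT; auto.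
        by exists [:: u; y; t i]; rewrite /= se eus euy e3 !inE !negb_or us sy st uy ut yt.
      + by rewrite Eq.
      + move=> z; rewrite Eq !inE; case: (eqVneq z u) => [->|zu]; rewrite ?orbT //=.
        case: (eqVneq z x) => [->|zx]; rewrite ?orbF //=.
        by rewrite eq_sym (negbTE sx) (negbTE xt) (negbTE xy).
      + by rewrite se.
    apply: (freeing i u y w [:: s i; x; u; t i]) => //.
    + by apply: mkX; rewrite // eq_sym.
    + apply: mkv; last by move=> z; rewrite Eq !inE => /or4P[]/eqP->; rewrite ?eqxx ?orbT; auto.
      by exists [:: x; u; t i]; rewrite /= e1 [e x u]se eux eut !inE !negb_or us sx st xu ut xt.
    + by rewrite Eq.
    + move=> z; rewrite Eq !inE; case: (eqVneq z u) => [->|zu]; rewrite ?orbT //=.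
      case: (eqVneq z y) => [->|zy]; rewrite ?orbF //=.
      by rewrite eq_sym (negbTE sy) (negbTE yt) eq_sym (negbTE xy).
    + by rewrite se.
  - by move=> *; arith.
have nbC x : x \in C -> nb e C x = nb e U x.
  move=> xC; apply/setP => y; rewrite !nbP; apply/andP/andP => -[h exy]; split; rewrite ?UC //.
  by apply/negPn/negP => yC; have := Ccl x y xC h yC; rewrite exy.
have nbD x : x \in D -> nb e D x = nb e U x.
  move=> xD; apply/setP => y; rewrite !nbP; apply/andP/andP => -[h exy]; split; rewrite ?UD //.
  by apply: (cnD _ _ xD); rewrite /cn in_setU1 nbP h exy orbT.
have [u uC umin] := arg_minnP (fun x => #|nb e U x|) z0C.
have [w wD wmin] := arg_minnP (fun x => #|nb e U x|) w0D.
(* This secures the first degree condition of [hno], so only the second can fail. *)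
have dlow x : x \in U -> 3 * K + 2 <= #|nb e U x|.
  move=> xU; have h1 := degfree c xU.
  have h2 : \sum_i a P i x + 2 <= \sum_(i : I) 3.
    apply: (leq_sum_gap (i0 := i0)) => [i|]; first exact: a_le3.
    by have := a_nil c sgP xU En; arith.
  rewrite sum_nat_const (_ : #|xpredT : pred I| = #|I|) in h2; last by apply: eq_card.
  rewrite -/U in h1; have := card_Xb pr; have := cI; arith.
have fV : U \subset V by apply: subsetDl.
have hs : \sum_i 2 * (a P i u + a P i w) + 5 <= \sum_i (#|Qs P i| + 7).
  apply: (leq_sum_gap (i0 := i0)) => [i|]; first exact: keyi.
  rewrite (card_Qs pr i0 c) En /=.
  by have := a_nil c sgP (UC _ uC) En; have := a_nil c sgP (UD _ wD) En; arith.
rewrite -big_distrr !big_split /= sum_nat_const (_ : #|xpredT : pred I| = #|I|) in hs; last by apply: eq_card.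
have hC := hno (F := C) (d := #|nb e U u|) (subset_trans CU fV) ltac:(by apply/card_gt0P; exists u) ltac:(by move=> x xC; rewrite nbC //; apply: umin).
have hD := hno (F := D) (d := #|nb e U w|) (subset_trans (subsetDl _ _) fV) ltac:(by apply/card_gt0P; exists w) ltac:(by move=> x xD; rewrite nbD //; apply: wmin).
have cCD : #|U| = #|C| + #|D|.
  by rewrite -(cardsID C U) (setIidPr CU).
have d1 := dlow _ (UC _ uC); have d2 := dlow _ (UD _ wD).
have f1 := degfree c (UC _ uC); have f2 := degfree c (UD _ wD).
have k1 := card_V XV pr c; have k2 := card_Xb pr; have k3 := cI.
have nC : 6 * #|nb e U u| + 10 < 7 * K + 3 * #|C|.
  rewrite ltnNge; apply/negP => h; apply: hC h; move: d1; clear; lia.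
have nD : 6 * #|nb e U w| + 10 < 7 * K + 3 * #|D|.
  rewrite ltnNge; apply/negP => h; apply: hD h; move: d2; clear; lia.
(* As [#|Xb| <= 2 * K - 2 * #|I|], the inequalities combine to [6 * delta + 34 <= 35 * K], against
   [6 * K <= delta]. *)
move: f1 f2; rewrite -/U; move: k1; rewrite -/U; arith.
Qed.

(* The new route of [i0] is exchanged for the longer path [P i]. *)
Lemma steal P i i0 q x y : minc P -> P i0 = [::] -> long (P i) ->
  (x = s i0 /\ y = t i0) \/ (x = t i0 /\ y = s i0) ->
  path lz x (rcons q y) -> (forall z, z \in q -> (z \in free P) || (z \in P i) && (z \notin X)) ->
  size q + 2 < size (P i) -> False.
Proof.
have [_ _ st sX] := pr; have [si ti] := sX i0.
move=> mc En lg xy pq qf sz; have [c sgP mn] := mc; have [c1 c2] := c.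
have ii0 : i0 != i by apply/eqP => E; rewrite -E En in lg.
have iV z : z \in P i -> z \in V.
  by case: (c1 i) => [E|[_ h _]]; [rewrite E|apply: h].
pose S := [set z in x :: rcons q y].
have xy2 : x \in [set s i0; t i0] /\ y \in [set s i0; t i0].
  by case: xy => -[-> ->]; rewrite set21 set22.
have sub z : z \in S -> z \in [set s i0; t i0] \/ (z \in free P) || (z \in P i) && (z \notin X).
  by rewrite inE inE mem_rcons inE => /or3P[/eqP->|/eqP->|/qf]; case: xy2; auto.
have con : connect (rstr e S) (s i0) (t i0).
  have h : connect (rstr e S) x y.
    have := lz_connect (S := S) pq; rewrite last_rcons; apply; first by rewrite !inE eqxx.
    by move=> z zq; rewrite inE inE zq orbT.
  case: xy h => -[-> ->] //; rewrite (sym_connect_sym _) //.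
  by move=> u v; rewrite /rstr /= se; congr (_ && _); apply: andbC.
have SV : S \subset V.
  apply/subsetP => z /sub[/set2P[]->|/orP[/(freeP c)[]//|/andP[/iV]//]]; exact: (subsetP XV).
have SX z : z \in S -> z \in X -> z \in [set s i0; t i0].
  by move=> /sub[//|/orP[/(freeP c)[_ /negbTE->]//|/andP[_ /negbTE->]//]].
have [p [vp psub psz]] := connect_vpath pr SV SX con.
have cS : #|S| <= size q + 2.
  apply: leq_trans (_ : size (x :: rcons q y) <= _); last by rewrite /= size_rcons addn2.
  apply: leq_trans (card_size _); by apply: subset_leq_card; apply/subsetP => z; rewrite inE.
pose P1 := upd P i [::]; pose P2 := upd P1 i0 p.
have conf1 : conf P1 by apply: conf_upd; [|left|].
have conf2 : conf P2.
  apply: conf_upd => //; first by right.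
  move=> j z ji0 /psub/sub zS; rewrite /P1; case: (eqVneq j i) => [->|ji]; rewrite ?upd_eq ?upd_ne //.
  case: zS => [/terminal_notin|/orP[/(freeP c)[_ _ h]|/andP[h1 _] h2]].
  - by move=> h; apply/negP; apply: h En.
  - exact/negP.
  - by rewrite (c2 _ _ _ h1 h2) eqxx in ji.
have e1 := mu_upd P i [::]; have e2 := rh_upd P i [::]; have e3 := sg_upd P i [::].
have e4 := mu_upd P1 i0 p; have e5 := rh_upd P1 i0 p; have e6 := sg_upd P1 i0 p.
have En1 : P1 i0 = [::] by rewrite /P1 upd_ne.
rewrite -/P1 -/P2 En1 /= in e1 e2 e3 e4 e5 e6.
have h1 := vpath_size pr vp; have h2 := mx conf2; have h3 := mn P2 conf2.
move: lg e1 e2 e3 e4 e5 e6 h3; rewrite /short /long /=; arith.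
Qed.

Definition il (P : I -> seq T) i := if long (P i) then size (P i) - 2 else 0.

Lemma mu_il P : conf P -> mu P <= sg P + \sum_i il P i.
Proof.
move=> c; rewrite -big_split /=; apply: leq_sum => i _; rewrite /il /long /short.
by case: (Qs_cases pr i c) => [[-> _]//|[/(vpath_size pr)]]; case: ifP => /=; arith.
Qed.

Lemma count_kinds (P : I -> seq T) i0 : P i0 = [::] -> sg P + rh P + 1 <= #|I|.
Proof.
move=> En; have -> : #|I| = \sum_(i : I) 1 by rewrite sum1_card; apply: eq_card.
rewrite /sg /rh -big_split /=; apply: (leq_sum_gap (i0 := i0)).
  by move=> i; rewrite /short /long; arith.
by rewrite En.
Qed.

Lemma sg_compl (P : I -> seq T) : #|[set j | ~~ short (P j)]| + sg P = #|I|.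
Proof.
have -> : sg P = #|[set j | short (P j)]|.
  by rewrite /sg -sum1_card [RHS]big_mkcond /=; apply: eq_bigr => j _; rewrite inE; case: (short _).
rewrite -(cardC [set j | short (P j)]) addnC; congr (_ + _).
by apply: eq_card => j; rewrite !inE.
Qed.

(** Each new long path raises [#|X| + mu P] by at most 7, and this excludes the moment at which
    [delta] is first passed. Few vertices are then free, so any two of them are at distance at most
    two. A route for [i0] through free vertices, and possibly one vertex of a long path, is so short
    that [steal] can trade a longer path for it. *)
Lemma interior_not_large P i0 : minc P -> P i0 = [::] -> 1 < rh P ->
  delta < #|X| + mu P -> #|X| + mu P <= delta + 7 -> False.
Proof.
have [is_ it st sX] := pr; have [si ti] := sX i0.
move=> mc En rh2 lo hi; have [c sgP mn] := mc; have [c1 c2] := c.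
set U := free P; have ns0 := nil_nshort En.
have [_ cm] := card_pairing pr; have cIK := cI.
have kinds := count_kinds En; have muil := mu_il c.
have sil : 3 * K + 1 + (#|I| - sigma) <= \sum_i il P i by move: kinds muil; rewrite sgP; arith.
(* Two long paths and an unjoined pair give [#|I| - sigma >= 3], hence also [K >= 3]. *)
have big13 : 13 <= \sum_i il P i by move: kinds; rewrite sgP; arith.
(* Together two free vertices have fewer than [6 * K] neighbours outside [U], while [#|U| <= delta];
   so nonadjacent ones share a free neighbour. *)
have share u w : u \in U -> w \in U -> exists2 m, m \in U & lz u m && lz m w.
  move=> uU wU; case: (eqVneq u w) => [->|uw]; first by exists w; rewrite // /lz /= eqxx.
  case: (boolP (e u w)) => [euw|nuw]; first by exists w; rewrite // (lz_edge euw) /lz /= eqxx.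
  have h := common_nb se ie uU wU uw nuw; have h1 := degfree c uU; have h2 := degfree c wU.
  have hs : \sum_i (a P i u + a P i w) + 4 <= \sum_(i : I) 6.
    apply: (leq_sum_gap (i0 := i0)) => [i|].
      by have := a_le3 i mc uU; have := a_le3 i mc wU; arith.
    by have := a_nil c sgP uU En; have := a_nil c sgP wU En; arith.
  rewrite big_split /= sum_nat_const (_ : #|xpredT : pred I| = #|I|) in hs; last by apply: eq_card.
  have cf := card_free XV pr c; have cX := card_Xb pr; rewrite -/U in h1 h2 cf.
  have /card_gt0P[m] : 0 < #|nb e U u :&: nb e U w| by arith.
  rewrite in_setI !nbP => /andP[/andP[mU eum] /andP[_ ewm]].
  by exists m; rewrite // (lz_edge eum) (lz_sym (lz_edge ewm)).
pose W := V :\: U :\: [set s i0; t i0].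
have [d_s [sub_s cW]] := deg_st c sgP ns0 (set21 (s i0) (t i0)).
have [d_t [sub_t _]] := deg_st c sgP ns0 (set22 (s i0) (t i0)).
rewrite -/U -/W in d_s d_t sub_s sub_t cW.
pose In i := [set z in P i] :\: [set s i; t i].
have longne i : long (P i) -> P i <> [::] by move=> + E; rewrite E.
have cIn i : long (P i) -> #|In i| = il P i.
  move=> lg; have [vp EQ] := Qs_path c (longne _ lg); have [h1 h2] := vpath_mem vp.
  have sub : [set s i; t i] \subset [set z in P i] by apply/subsetP => z /set2P[]->; rewrite inE.
  by rewrite /il lg cardsDS // cardsE (card_uniqP (vpath_uniq vp)) cards2 st.
have InP i z : long (P i) -> z \in In i -> [/\ z \in P i, z \in V, z \notin X & z \in W].
  move=> lg; have [[pp vpV vpX] EQ] := Qs_path c (longne _ lg).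
  rewrite inE [z \in [set z in P i]]inE => /andP[z2 zP].
  have zX : z \notin X by apply: contra z2; apply: vpX.
  split=> //; first exact: vpV.
  rewrite in_setD in_setD vpV // andbT; apply/andP; split.
    by apply: contra zX => /set2P[]->.
  by apply/negP => /(freeP c)[_ _ /(_ i)]; rewrite zP.
have dIn i j : i != j -> [disjoint In i & In j].
  move=> ij; apply/disjP => z /setDP[zi _] /setDP[zj _]; rewrite !inE in zi zj.
  by move: ij; rewrite (c2 _ _ _ zi zj) eqxx.
have bigIn (Q : pred I) : (forall i, Q i -> long (P i)) ->
    #|\bigcup_(i | Q i) In i| = \sum_(i | Q i) il P i.
  move=> Ql; rewrite (eq_bigl (fun i => i \in [set i | Q i])); last by move=> i; rewrite inE.
  rewrite [RHS](eq_bigr (fun i => #|In i|)); last by move=> i /Ql/cIn.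
  rewrite [LHS](_ : _ = #|\bigcup_i (if Q i then In i else set0)|); last first.
    by congr #|pred_of_set _|; rewrite big_mkcond /=; apply: eq_bigr => i _; rewrite inE.
  rewrite card_bigcup_disj; last first.
    move=> i j ij; case: ifP => _; last by apply/disjP => z; rewrite inE.
    by case: ifP => _; [apply: dIn|apply/disjP => z _; rewrite inE].
  by rewrite [RHS]big_mkcond; apply: eq_bigr => i _; case: ifP; rewrite ?cards0.
have sil' : \sum_i il P i = \sum_(i | long (P i)) il P i.
  rewrite [RHS]big_mkcond; apply: eq_bigr => i _; rewrite /il; by case: ifP.
(* All neighbours of [z], at least [delta] of them, lie in [W], which has at most [delta + 5]
   vertices. *)
have poor z : z \in [set s i0; t i0] -> nb e U z = set0 -> #|W :\: nb e V z| <= 5.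
  move=> z2 E0; have zV : z \in V by case/set2P: z2 => ->; apply: (subsetP XV).
  have sub : nb e V z \subset W.
    by case/set2P: z2 E0 => -> E0; [move: sub_s|move: sub_t]; rewrite E0 set0U.
  have := subset_leq_card sub; rewrite cardsDS //; have := hdeg zV; arith.
have noboth i z : long (P i) -> z \in In i -> e (s i0) z -> e (t i0) z -> False.
  move=> lg /(InP _ _ lg)[zP zV zX _]; apply: (nocommon c sgP ns0) => // j sj.
  apply/negP => zj; move: sj lg; rewrite (c2 _ _ _ zj zP) /short /long; arith.
have exlong : exists2 i, long (P i) & 5 <= il P i.
  apply: NNPP => no.
  have : \sum_i il P i <= \sum_i (long (P i) * 4).
    apply: leq_sum => i _; rewrite /il; case: ifP => // lg; rewrite mul1n leqNgt; apply/negP => h.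
    by apply: no; exists i; rewrite // /il lg.
  rewrite -big_distrl /= -/(rh P); move: sil kinds; rewrite sgP; arith.
(* Only [y] has a free neighbour, so a route has to leave [x] through an inner vertex of a long
   path. *)
have main x y : (x = s i0 /\ y = t i0) \/ (x = t i0 /\ y = s i0) -> nb e U x = set0 ->
    (exists w, w \in nb e U y) -> False.
  move=> xy x0 [w]; rewrite nbP => /andP[wU eyw].
  have x2 : x \in [set s i0; t i0] by case: xy => -[-> _]; rewrite ?set21 ?set22.
  have px := poor x x2 x0.
  (* A free neighbour of [z] would open a route with four inner vertices, shorter than [P i]. So [z]
     misses at most six occupied vertices. Among these are all other vertices of its path but two,
     and a terminal of every other pair not joined by a short path. *)
  have claim i z : long (P i) -> 5 <= il P i -> z \in In i -> e x z -> il P i + (#|I| - sigma) <= 8.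
    move=> lg il5 zI exz; have [zP zV zX zW] := InP i z lg zI.
    have nn := longne i lg; have [vp EQ] := Qs_path c nn.
    have zU0 : nb e U z = set0.
      apply/setP => u; rewrite nbP in_set0; apply/negbTE/negP => /andP[uU ezu].
      have [m mU /andP[lum lmw]] := share u w uU wU.
      apply: (steal (i := i) (q := [:: z; u; m; w]) mc En lg xy).
      - by rewrite /= (lz_edge exz) (lz_edge ezu) lum lmw (lz_sym (lz_edge eyw)).
      - move=> v; rewrite !in_cons in_nil orbF -/U => /or4P[]/eqP->; rewrite ?zP ?zX ?orbT ?uU ?mU ?wU //.
      - by move: il5; rewrite /il lg /=; arith.
    have subz : nb e V z \subset V :\: U :\ z.
      apply/subsetP => v; rewrite nbP => /andP[vV ezv]; rewrite in_setD1 in_setD vV andbT.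
      have := in_set0 v; rewrite -zU0 nbP ezv andbT => ->; rewrite andbT.
      by apply: contraTneq ezv => ->; rewrite ie.
    have zVU : z \in V :\: U by case/setDP: zW.
    have cVU : #|V :\: U| = #|X| + mu P.
      rewrite cardsDS ?subsetDl //; have := card_free XV pr c; rewrite -/U; arith.
    have c6 : #|(V :\: U :\ z) :\: nb e V z| <= 6.
      rewrite cardsDS //; have := cardsD1 z (V :\: U); rewrite zVU cVU; have := hdeg zV.
      have := subset_leq_card subz; arith.
    pose A1 := [set v in P i] :\ z :\: nb e [set v in P i] z.
    pose R := [set j | ~~ short (P j)] :\ i.
    pose g j := if e z (s j) then t j else s j.
    have ig : injective g.
      move=> j k; rewrite /g; case: ifP => _; case: ifP => _; [exact: it|move=> E|move=> E|exact: is_].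
        by have := st k j; rewrite E eqxx.
      by have := st j k; rewrite E eqxx.
    have nsi : ~~ short (P i) by move: lg; rewrite /short /long; arith.
    have nzs j : short (P j) -> z \notin P j.
      move=> sj; apply/negP => zj; move: sj lg; rewrite (c2 _ _ _ zj zP) /short /long; arith.
    have gX j : g j \in X by rewrite /g; case: ifP; case: (sX j).
    have XU v : v \in X -> v \in V :\: U.
      by move=> vX; rewrite in_setD (subsetP XV) // andbT; apply/negP => /(freeP c)[_]; rewrite vX.
    have cA1 : il P i <= #|A1| + 1.
      have k1 := chordless mc zP.
      have ziP : z \in [set v in P i] by rewrite inE.
      have k2 : #|nb e [set v in P i] z| <= 2 by rewrite card_nb_seq // (vpath_uniq vp).
      have k3 := cardsD1 z [set v in P i]; rewrite ziP cardsE (card_uniqP (vpath_uniq vp)) in k3.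
      have k4 := cardsID (nb e [set v in P i] z) ([set v in P i] :\ z).
      have k5 : #|([set v in P i] :\ z) :&: nb e [set v in P i] z| <= #|nb e [set v in P i] z|.
        by rewrite subset_leq_card ?subsetIr.
      rewrite -/A1 in k4; move: lg; rewrite /il => ->; arith.
    have cR : #|R| + 1 = #|I| - sigma.
      have := sg_compl P; rewrite sgP (cardsD1 i) inE nsi -/R; arith.
    have sub : A1 :|: g @: R \subset (V :\: U :\ z) :\: nb e V z.
      apply/subsetP => v /setUP[|/imsetP[j jR ->]].
        case/setDP => /setD1P[vz vP] h; rewrite inE in vP; rewrite nbP inE vP /= in h.
        have vV : v \in V by have [_ h1 _] := vp; apply: h1.
        rewrite in_setD nbP negb_and h orbT in_setD1 vz in_setD vV andbT.
        by apply/negP => /(freeP c)[_ _ /(_ i)]; rewrite vP.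
      case/setD1P: jR => ji; rewrite inE => nsj.
      rewrite in_setD in_setD1 XU // andbT nbP negb_and; apply/andP; split.
        rewrite /g; case: ifP => [e1|->]; rewrite ?orbT //; apply/orP; right; apply/negP => e2.
        by apply: (nocommon c sgP nsj zV zX nzs); rewrite se.
      by apply: contraNneq zX => <-.
    have dis : [disjoint A1 & g @: R].
      apply/disjP => v /setDP[/setD1P[_ vP] _] /imsetP[j /setD1P[ji _] E]; rewrite inE E /g in vP.
      have [h1 h2] := vpath_E pr j vp.
      by move: vP ji; case: ifP => _ => [/h2|/h1] ->; rewrite eqxx.
    have := subset_leq_card sub; rewrite cardsU disjoint_setI0 // cards0 subn0 card_imset //.
    by arith.
  have ex6 i : long (P i) -> 6 <= il P i -> exists2 z, z \in In i & e x z.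
    move=> lg il6; apply: NNPP => no.
    have : #|In i| <= #|W :\: nb e V x|; last by rewrite cIn //; arith.
    apply/subset_leq_card/subsetP => z zI; have [zP zV zX zW] := InP i z lg zI.
    rewrite in_setD zW andbT nbP zV /=; apply/negP => exz; apply: no; by exists z.
  have [i lg [il5 [z zI exz]]] : exists2 i, long (P i) & 5 <= il P i /\ exists2 z, z \in In i & e x z.
    apply: NNPP => no; have [i1 lg1 il1] := exlong.
    have h5 : \sum_(i | long (P i) && (4 < il P i)) il P i <= 5.
      rewrite -bigIn; last by move=> i /andP[].
      apply: leq_trans px; apply/subset_leq_card/bigcupsP => i /andP[lg il5]; apply/subsetP => z zI.
      have [zP zV zX zW] := InP i z lg zI.
      rewrite in_setD zW andbT nbP zV /=; apply/negP => exz; apply: no; exists i => //; split=> //; by exists z.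
    pose G j := if long (P j) && (4 < il P j) then il P j else 0.
    have hG : \sum_j G j <= 5 by rewrite /G -big_mkcond.
    have : \sum_i il P i + 4 <= \sum_j G j + rh P * 4.
      have -> : \sum_j G j + rh P * 4 = \sum_j (G j + long (P j) * 4) by rewrite big_split /= -big_distrl.
      apply: (leq_sum_gap (i0 := i1)) => [i|]; last by rewrite /G lg1 il1 mul1n.
      rewrite /G; case: (boolP (long (P i))) => lg; last by rewrite /il (negbTE lg).
      by case: ifP => /= h; move: h; arith.
    move: hG sil kinds; rewrite sgP; arith.
  have k1 := claim i z lg il5 zI exz.
  (* With six inner vertices one is adjacent to [x], since [x] misses at most five; but [claim] and
     [#|I| - sigma >= 3] allow no more than five. *)
  have k2 : \sum_i il P i <= \sum_i (long (P i) * 5).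
    apply: leq_sum => j _; case: (boolP (long (P j))) => lj; last by rewrite /il (negbTE lj).
    rewrite mul1n leqNgt; apply/negP => l6; have [y' yI exy] := ex6 j lj l6.
    have := claim j y' lj (ltnW l6) yI exy; move: l6 kinds; rewrite sgP; move: rh2; clear; lia.
  rewrite -big_distrl /= -/(rh P) in k2; move: kinds; rewrite sgP; arith.
have [i lg il5] := exlong.
have [s0|[z zs]] := set_0Vmem (nb e U (s i0)); have [t0|[w wt]] := set_0Vmem (nb e U (t i0)).
- have ps := poor _ (set21 _ _) s0; have pt := poor _ (set22 _ _) t0.
  have : #|\bigcup_(i | long (P i)) In i| <= #|(W :\: nb e V (s i0)) :|: (W :\: nb e V (t i0))|.
    apply/subset_leq_card/bigcupsP => j lj; apply/subsetP => z zI.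
    have [zP zV zX zW] := InP j z lj zI; have inWD (B : {set T}) : (z \in W :\: B) = (z \notin B) by rewrite in_setD zW andbT.
    rewrite in_setU !inWD !nbP zV /= -negb_and.
    by apply/negP => /andP[]; apply: noboth lj zI.
  rewrite bigIn // -sil'; have := (leq_card_setU (W :\: nb e V (s i0)) (W :\: nb e V (t i0))).1; arith.
- by apply: (main (s i0) (t i0)) => //; [left|exists w].
- by apply: (main (t i0) (s i0)) => //; [right|exists z].
move: zs wt; rewrite !nbP => /andP[zU esz] /andP[wU etw]; have [m mU /andP[lzm lmw]] := share z w zU wU.
apply: (steal (i := i) (q := [:: z; m; w]) mc En lg (or_introl (conj erefl erefl))).
- by rewrite /= (lz_edge esz) lzm lmw (lz_sym (lz_edge etw)).
- by move=> v; rewrite !in_cons in_nil orbF -/U => /or3P[]/eqP->; rewrite ?zU ?mU ?wU.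
- by move: il5; rewrite /il lg /=; arith.
Qed.

(** While some pair is unjoined, a long path can always be added without pushing [#|X| + mu P]
    beyond [delta], and this would produce more long paths than pairs. [interior_not_large] needs
    two long paths; for the first one [mu] is at most [sigma + 7], which is harmless when
    [1 < K]. *)
Lemma all_pairs_routed : 1 < K -> (exists P, conf P /\ sg P = sigma) ->
  exists P, conf P /\ forall i, P i <> [::].
Proof.
move=> K2 [P0 [c0 sg0]]; apply: NNPP => no.
have exnil P : conf P -> exists i, P i = [::].
  move=> c; apply: NNPP => nn; apply: no; exists P; split=> // i E; apply: nn; by exists i.
have all_rho r : exists P, [/\ conf P, sg P = sigma, rh P = r, #|X| + mu P <= delta & r = 0 -> mu P <= sigma].
  elim: r => [|r [P [c sgP rhP small zero]]].
    pose P j := if long (P0 j) then [::] else P0 j; have [c1 c2] := c0.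
    have c : conf P.
      split=> [j|j k z]; first by rewrite /P; case: ifP; auto.
      by rewrite /P; case: ifP => // _; case: ifP => // _; apply: c2.
    have sgP : sg P = sigma.
      by rewrite -sg0; apply: eq_bigr => j _; rewrite /P; case: ifP => //; rewrite /long /short; case: (size _) => [|[|[|[|]]]].
    have rhP : rh P = 0 by rewrite /rh big1 // => j _; rewrite /P; case: ifP => // ->.
    have muP : mu P <= sigma.
      rewrite -sgP; apply: leq_sum => j _; rewrite /P; case: ifP => // h; case: (c1 j) => [->//|/(vpath_size pr)].
      by move: h; rewrite /long /short; arith.
    have [i En] := exnil P c; have k1 := count_kinds En; have k2 := cI.
    by exists P; split=> //; rewrite sgP in k1; arith.
  have [Pm [[cm [sgm rhm]] mnm]] := ex_min (Q := fun P => conf P /\ sg P = sigma /\ rh P = r) (@mu T I)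
    (ex_intro _ P (conj c (conj sgP rhP))).
  have mcm : minc Pm by split=> // P' h1 h2 h3; apply: mnm; rewrite h2 h3.
  have lem := mnm P (conj c (conj sgP rhP)).
  have [i En] := exnil Pm cm.
  have smallm : #|X| + mu Pm <= delta by arith.
  have [P1 [cP1 sgP1 rhP1 muP1]] := new_long_path mcm En smallm.
  have [Q [[cq [sgq rhq]] mnq]] := ex_min (Q := fun P => conf P /\ sg P = sigma /\ rh P = r.+1) (@mu T I)
    (ex_intro _ P1 (conj cP1 (conj sgP1 (etrans rhP1 (etrans (congr1 (addn^~ 1) rhm) (addn1 r)))))).
  have mcq : minc Q by split=> // P' h1 h2 h3; apply: mnq; rewrite h2 h3.
  have leq1 := mnq P1 (conj cP1 (conj sgP1 (etrans rhP1 (etrans (congr1 (addn^~ 1) rhm) (addn1 r))))).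
  exists Q; split=> //.
  have [j Enq] := exnil Q cq; have kq := count_kinds Enq; have cI' := cI.
  rewrite leqNgt; apply/negP => lo.
  case: r rhm rhP rhP1 rhq zero mnm mnq => [|r] rhm rhP rhP1 rhq zero mnm mnq.
    have := zero erefl; move: kq; rewrite sgq rhq; arith.
  by apply: (interior_not_large mcq Enq _ lo); rewrite ?rhq //; arith.
have [P [c _ rhP _ _]] := all_rho #|I|.+1; have [i En] := exnil P c.
by have := count_kinds En; rewrite rhP; arith.
Qed.

End Dense.

(** Either a subset of [V] satisfies the hypotheses of [klinked_dense], or the absence of such a
    subset allows every pairing in [V] itself to be joined. *)
Lemma dense_linked (T : finType) (e : rel T) (V : {set T}) delta K :
  symmetric e -> irreflexive e -> {in V, forall x, delta <= #|nb e V x|} ->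
  0 < #|V| -> #|V| <= 2 * delta + 1 -> 6 * K <= delta -> 1 < K ->
  exists F : {set T}, [/\ F \subset V, 2 * K < #|F| & klinked e F (2 * K)].
Proof.
move=> se ie hdeg V0 hV hdelta K2.
have big (F : {set T}) d : 0 < #|F| -> {in F, forall x, d <= #|nb e F x|} -> d < #|F|.
  move=> /card_gt0P[x xF] /(_ x xF) h; apply: leq_ltn_trans h _; apply: proper_card; apply/properP; split.
    by apply/subsetP => y; rewrite nbP => /andP[].
  by exists x; rewrite // nbP ie andbF.
apply: NNPP => no.
have hno (F : {set T}) d : F \subset V -> 0 < #|F| -> {in F, forall x, d <= #|nb e F x|} ->
    3 * K <= d + 2 -> 7 * K + 3 * #|F| <= 6 * d + 10 -> False.
  move=> FV F0 hd h1 h2; apply: no; exists F; split=> //; last exact: klinked_dense hd h1 h2.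
  by have := big F d F0 hd; arith.
apply: no; exists V; split=> //; first by have := big V delta V0 hdeg; arith.
move=> X XV hX I s t pr.
have bd (P : I -> seq T) : conf e V X s t P -> sg P <= #|I|.
  move=> _; have -> : #|I| = \sum_(i : I) 1 by rewrite sum1_card; apply: eq_card.
  by apply: leq_sum => i _; case: (short _).
have [P0 [c0 mx]] := ex_max (f := @sg T I) (ex_intro _ _ (conf_nil e V X s t)) bd.
have [P [[c1 c2] nn]] := all_pairs_routed se ie XV pr hdeg hV hdelta hX hno mx K2 (ex_intro _ P0 (conj c0 erefl)).
have vp i : vpath e V X s t i (P i) by case: (c1 i) => // /nn.
exists (fun i => [set z in P i]); split.
- by move=> i; apply/subsetP => z; rewrite inE; have [_ h _] := vp i; apply: h.
- move=> i; have [h1 h2] := vpath_mem (vp i); have [_ _ _ sX] := pr; have [si ti] := sX i.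
  apply/setP => z; rewrite in_setI inE; apply/andP/idP => [[zP zX]|].
    by have [_ _ h] := vp i; apply: h.
  by case/set2P => ->.
- move=> i; have [pp _ _] := vp i; apply: is_path_connect pp _ => z; by rewrite inE.
- move=> i j ij; apply/disjP => z; rewrite !inE => zi zj.
  by move: ij; rewrite (c2 _ _ _ zi zj) eqxx.
Qed.

(** * Massed pairs *)

Lemma connect_mono (T : finType) (e e' : rel T) (C C' : {set T}) x y :
  C \subset C' -> {in C &, forall a b, e a b -> e' a b} ->
  connect (rstr e C) x y -> connect (rstr e' C') x y.
Proof.
move=> sub he; apply: connect_sub => a b /and3P[eab aC bC].
by apply: connect_step; rewrite ?he // (subsetP sub).
Qed.

Lemma connect_rstrC (T : finType) (e : rel T) (C : {set T}) x y : symmetric e ->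
  connect (rstr e C) x y = connect (rstr e C) y x.
Proof.
move=> se; apply: sym_connect_sym => u v; rewrite /rstr /= se; congr (_ && _); exact: andbC.
Qed.

Lemma is_path_connect_set (T : finType) (e : rel T) (C : {set T}) p a b :
  is_path e p a b -> {subset p <= C} -> connect (rstr e C) a b.
Proof. exact: is_path_connect. Qed.

(** The terminals are carried along [P] to the far ends. All far ends are put into [Y], not only
    those in use, so that a route inside [B] touches no path but its own two. *)
Lemma extend_linked (T : finType) (e : rel T) (V A B S : {set T}) n (P : 'I_n -> seq T) :
  symmetric e -> #|A| <= n -> linkage e A B P -> (forall i, {subset P i <= V}) -> B \subset V ->
  (forall i z, z \in P i -> z \in B -> z \in S) ->
  (forall Y : {set T}, Y \subset S -> #|Y| <= n -> linked e B Y) -> linked e V A.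
Proof.
move=> se An [hP dP] PV BV PS lkS I s t pr; have [is_ it st sX] := pr.
have {}hP i : exists ab : T * T, [/\ is_path e (P i) ab.1 ab.2, ab.1 \in A, ab.2 \in B,
     (forall z, z \in P i -> z \in A -> z = ab.1) & (forall z, z \in P i -> z \in B -> z = ab.2)].
  by have [a [b h]] := hP i; exists (a, b).
have [F hF] := fin_all_exists hP.
have mF i : (F i).1 \in P i /\ (F i).2 \in P i by case: (hF i) => /is_path_mem.
have i1 : injective (fun i => (F i).1).
  by move=> i j E; apply: dP (proj1 (mF i)) _; rewrite E; case: (mF j).
have i2 : injective (fun i => (F i).2).
  by move=> i j E; apply: dP (proj2 (mF i)) _; rewrite E; case: (mF j).
have onto a : a \in A -> exists i, a = (F i).1.
  by apply: (injK_onto i1); rewrite ?card_ord // => i; case: (hF i).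
have [js hs] := fin_all_exists (fun i => onto _ (proj1 (sX i))).
have [jt ht] := fin_all_exists (fun i => onto _ (proj2 (sX i))).
pose Y := [set (F i).2 | i : 'I_n].
have YF i : (F i).2 \in Y by apply: imset_f.
have PY i z : z \in P i -> z \in B -> z \in Y.
  by move=> zP zB; have [_ _ _ _ h] := hF i; rewrite (h z zP zB).
have lk : linked e B Y.
  apply: lkS; last by rewrite -[X in _ <= X]card_ord; apply: leq_imset_card.
  by apply/subsetP => _ /imsetP[i _ ->]; apply: (PS i); [case: (mF i)|case: (hF i)].
have [C [CB CY con dis]] : exists C, routing e B Y (fun i => (F (js i)).2) (fun i => (F (jt i)).2) C.
  apply: lk; split.
  - by move=> i j /i2 E; apply: is_; rewrite !hs E.
  - by move=> i j /i2 E; apply: it; rewrite !ht E.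
  - by move=> i j; apply/eqP => /i2 E; have := st i j; rewrite hs ht E eqxx.
  - by move=> i; rewrite !YF.
have CP i j z : z \in C i -> z \in P j -> j = js i \/ j = jt i.
  move=> zC zP; have zB := subsetP (CB i) z zC.
  have zF : z = (F j).2 by case: (hF j) => _ _ _ _; apply.
  have : z \in C i :&: Y by rewrite in_setI zC (PY j).
  by rewrite CY zF => /set2P[]/i2; auto.
have mC i z : (z \in [set x in P (js i)] :|: [set x in P (jt i)] :|: C i) =
    ((z \in P (js i)) || (z \in P (jt i))) || (z \in C i).
  by rewrite !in_setU; congr ((_ || _) || _); rewrite inE.
exists (fun i => [set z in P (js i)] :|: [set z in P (jt i)] :|: C i); split.
- by move=> i; rewrite !subUset (subset_trans (CB i) BV) andbT; apply/andP; split; apply/subsetP => z; rewrite inE; apply: PV.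
- move=> i; apply/setP => z; rewrite in_setI mC in_set2; apply/andP/idP.
    have key j : z \in P j -> z \in A -> z = (F j).1 by case: (hF j) => _ _ _ + _; apply.
    case=> /orP[/orP[]|] zP zA; first by rewrite (key _ zP zA) -hs eqxx.
      by rewrite (key _ zP zA) -ht eqxx orbT.
    have [j zj] := onto z zA; have zPj : z \in P j by rewrite zj; case: (mF j).
    by case: (CP i j z zP zPj) => Ej; rewrite zj Ej -?hs -?ht eqxx ?orbT.
  by case/orP=> /eqP->; case: (sX i) => h1 h2; rewrite ?h1 ?h2 ?hs ?ht; split=> //;
     [case: (mF (js i)) => ->|case: (mF (jt i)) => ->]; rewrite ?orbT.
- move=> i; set S' := _ :|: C i.
  have c1 : connect (rstr e S') (s i) (F (js i)).2.
    by rewrite [s i]hs; case: (hF (js i)) => pp _ _ _ _; apply: is_path_connect_set pp _ => z zp; rewrite !inE zp.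
  have c2 : connect (rstr e S') (t i) (F (jt i)).2.
    by rewrite [t i]ht; case: (hF (jt i)) => pp _ _ _ _; apply: is_path_connect_set pp _ => z zp; rewrite !inE zp orbT.
  apply: connect_trans c1 _; rewrite connect_rstrC //; apply: connect_trans c2 _; rewrite connect_rstrC //.
  by apply: connect_mono (con i) => //; apply: subsetUr.
- move=> i j ij; apply/disjP => z; rewrite !mC.
  have neqs : js i <> js j by move=> E; move: ij; rewrite (is_ i j) ?eqxx // !hs E.
  have neqt : jt i <> jt j by move=> E; move: ij; rewrite (it i j) ?eqxx // !ht E.
  have neqst k l : js k <> jt l by move=> E; have := st k l; rewrite hs ht E eqxx.
  move=> /orP[/orP[]|] zi /orP[/orP[]|] zj.
  + exact/neqs/(dP _ _ _ zi zj).
  + exact/neqst/(dP _ _ _ zi zj).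
  + by case: (CP _ _ _ zj zi) => E; [exact: neqs|exact: neqst E].
  + exact/neqst/(dP _ _ _ zj zi).
  + exact/neqt/(dP _ _ _ zi zj).
  + by case: (CP _ _ _ zj zi) => E; [exact: neqst (esym E)|exact: neqt].
  + by case: (CP _ _ _ zi zj) => E; [exact/neqs/esym|exact: neqst E].
  + by case: (CP _ _ _ zi zj) => E; [exact: neqst (esym E)|exact/neqt/esym].
  + by have /disjP := dis _ _ ij; apply; eauto.
Qed.

Definition clq (T : finType) (e : rel T) (S : {set T}) : rel T :=
  [rel a b | e a b || [&& a != b, a \in S & b \in S]].

(** Take the vertex from which the walk first uses an edge of the added clique. *)
Lemma leave_clique (T : finType) (e : rel T) (S C : {set T}) a b :
  connect (rstr (clq e S) C) a b -> ~~ connect (rstr e C) a b ->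
  exists x, [/\ x \in C, x \in S & connect (rstr e C) a x].
Proof.
case/connectP => q; elim: q a => [|c q IH] a /=; first by move=> _ ->; rewrite connect0.
move=> /andP[/and3P[eac aC cC] pq] lq nc; have [h|h] := orP eac; last first.
  by exists a; split=> //; case/and3P: h.
have ac : connect (rstr e C) a c by apply: connect_step.
have [x [xC xS cx]] := IH c pq lq ltac:(by apply: contra nc; apply: connect_trans).
by exists x; split=> //; apply: connect_trans cx.
Qed.

(** A pair that depends on added edges reaches [S] from both of its ends by edges of [e], at two
    different vertices, and these are joined through [W] instead. *)
Lemma unclique (T : finType) (e : rel T) (W S B Y : {set T}) : symmetric e ->
  [disjoint B & W] -> Y \subset B -> linked (clq e S) B Y -> linked e (W :|: S) S ->
  linked e (B :|: W) Y.
Proof.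
move=> se /disjP BW YB lk lkS I s t pr; have [C [CB CY con dis]] := lk I s t pr.
pose bad i := ~~ connect (rstr e (C i)) (s i) (t i).
pose J := {i : I | bad i}.
have sc : symmetric (clq e S).
  by move=> a b; rewrite /clq /= se eq_sym; congr (_ || _); case: (_ == _) => //=; apply: andbC.
have exx (j : J) : exists x, [/\ x \in C (val j), x \in S & connect (rstr e (C (val j))) (s (val j)) x].
  exact: leave_clique (con _) (valP j).
have exy (j : J) : exists x, [/\ x \in C (val j), x \in S & connect (rstr e (C (val j))) (t (val j)) x].
  by apply: leave_clique; [rewrite connect_rstrC|rewrite connect_rstrC //; exact: (valP j)].
have [x hx] := fin_all_exists exx; have [y hy] := fin_all_exists exy.
have same i j z : z \in C i -> z \in C j -> i = j.
  by move=> zi zj; apply/eqP; apply/negPn/negP => /dis/disjP/(_ z zi zj).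
have [D [DV DS conD disD]] : exists D, routing e (W :|: S) S x y D.
  apply: lkS; split.
  - move=> i j E; apply: val_inj; have [h1 _ _] := hx i; have [h2 _ _] := hx j.
    by apply: same h1 _; rewrite E.
  - move=> i j E; apply: val_inj; have [h1 _ _] := hy i; have [h2 _ _] := hy j.
    by apply: same h1 _; rewrite E.
  - move=> i j; apply/eqP => E; have [h1 _ c1] := hx i; have [h2 _ c2] := hy j.
    have Eij : i = j by apply: val_inj; apply: same h1 _; rewrite E.
    have := valP i; rewrite /bad => /negP; apply; apply: connect_trans c1 _.
    by rewrite E Eij connect_rstrC.
  - by move=> i; case: (hx i) => _ -> _; case: (hy i) => _ ->.
have DC j z : z \in D j -> z \in B -> z \in C (val j).
  move=> zD zB; have : z \in D j :&: S.
    rewrite in_setI zD; have /setUP[zW|//] := subsetP (DV j) z zD; by case: (BW z zB zW).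
  by rewrite DS => /set2P[]->; [case: (hx j)|case: (hy j)].
pose E i := if insub i is Some j then D (j : J) else set0.
have EP i z : z \in E i -> exists2 j : J, val j = i & z \in D j.
  by rewrite /E; case: insubP => [j _ <-|]; [exists j|rewrite in_set0].
exists (fun i => C i :|: E i); split.
- move=> i; apply/subsetP => z /setUP[/(subsetP (CB i))|/EP[j _ zD]]; rewrite in_setU; first by move->.
  have /setUP[->|zS] := subsetP (DV j) z zD; first by rewrite orbT.
  have : z \in D j :&: S by rewrite inE zD.
  by rewrite DS => /set2P[]->; [case: (hx j) => h _ _|case: (hy j) => h _ _]; rewrite (subsetP (CB _) _ h).
- move=> i; rewrite -CY; apply/setP => z; rewrite !in_setI in_setU; case: (boolP (z \in Y)) => zY; rewrite ?andbF // !andbT.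
  case: (boolP (z \in C i)) => //= zC; apply/negbTE/negP => /EP[j Ej zD].
  by have := DC j z zD (subsetP YB z zY); rewrite Ej (negbTE zC).
- move=> i; case: (boolP (connect (rstr e (C i)) (s i) (t i))) => [h|h].
    by apply: connect_mono h => //; apply: subsetUl.
  have -> : E i = D (exist _ i h) by rewrite /E insubT.
  set j : J := exist _ i h; have [_ _ c1] := hx j; have [_ _ c2] := hy j.
  have sub : C i \subset C i :|: D j := subsetUl _ _.
  apply: connect_trans (connect_mono sub (fun a b _ _ k => k) c1) _.
  rewrite connect_rstrC //; apply: connect_trans (connect_mono sub (fun a b _ _ k => k) c2) _.
  by rewrite connect_rstrC //; apply: connect_mono (conD j) => //; apply: subsetUr.
- move=> i k ik; apply/disjP => z /setUP[zi|/EP[j Ej zD]] /setUP[zk|/EP[l El zD']].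
  + by have /disjP := dis _ _ ik; apply; eauto.
  + have := DC l z zD' (subsetP (CB i) z zi); rewrite El => zk.
    by have /disjP := dis _ _ ik; apply; eauto.
  + have := DC j z zD (subsetP (CB k) z zk); rewrite Ej => zi.
    by have /disjP := dis _ _ ik; apply; eauto.
  + have jl : j != l by apply: contraNneq ik => E2; rewrite -Ej -El E2.
    by have /disjP := disD _ _ jl; apply; eauto.
Qed.

(** Contraction of the edge [uv] into [u], for use on vertex sets that do not contain [v]. *)
Definition ctr (T : finType) (e : rel T) (u v : T) : rel T :=
  [rel a b | (a != b) && [|| e a b, (a == u) && e v b | (b == u) && e v a]].

Lemma uncontract (T : finType) (e : rel T) (u v : T) (V X : {set T}) : symmetric e ->
  e u v -> v \notin V -> v \notin X -> linked (ctr e u v) V X -> linked e (v |: V) X.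
Proof.
move=> se euv vV vX lk I s t pr; have [C [CV CX con dis]] := lk I s t pr.
have vC i : v \notin C i by apply: contra vV; apply: (subsetP (CV i)).
pose C' i := if u \in C i then v |: C i else C i.
have sub i : C i \subset C' i by rewrite /C'; case: ifP => // _; apply: subsetUr.
have C'P i z : z \in C' i -> z = v /\ u \in C i \/ z \in C i.
  by rewrite /C'; case: ifP => [uC /setU1P[->|]|]; auto.
exists C'; split.
- by move=> i; apply/subsetP => z /C'P[[-> _]|/(subsetP (CV i)) h]; rewrite !inE ?eqxx ?h ?orbT.
- move=> i; rewrite -CX; apply/setP => z; rewrite !in_setI; case: (boolP (z \in X)) => zX; rewrite ?andbF // !andbT.
  apply/idP/idP => [/C'P[[E _]|//]|/(subsetP (sub i))//]; by move: zX; rewrite E (negbTE vX).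
- move=> i; apply: connect_sub (con i) => a b /and3P[/andP[ab h] aC bC].
  have sa := subsetP (sub i) a aC; have sb := subsetP (sub i) b bC.
  case/or3P: h => [h|/andP[/eqP Ea h]|/andP[/eqP Eb h]]; first exact: connect_step.
    have vi : v \in C' i by rewrite /C' -Ea aC setU11.
    by apply: connect_trans (connect_step _ sa vi) (connect_step h vi sb); rewrite Ea.
  have vi : v \in C' i by rewrite /C' -Eb bC setU11.
  by apply: connect_trans (connect_step _ sa vi) (connect_step _ vi sb); rewrite ?Eb se.
- move=> i j ij; apply/disjP => z; have /disjP d := dis _ _ ij.
  move=> /C'P[[-> ui]|zi] /C'P[[E uj]|zj].
  + exact: d ui uj.
  + by rewrite (negbTE (vC j)) in zj.
  + by move: zi; rewrite E (negbTE (vC i)).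
  + exact: d zi zj.
Qed.

Section Arcs.
Variable T : finType.
Implicit Types (e : rel T) (V W S X : {set T}).

(* Ordered pairs, so that an edge counts twice. *)
Definition arcset e V W : {set T * T} := [set p | [&& p.1 \in V, p.2 \in V, e p.1 p.2 & (p.1 \in W) || (p.2 \in W)]].
Definition arcs e V W := #|arcset e V W|.
(** A separation of order [#|S|] with the sides [W :|: S] and [V :\: W]. *)
Definition sepn e V W S := [/\ W \subset V, S \subset V, [disjoint W & S] &
  forall a b, a \in W -> b \in V -> e a b -> b \in W :|: S].
Definition thin c e V X := forall W S, sepn e V W S -> [disjoint X & W] -> #|S| < #|X| ->
  arcs e V W <= c * #|W|.
(** Because an edge is two arcs, [c = 12 * K] asks for more than [6 * K] edges per vertex outside
    [X], and for no more than that behind a separation of small order. *)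
Definition massed c e V X := [/\ X \subset V, c * #|V :\: X| < arcs e V (V :\: X) & thin c e V X].

Lemma arcs_le e e' V V' W W' :
  (forall a b, a \in V -> b \in V -> e a b -> (a \in W) || (b \in W) ->
     [&& a \in V', b \in V', e' a b & (a \in W') || (b \in W')]) -> arcs e V W <= arcs e' V' W'.
Proof.
move=> h; apply/subset_leq_card/subsetP => -[a b]; rewrite !inE /= => /and4P[*]; exact: h.
Qed.

Lemma arcs0 e V : arcs e V set0 = 0.
Proof. by apply/eqP; rewrite cards_eq0; apply/eqP/setP => p; rewrite !inE !andbF. Qed.

(** Take a violating separation of least order. A violation inside [W :|: S] would be a separation
    of [V] of still smaller order. *)
Lemma thin_fails c e V X : symmetric e -> ~ thin c e V X ->
  exists W S, [/\ sepn e V W S, [disjoint X & W], #|S| < #|X|, c * #|W| < arcs e V W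
    & massed c e (W :|: S) S].
Proof.
move=> se nt.
pose Q (WS : {set T} * {set T}) := [/\ sepn e V WS.1 WS.2, [disjoint X & WS.1], #|WS.2| < #|X| & c * #|WS.1| < arcs e V WS.1].
have exQ : exists WS, Q WS.
  apply: NNPP => no; apply: nt => W S h1 h2 h3; rewrite leqNgt; apply/negP => h4.
  by apply: no; exists (W, S).
have [[W S] [[/= sp dX lS big] mn]] := ex_min (fun WS : {set T} * {set T} => #|WS.2|) exQ.
have [WV SV WS cl] := sp; have /disjP dWS := WS.
exists W, S; split=> //; split; first exact: subsetUr.
- have -> : (W :|: S) :\: S = W.
    apply/setP => z; rewrite !inE; case: (boolP (z \in S)) => zS /=; last by rewrite orbF.
    by apply/esym/negP => zW; apply: dWS zS.
  apply: leq_trans big _; apply: arcs_le => a b aV bV eab ab; rewrite eab ab /= andbT.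
  case/orP: ab => h; first by rewrite inE h (cl a b).
  by rewrite [b \in _]inE h andbT; apply: (cl b a); rewrite // se.
- move=> W2 S2 [W2V S2V dW2 cl2] dS2 lt2; rewrite leqNgt; apply/negP => big2.
  have W2W z : z \in W2 -> z \in W.
    move=> zW; have /setUP[//|zS] := subsetP W2V z zW; by have /disjP/(_ z zS zW) := dS2.
  have : #|S| <= #|S2|; last by rewrite leqNgt lt2.
  apply: (mn (W2, S2)); split=> /=.
  + split=> //.
    * by apply/subsetP => z /W2W; apply: (subsetP WV).
    * by apply/subsetP => z /(subsetP S2V)/setUP[]; [apply: (subsetP WV)|apply: (subsetP SV)].
    * by move=> a b aW bV eab; apply: (cl2 a b) => //; apply: cl (W2W _ aW) bV eab.
  + by apply/disjP => z zX /W2W zW; have /disjP := dX; apply; eauto.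
  + exact: ltn_trans lS.
  + apply: leq_trans big2 _; apply: arcs_le => a b aV bV -> ->.
    have WSV : W :|: S \subset V by rewrite subUset WV SV.
    by rewrite !(subsetP WSV).
Qed.

End Arcs.

Lemma setU_disjK (T : finType) (W S : {set T}) : [disjoint W & S] -> (W :|: S) :\: S = W.
Proof. by move=> d; rewrite setDUl setDv setU0; apply/setDidPl. Qed.

Lemma linked_sub (T : finType) (e : rel T) (V X Y : {set T}) : Y \subset X -> linked e V X -> linked e V Y.
Proof.
move=> YX lk I s t [is_ it st sY].
have [C [CV CX con dis]] := lk I s t (And4 is_ it st (fun i => conj (subsetP YX _ (proj1 (sY i))) (subsetP YX _ (proj2 (sY i))))).
exists C; split=> // i; apply/setP => z; rewrite in_setI.
have E : (z \in C i :&: X) = (z \in [set s i; t i]) by rewrite CX.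
rewrite in_setI in E; case: (boolP (z \in Y)) => zY; first by rewrite -E (subsetP YX) // !andbT.
by rewrite andbF; apply/esym/negbTE; apply: contra zY => /set2P[]->; case: (sY i).
Qed.

Lemma rstr_path (T : finType) (e : rel T) (Z : {set T}) p a b :
  is_path (rstr e Z) p a b -> a \in Z -> {subset p <= Z} /\ is_path e p a b.
Proof.
move=> pp aZ; split; last by apply: is_path_sub pp => x y _ _ /andP[].
case: pp => q [-> pq _ _]; elim: q a aZ pq => [|x q IH] a aZ /=.
  by move=> _ z; rewrite inE => /eqP->.
by move=> /andP[/and3P[_ _ xZ] pq] z; rewrite inE => /predU1P[->//|]; apply: IH.
Qed.

Lemma path_rstr (T : finType) (e : rel T) (Z : {set T}) p a b :
  is_path e p a b -> {subset p <= Z} -> is_path (rstr e Z) p a b.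
Proof. by move=> pp sub; apply: is_path_sub pp => x y /sub xZ /sub yZ exy; rewrite /rstr /= exy xZ. Qed.

(** Menger's theorem between [X] and [S], outside [B :\: S]. Either [#|X|] disjoint paths carry the
    terminals into [S], or a smallest separator [S1] has fewer than [#|X|] vertices; then [S1]
    itself is carried into [S] by disjoint paths behind it, and so is linked there. *)
Lemma linked_or_rigid (T : finType) (e : rel T) (V X B S : {set T}) : symmetric e ->
  X \subset V -> S \subset B -> B \subset V -> [disjoint X & B :\: S] ->
  (forall a b, a \in B :\: S -> b \in V -> e a b -> b \in B) ->
  (forall Y : {set T}, Y \subset S -> #|Y| <= #|X| -> linked e B Y) ->
  linked e V X \/ exists W1 S1, [/\ sepn e V W1 S1, [disjoint X & W1], #|S1| < #|X|,
    linked e (W1 :|: S1) S1 & B :\: S :|: (B :\: S1) \subset W1].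
Proof.
move=> se XV SB BV /disjP XD cl lk; pose Z := V :\: (B :\: S).
have XZ : X \subset Z.
  apply/subsetP => x xX; rewrite in_setD (subsetP XV) // andbT; apply/negP; exact: XD.
have ZB z : z \in Z -> z \in B -> z \in S.
  by rewrite in_setD in_setD => /andP[/nandP[/negPn->//|/negP h]].
have SZ : S \subset Z.
  by apply/subsetP => z zS; rewrite !in_setD zS /= (subsetP BV) // (subsetP SB).
pose Q (S1 : {set T}) := S1 \subset Z /\ separates (rstr e Z) X S S1.
have QS : Q S by split=> // p a b pp _ bS; exists b; case: (is_path_mem pp).
have [S1 [[S1Z sep1] mn]] := ex_min (fun S1 : {set T} => #|S1|) (ex_intro _ S QS).
have mn' S2 : separates (rstr e Z) X S S2 -> #|S1| <= #|S2|.
  move=> sep2; apply: leq_trans (_ : #|S2 :&: Z| <= _); last by rewrite subset_leq_card ?subsetIl.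
  apply: mn; split; first exact: subsetIr.
  move=> p a b pp aX bS; have [z zp zS] := sep2 _ _ _ pp aX bS.
  have [sub _] := rstr_path pp (subsetP XZ a aX).
  by exists z; rewrite // inE zS sub.
(* Used once for [X] in the whole of [Z], and once for [S1] on the far side of the separator. *)
have link_up (A Z' : {set T}) (P : 'I_#|A| -> seq T) (V' : {set T}) : A \subset Z' -> Z' \subset Z -> Z' \subset V' ->
    B \subset V' -> #|A| <= #|X| -> linkage (rstr e Z') A S P -> linked e V' A.
  move=> AZ Z'Z Z'V' BV' AX [hP dP].
  have PZ i z : z \in P i -> z \in Z'.
    by have [a [b [pp aA _ _ _]]] := hP i; have [sub _] := rstr_path pp (subsetP AZ a aA); apply: sub.
  apply: (extend_linked (B := B) (S := S) (P := P)) => //.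
  - split=> // i; have [a [b [pp aA bS h1 h2]]] := hP i; have [sub pp'] := rstr_path pp (subsetP AZ a aA).
    exists a, b; split=> //; first exact: (subsetP SB).
    by move=> z zP zB; apply: h2 => //; apply: ZB zB; apply: (subsetP Z'Z); apply: sub.
  - by move=> i z /PZ; apply: (subsetP Z'V').
  - by move=> i z /PZ/(subsetP Z'Z) zZ zB; apply: ZB.
  - by move=> Y YS YA; apply: lk => //; apply: leq_trans AX.
have [le|lt] := leqP #|X| #|S1|.
  left; have [P lP] := menger (fun S2 h => leq_trans le (mn' S2 h)).
  by apply: (link_up X Z P V) => //; apply: subsetDl.
right; pose R := [set b in Z | (b \notin S1) && [exists a in X :\: S1, connect (rstr e (Z :\: S1)) a b]].
have RP b : b \in R -> [/\ b \in Z, b \notin S1 & exists2 a, a \in X :\: S1 & connect (rstr e (Z :\: S1)) a b].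
  by rewrite inE => /and3P[h1 h2 /existsP[a /andP[h3 h4]]]; split=> //; exists a.
have inR a b : a \in X :\: S1 -> connect (rstr e (Z :\: S1)) a b -> b \in R.
  move=> aX ab; have /setDP[aX' aS] := aX.
  have bZ : b \in Z :\: S1.
    have [->|ne] := eqVneq b a; first by rewrite in_setD aS (subsetP XZ).
    have [|p pp sub] := connect_rstr ab; first by rewrite eq_sym.
    by apply: sub; case: (is_path_mem pp).
  case/setDP: bZ => bZ bS; rewrite inE bZ bS /=; apply/existsP; exists a; by rewrite aX.
have noR y : y \in S -> y \in R -> False.
  move=> yS /RP[yZ yS1 [a /setDP[aX aS] ay]].
  have [E|ne] := eqVneq a y.
    have [z] := sep1 [:: a] a a (is_path1 _ a) aX ltac:(by rewrite E).
    by rewrite inE => /eqP->; rewrite (negbTE aS).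
  have [p pp sub] := connect_rstr ay ne.
  have [z zp zS] := sep1 p a y (path_rstr pp (fun z h => proj1 (setDP (sub z h)))) aX yS.
  by have /setDP[_] := sub z zp; rewrite zS.
pose W1 := V :\: (R :|: S1).
have ZV : Z \subset V := subsetDl _ _.
have W1P z : z \in V -> z \notin R -> z \in W1 :|: S1.
  by move=> zV zR; rewrite in_setU in_setD in_setU zV (negbTE zR) /=; case: (z \in S1).
have BW : B :\: S1 \subset W1.
  apply/subsetP => z /setDP[zB zS1]; have := W1P z (subsetP BV z zB); rewrite in_setU (negbTE zS1) orbF; apply.
  by apply/negP => zR; apply: (noR z) => //; have [zZ _ _] := RP z zR; apply: ZB.
exists W1, S1; split=> //.
- split; [exact: subsetDl|exact: subset_trans ZV| |].
    by apply/disjP => z /setDP[_]; rewrite in_setU negb_or => /andP[_ /negP].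
  move=> a b aW bV eab; apply: W1P => //; apply/negP => bR.
  case/setDP: aW => aV; rewrite in_setU negb_or => /andP[aR aS1].
  have [bZ bS1 [x xX xb]] := RP b bR.
  case: (boolP (a \in Z)) => aZ; last first.
    apply: (noR b) => //; apply: ZB => //; apply: (cl a b) => //.
    by apply: contraR aZ => aD; rewrite in_setD aD.
  case/negP: aR; apply: inR xX _; apply: connect_trans xb (connect_step _ _ _); first by rewrite se.
    by rewrite in_setD bS1.
  by rewrite in_setD aS1.
- apply/disjP => x xX /setDP[_]; rewrite in_setU negb_or => /andP[/negP xR xS1]; apply: xR.
  by apply: (inR x); rewrite ?connect0 // in_setD xS1.
(* After its last vertex in [S1] a path from [X] to [S] never returns to [R]. A set separating [S1]
   from [S] off [R] thus separates [X] from [S], and has at least [#|S1|] vertices. *)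
- have [P lP] : exists P : 'I_#|S1| -> seq T, linkage (rstr e (Z :\: R)) S1 S P.
    apply: menger => S2 sep2; apply: mn' => p a b pp aX bS.
    have [sub pp'] := rstr_path pp (subsetP XZ a aX).
    have [z zp zS] := sep1 p a b pp aX bS.
    have [v [p1 [p2 [P1 P2 E vS fv]]]] := is_path_last (A := mem S1) pp' ltac:(by apply/hasP; exists z).
    have [_ vp1] := is_path_mem P1; have [vp2 bp2] := is_path_mem P2.
    have p2sub w : w \in p2 -> w \in Z by move=> wp; apply: sub; rewrite E (mem_join _ P2 vp1) wp orbT.
    have p2R w : w \in p2 -> w \notin R.
      move=> wp; apply/negP => wR; have [wZ wS1 [x xX xw]] := RP w wR.
      have [q1 [q2 [Q1 Q2 E2 D2]]] := is_path_split P2 wp; have [_ wq1] := is_path_mem Q1.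
      apply: (noR b) => //; apply: (inR x) => //; apply: connect_trans xw _.
      apply: (is_path_connect Q2) => y yq; rewrite in_setD p2sub ?andbT; last by rewrite E2 (mem_join _ Q2 wq1) yq orbT.
      apply/negP => yS1; have yv : y = v by apply: fv yS1; rewrite E2 (mem_join _ Q2 wq1) yq orbT.
      have vw : v = w by apply: D2; rewrite -?yv //; case: (is_path_mem Q1) => h _; rewrite yv.
      by move: wS1; rewrite -vw; move: vS => /= ->.
    have p2Z : {subset p2 <= Z :\: R} by move=> w wp; rewrite in_setD p2R // p2sub.
    have [y yp yS] := sep2 p2 v b (path_rstr P2 p2Z) vS bS.
    by exists y; rewrite // E (mem_join _ P2 vp1) yp orbT.
  apply: (link_up S1 (Z :\: R) P) => //.
  + apply/subsetP => z zS; rewrite in_setD (subsetP S1Z) // andbT; apply/negP => /RP[_]; by rewrite zS.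
  + exact: subsetDl.
  + apply/subsetP => z /setDP[zZ zR]; apply: W1P => //; exact: (subsetP ZV).
  + apply/subsetP => z zB; apply: W1P; first exact: (subsetP BV).
    by apply/negP => zR; apply: (noR z) => //; have [zZ _ _] := RP z zR; apply: ZB.
  + exact: ltnW.
- rewrite subUset BW andbT; apply/subsetP => z zD; apply: (subsetP BW); rewrite in_setD.
  have /setDP[zB _] := zD; rewrite zB andbT; apply/negP => /(subsetP S1Z); rewrite in_setD.
  by rewrite zD.
Qed.

(** * A smallest massed pair that is not linked *)

Section Step.
Variables (T : finType) (c N : nat) (e : rel T) (V X : {set T}).
Hypotheses (se : symmetric e) (ie : irreflexive e) (hX : #|X| <= N) (ms : massed c e V X).
Hypothesis IH : forall (V' : {set T}) (e' : rel T) (X' : {set T}), #|V'| < #|V| -> symmetric e' ->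
  irreflexive e' -> #|X'| <= N -> massed c e' V' X' -> linked e' V' X'.
Hypothesis nl : ~ linked e V X.

(** Take [W] as large as possible. The linked side can be replaced by a clique on [S], which gives a
    smaller graph to which induction applies. *)
Lemma no_rigid W S : sepn e V W S -> [disjoint X & W] -> #|S| <= #|X| -> 0 < #|W| ->
  linked e (W :|: S) S -> False.
Proof.
move=> h1 h2 h3 h4 h5; have [XV m1 m2] := ms.
pose Q (WS : {set T} * {set T}) := [/\ sepn e V WS.1 WS.2, [disjoint X & WS.1], #|WS.2| <= #|X|, 0 < #|WS.1| & linked e (WS.1 :|: WS.2) WS.2].
have [[{h1 h2 h3 h4 h5}W {}S] [[/= sp dX leS W0 lk] mn]] := ex_min (Q := Q) (fun WS => #|V :\: WS.1|) (ex_intro _ (W, S) (And5 h1 h2 h3 h4 h5)).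
have [WV SV dWS cl] := sp; have [/disjP dX' /disjP dWS'] := (dX, dWS).
have smaller (W1 : {set T}) z : W \subset W1 -> z \in V -> z \in W1 -> z \notin W -> #|V :\: W1| < #|V :\: W|.
  move=> sub zV z1 zW; apply: proper_card; apply/properP; split; first exact: setDS.
  by exists z; rewrite ?in_setD ?zV ?zW ?z1.
(* If the order equals [#|X|], thinness says nothing about [W]. Here [X] links onto [S], or the
   smaller separator found on the way gives a larger [W]. *)
have [big|lt] := leqP #|X| #|S|.
  have DE : (W :|: S) :\: S = W.
    apply/setP => z; rewrite in_setD in_setU; case: (boolP (z \in S)) => zS /=; last by rewrite orbF.
    by apply/esym/negP => zW; apply: dWS' zS.
  have [//|[W1 [S1 [sp1 dX1 lt1 lk1 sub1]]]] : linked e V X \/ exists W1 S1, [/\ sepn e V W1 S1, [disjoint X & W1], #|S1| < #|X|,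
    linked e (W1 :|: S1) S1 & (W :|: S) :\: S :|: ((W :|: S) :\: S1) \subset W1].
    apply: linked_or_rigid => //; first exact: subsetUr.
    - by rewrite subUset WV.
    - by rewrite DE.
    - by rewrite DE; apply: cl.
    - by move=> Y YS _; apply: linked_sub lk.
  move: sub1; rewrite DE subUset => /andP[sub1 sub2].
  have [z zS zS1] : exists2 z, z \in S & z \notin S1.
    apply: NNPP => no; have : #|S| <= #|S1|; last by move: lt1 big; clear; lia.
    apply/subset_leq_card/subsetP => z zS; apply/negPn/negP => zS1; apply: no; by exists z.
  have z1 : z \in W1 by apply: (subsetP sub2); rewrite in_setD zS1 in_setU zS orbT.
  have zW : z \notin W by apply/negP => zW; apply: dWS' zS.
  have := smaller W1 z sub1 (subsetP SV z zS) z1 zW; rewrite ltnNge => /negP; apply.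
  apply: (mn (W1, S1)); split=> //=; first exact: ltnW.
  by apply/card_gt0P; exists z.
(* By thinness only [c * #|W|] arcs disappear with [W], so what remains has enough arcs, and only
   its thinness is in doubt. *)
pose A := V :\: W; pose e2 := clq e S.
have se2 : symmetric e2.
  by move=> a b; rewrite /e2 /clq /= se eq_sym; congr (_ || _); case: (_ == _) => //=; apply: andbC.
have ie2 : irreflexive e2 by move=> a; rewrite /e2 /clq /= ie eqxx.
have XA : X \subset A.
  by apply/subsetP => x xX; rewrite in_setD (subsetP XV) // andbT; apply/negP; apply: dX'.
have AV : A \subset V := subsetDl _ _.
have dAW : [disjoint A & W] by apply/disjP => z /setDP[_ /negP].
have ltA : #|A| < #|V|.
  rewrite cardsDS //; have := subset_leq_card WV; move: W0; clear; lia.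
have AW : A :|: W = V by apply/setP => z; rewrite !inE; case: (boolP (z \in W)) => [/(subsetP WV)->|]; rewrite ?orbT ?orbF.
have m1A : c * #|A :\: X| < arcs e2 A (A :\: X).
  have k1 : arcs e V (V :\: X) <= arcs e V W + arcs e2 A (A :\: X).
    apply: leq_trans (_ : #|arcset e V W :|: arcset e2 A (A :\: X)| <= _); last exact: (leq_card_setU _ _).1.
    apply/subset_leq_card/subsetP => -[a b]; rewrite !inE /= => /and4P[aV bV eab ab].
    rewrite aV bV eab /=; case: (a \in W) => //=; case: (b \in W) => //=.
    by move: ab; rewrite aV bV !andbT /e2 /clq /= eab.
  have k2 := m2 W S sp dX lt.
  have k3 : #|V :\: X| = #|W| + #|A :\: X|.
    rewrite -(cardsID W (V :\: X)); congr (_ + _).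
      apply: eq_card => z; rewrite !inE; case: (boolP (z \in W)) => zW; rewrite ?andbF // andbT (subsetP WV) // andbT.
      by apply/negP => zX; apply: dX' zW.
    by apply: eq_card => z; rewrite !inE; case: (z \in W); rewrite ?andbF.
  by move: m1 k1 k2; rewrite k3 mulnDr; clear; lia.
case: (classic (thin c e2 A X)) => th.
  apply: nl; rewrite -AW; apply: (unclique (S := S)) => //.
  by apply: IH => //.
have [W' [S' [sp' dX2 ltS' big ms']]] := thin_fails se2 th.
have [W'A S'A dWS2 cl'] := sp'; have /disjP dX2' := dX2.
have lk' : linked e2 (W' :|: S') S'.
  apply: IH => //; last by apply: leq_trans (ltnW ltS') hX.
  by apply: leq_ltn_trans ltA; apply: subset_leq_card; rewrite subUset W'A.
have W'V : W' \subset V by apply: subset_trans AV.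
have S'V : S' \subset V by apply: subset_trans AV.
have W'W z : z \in W' -> z \notin W by move=> /(subsetP W'A)/setDP[].
have ee2 a b : e a b -> e2 a b by rewrite /e2 /clq /= => ->.
(* If [W'] meets the clique, then [W' :|: S'] contains all of it, and adding [W] to [W'] gives a
   larger linked side. If not, [W'] and [S'] form a separation for [e] as well and contradict the
   thinness of [X]. *)
have [S0|[z]] := set_0Vmem (S :&: W'); last first.
  case/setIP => zS zW'.
  have SW z' : z' \in S -> z' \in W' :|: S'.
    move=> z'S; have [->|ne] := eqVneq z' z; first by rewrite in_setU zW'.
    have z'A : z' \in A by rewrite in_setD (subsetP SV) // andbT; apply/negP => /dWS'; apply.
    by apply: cl' zW' z'A _; rewrite /e2 /clq /= eq_sym ne zS z'S orbT.
  have : #|V :\: W| <= #|V :\: (W' :|: W)|; last first.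
    by rewrite leqNgt (smaller _ z) ?subsetUr ?(subsetP W'V) ?in_setU ?zW' ?W'W.
  apply: (mn (W' :|: W, S')); split=> /=.
  - split=> //; first by rewrite subUset W'V.
      apply/disjP => y /setUP[yW yS|yW yS]; first by have /disjP := dWS2; apply; eauto.
      by have /setDP[_] := subsetP S'A y yS; rewrite yW.
    move=> a b /setUP[aW|aW] bV eab.
      case: (boolP (b \in W)) => bW; first by rewrite !in_setU bW orbT.
      have /setUP[bW'|bS'] := cl' a b aW ltac:(by rewrite in_setD bW) (ee2 _ _ eab).
        by rewrite !in_setU bW'.
      by rewrite !in_setU bS' orbT.
    have /setUP[bW|bS] := cl a b aW bV eab; first by rewrite !in_setU bW orbT.
    by have /setUP[h|h] := SW b bS; rewrite !in_setU h ?orbT.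
  - by apply/disjP => y yX /setUP[]; [apply: dX2'|apply: dX'].
  - exact: ltnW.
  - by apply/card_gt0P; exists z; rewrite in_setU zW'.
  - have -> : W' :|: W :|: S' = (W' :|: S') :|: W by rewrite -!setUA (setUC W).
    apply: (unclique (S := S)) => //; last exact: subsetUr.
    apply/disjP => y /setUP[/W'W/negP//|/(subsetP S'A)/setDP[_ /negP]//].
have sp2 : sepn e V W' S'.
  split=> // a b aW bV eab; case: (boolP (b \in W)) => bW.
    have /setUP[aW2|aS] := cl b a bW (subsetP W'V a aW) ltac:(by rewrite se).
      by have := W'W a aW; rewrite aW2.
    by have := in_set0 a; rewrite -S0 in_setI aS aW.
  by apply: (cl' a b aW _ (ee2 _ _ eab)); rewrite in_setD bW.
have := m2 W' S' sp2 dX2 ltS'; rewrite leqNgt => /negP; apply.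
apply: leq_trans big _; apply: arcs_le => a b aA bA eab ab.
rewrite (subsetP AV) // (subsetP AV) // ab andbT /=; case/orP: eab => // /and3P[_ aS bS].
by case/orP: ab => h'; [have := in_set0 a|have := in_set0 b]; rewrite -S0 in_setI h' ?aS ?bS.
Qed.

Lemma linked_mono (V' V1 X' : {set T}) (e' : rel T) : V1 \subset V' -> linked e' V1 X' -> linked e' V' X'.
Proof.
move=> sub lk I s t pr; have [C [CV CX con dis]] := lk I s t pr.
by exists C; split=> // i; apply: subset_trans sub.
Qed.

Lemma sepn_arcs W S V' : sepn e V' W S -> V' \subset V -> arcs e V' W <= arcs e V W.
Proof.
by move=> _ sub; apply: arcs_le => a b aV bV -> ->; rewrite !(subsetP sub).
Qed.

Lemma no_isolated v : v \in V -> v \notin X -> nb e V v = set0 -> False.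
Proof.
move=> vV vX v0; have [XV m1 m2] := ms.
have nv a : a \in V -> e v a = false.
  by move=> aV; have := in_set0 a; rewrite -v0 nbP aV.
have sV : V :\ v \subset V := subsetDl _ _.
apply: nl; apply: (linked_mono sV); apply: IH => //; first by rewrite [#|V|](cardsD1 v) vV; clear; lia.
split.
- by apply/subsetP => x xX; rewrite in_setD1 (subsetP XV) // andbT; apply: contraNneq vX => <-.
- apply: leq_ltn_trans (_ : c * #|V :\: X| < _).
    by rewrite leq_mul2l subset_leq_card ?orbT // setSD.
  apply: leq_trans m1 _; apply: arcs_le => a b aV bV eab ab.
  have av : a != v by apply: contraTneq eab => ->; rewrite nv.
  have bv : b != v by apply: contraTneq eab => ->; rewrite se nv.
  by move: ab; rewrite !inE av bv aV bV eab.
- move=> W S sp dX lt; have [WV SV dWS cl] := sp; apply: leq_trans (sepn_arcs sp sV) _; apply: m2 dX lt.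
  split=> //; [exact: subset_trans sV|exact: subset_trans sV|].
  move=> a b aW bV eab; apply: (cl a b aW _ eab); rewrite in_setD1 bV andbT.
  apply: contraTneq eab => ->; rewrite se nv //; apply: (subsetP sV); exact: (subsetP WV).
Qed.

(** Inside [X] a vertex is nonadjacent to at most one other, its partner; [massed_linked] arranges
    this. *)
Hypothesis hpart : forall u y z, u \in X -> y \in X -> z \in X -> y != u -> z != u ->
  ~~ e u y -> ~~ e u z -> y = z.

Lemma ctr_sym u v : symmetric (ctr e u v).
Proof. by move=> a b; rewrite /ctr /= eq_sym se; congr (_ && _); congr (_ || _); rewrite orbC. Qed.

Lemma ctr_irr u v : irreflexive (ctr e u v).
Proof. by move=> a; rewrite /ctr /= eqxx. Qed.

Lemma ctr_e u v a b : e a b -> ctr e u v a b.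
Proof. by move=> eab; rewrite /ctr /= eab andbT; apply: contraTneq eab => ->; rewrite ie. Qed.

(** A violating separation in the contracted graph lifts to a linked one for [e], against
    [no_rigid]: [v] joins [W] or [S] according to where [u] is. If [u] is in neither, it is already
    a separation for [e] and violates the thinness of [X]. *)
Lemma contract_thin u v : u \in V -> v \in V -> v \notin X -> e u v -> thin c (ctr e u v) (V :\ v) X.
Proof.
move=> uV vV vX euv; apply: NNPP => /(thin_fails (ctr_sym u v))[W [S [sp dX lt big ms']]].
have [XV m1 m2] := ms; have [WV SV dWS cl] := sp; have [/disjP dX' /disjP dWS'] := (dX, dWS).
have sV : V :\ v \subset V := subsetDl _ _.
have vW : v \notin W by apply/negP => /(subsetP WV); rewrite in_setD1 eqxx.
have vS : v \notin S by apply/negP => /(subsetP SV); rewrite in_setD1 eqxx.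
have uv : u != v by apply: contraTneq euv => ->; rewrite ie.
have W0 : 0 < #|W|.
  rewrite card_gt0; apply/eqP => E; move: big; rewrite E arcs0; by rewrite ltn0.
have V1 a : a \in V -> a != v -> a \in V :\ v by move=> h1 h2; rewrite in_setD1 h2.
have ltV : #|W :|: S| < #|V|.
  apply: leq_ltn_trans (_ : #|V :\ v| < _); first by apply: subset_leq_card; rewrite subUset WV.
  by rewrite [#|V|](cardsD1 v) vV; clear; lia.
have step a b : a \in W -> b \in V -> e a b -> b != v -> b \in W :|: S.
  by move=> aW bV eab bv; apply: (cl a b aW (V1 _ bV bv)); apply: ctr_e.
have lk : linked (ctr e u v) (W :|: S) S.
  by apply: IH => //; [exact: ctr_sym|exact: ctr_irr|apply: leq_trans (ltnW lt) hX].
case: (boolP (u \in W)) => uW.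
  apply: (@no_rigid (v |: W) S) => //; last 1 first.
  - rewrite -setUA; apply: (uncontract (u := u)) => //; by rewrite in_setU negb_or vW.
  - split=> //; first by rewrite subUset sub1set vV (subset_trans WV).
    + exact: subset_trans sV.
    + by apply/disjP => z /setU1P[->|]; [apply/negP|apply: dWS'].
    + move=> a b aW bV eab; have [->|bv] := eqVneq b v; first by rewrite !in_setU !inE eqxx.
      rewrite -setUA in_setU1 (negbTE bv) /=; case/setU1P: aW => [E|aW]; last exact: step eab bv.
      have [->|bu] := eqVneq b u; first by rewrite in_setU uW.
      by apply: (cl u b uW (V1 _ bV bv)); rewrite /ctr /= eq_sym bu eqxx -E eab orbT.
  - by apply/disjP => z zX /setU1P[E|]; [rewrite -E zX in vX|apply: dX'].
  - exact: ltnW.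
  - by rewrite cardsU1 vW.
case: (boolP (u \in S)) => uS; last first.
  have nvW a : a \in W -> e v a = false.
    move=> aW; apply/negP => eva; have au : a != u by apply: contraNneq uW => <-.
    have : u \in W :|: S by apply: (cl a u aW (V1 _ uV uv)); rewrite /ctr /= au eqxx eva !orbT.
    by rewrite in_setU (negbTE uW) (negbTE uS).
  have sp2 : sepn e V W S.
    split=> //; [exact: subset_trans sV|exact: subset_trans sV|].
    move=> a b aW bV eab; apply: (step a b) => //; apply: contraTneq eab => ->; by rewrite se nvW.
  have := m2 W S sp2 dX lt; rewrite leqNgt => /negP; apply; apply: leq_trans big _.
  apply: arcs_le => a b aV bV eab ab; rewrite !(subsetP sV) // ab andbT /=.
  case/andP: eab => _ /or3P[//|/andP[/eqP E h]|/andP[/eqP E h]].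
    by case/orP: ab => [|bW]; [rewrite E (negbTE uW)|rewrite nvW in h].
  by case/orP: ab => [aW|]; [rewrite nvW in h|rewrite E (negbTE uW)].
have sp2 : sepn e V W (v |: S).
  split; [exact: subset_trans sV| | |].
  - by rewrite subUset sub1set vV (subset_trans SV).
  - by apply/disjP => z zW /setU1P[E|]; [rewrite -E zW in vW|apply: dWS'].
  - move=> a b aW bV eab; have [->|bv] := eqVneq b v; first by rewrite !in_setU !inE eqxx !orbT.
    by have /setUP[h|h] := step a b aW bV eab bv; rewrite !in_setU h ?orbT.
have leS : #|v |: S| <= #|X| by rewrite cardsU1 vS.
have [x xX xS] : exists2 x, x \in X & x \notin S.
  apply: NNPP => no; have : #|X| <= #|S|; last by rewrite leqNgt lt.
  apply/subset_leq_card/subsetP => x xX; apply/negPn/negP => xS; apply: no; by exists x.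
have WSV : W :|: (v |: S) \subset V.
  by rewrite !subUset sub1set vV (subset_trans WV sV) (subset_trans SV sV).
apply: (no_rigid sp2 dX leS W0); apply: IH => //; last 1 first.
- split; first exact: subsetUr.
  + have -> : (W :|: (v |: S)) :\: (v |: S) = W.
      by have [_ _ d _] := sp2; apply: setU_disjK.
    apply: leq_trans big _; rewrite /arcs.
    (* An arc at [u] created by the contraction is charged to the arc at [v] from which it arose. *)
    pose f (p : T * T) := if e p.1 p.2 then p else if p.1 == u then (v, p.2) else (p.1, v).
    rewrite -(@card_in_imset _ _ f); last first.
      have nv p : p \in arcset (ctr e u v) (V :\ v) W -> [/\ p.1 != v, p.2 != v & ~~ e p.1 p.2 -> p.1 != u -> p.2 = u].
        rewrite inE !in_setD1 => /and4P[/andP[-> _] /andP[-> _] /andP[_ h] _]; split=> // ne nu.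
        by case/or3P: h => [h|/andP[h _]|/andP[/eqP]//]; [rewrite h in ne|rewrite h in nu].
      move=> [a b] [a' b'] /nv/=[av bv h] /nv/=[av' bv' h']; rewrite /f /=.
      case: (boolP (e a b)) => e1; case: (boolP (e a' b')) => e2.
      * by [].
      * by case: ifP => _ [E1 E2]; [rewrite E1 eqxx in av|rewrite E2 eqxx in bv].
      * by case: ifP => _ [E1 E2]; [rewrite -E1 eqxx in av'|rewrite -E2 eqxx in bv'].
      * case: eqP => [->|/eqP nu]; case: eqP => [->|/eqP nu'].
        -- by case=> ->.
        -- by case=> E1 _; rewrite -E1 eqxx in av'.
        -- by case=> E1 _; rewrite E1 eqxx in av.
        -- by case=> ->; rewrite (h e1 nu) (h' e2 nu').
    apply/subset_leq_card/subsetP => _ /imsetP[[a b] + ->].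
    rewrite inE /= => /and4P[aV bV eab ab]; have ab' := ab.
    have inA z : z \in W -> z \in W :|: (v |: S) by rewrite in_setU => ->.
    have vA : v \in W :|: (v |: S) by rewrite !in_setU inE eqxx orbT.
    have ctrc z y : z \in W -> y \in V :\ v -> ctr e u v z y -> y \in W :|: (v |: S).
      by move=> zW yV h; have /setUP[h'|h'] := cl z y zW yV h; rewrite !in_setU h' ?orbT.
    have [aA bA] : a \in W :|: (v |: S) /\ b \in W :|: (v |: S).
      case/orP: ab => h; first by rewrite inA // (ctrc a b).
      by rewrite [b \in _]inA // (ctrc b a) // ctr_sym.
    rewrite /f /=; case: ifP => e1; first by rewrite inE /= e1 aA bA.
    case/andP: eab => _; rewrite e1 /=; case: eqP => [Ea|/eqP na] /=.
      rewrite Ea (negbTE uW) /= in ab'; case/orP => [h|/andP[/eqP Eb _]]; last by rewrite Eb (negbTE uW) in ab'.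
      by rewrite inE /= vA bA h ab' orbT.
    by move=> /andP[/eqP Eb h]; rewrite Eb (negbTE uW) orbF in ab'; rewrite inE /= vA aA se h ab'.
  + move=> W2 S2 sp3 dS2 lt2; have [W2V S2V dW2 cl2] := sp3.
    have W2W z : z \in W2 -> z \in W.
      move=> zW; have /setUP[//|zS] := subsetP W2V z zW; by have /disjP/(_ z zS zW) := dS2.
    apply: leq_trans (sepn_arcs sp3 WSV) _; apply: (m2 _ S2); last exact: leq_trans leS.
    * split=> //; [exact: subset_trans WSV|exact: subset_trans WSV|].
      move=> a b aW bV eab; apply: (cl2 a b) => //; have [_ _ _ cl'] := sp2; exact: cl' (W2W _ aW) bV eab.
    * by apply/disjP => z zX /W2W; apply: dX'.
- apply: proper_card; apply/properP; split=> //; exists x; first exact: (subsetP XV).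
  rewrite !in_setU !inE !negb_or xS andbT; apply/andP; split; first by apply/negP; apply: dX'.
  by apply: contraNneq vX => <-.
- exact: leq_trans hX.
Qed.

(** The contracted pair is thin but not linked, so it has too few arcs: the contraction destroys
    more than [c]. It costs two arcs for each common neighbour, two for the edge [uv], and at most
    two more when [u] is in [X], where an edge from [v] to the partner of [u] turns into an edge
    inside [X]. *)
Lemma contract_count u v : u \in V -> v \in V -> v \notin X -> e u v ->
  arcs e V (V :\: X) + c <= c * #|V :\: X| + 2 * (#|nb e V u :&: nb e V v| + 2).
Proof.
move=> uV vV vX euv; have [XV m1 m2] := ms; pose e1 := ctr e u v; pose V1 := V :\ v.
have uv : u != v by apply: contraTneq euv => ->; rewrite ie.
have X1 : X \subset V1.
  by apply/subsetP => x xX; rewrite in_setD1 (subsetP XV) // andbT; apply: contraNneq vX => <-.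
have not1 : arcs e1 V1 (V1 :\: X) <= c * #|V1 :\: X|.
  rewrite leqNgt; apply/negP => big; apply: nl; rewrite -(setD1K vV).
  apply: (uncontract (u := u)) => //; first by rewrite in_setD1 eqxx.
  apply: IH => //; [by rewrite [#|V|](cardsD1 v) vV; clear; lia|exact: ctr_sym|exact: ctr_irr|].
  by split=> //; apply: contract_thin.
have cV1 : #|V :\: X| = #|V1 :\: X|.+1.
  rewrite (cardsD1 v (V :\: X)) in_setD vX vV add1n; congr _.+1; apply: eq_card => z; rewrite !inE.
  by case: (z == v); rewrite ?andbF.
pose A0 := [set p in arcset e V (V :\: X) | (p.1 != v) && (p.2 != v)].
pose G := [set b in nb e V v | [&& b != u, ~~ e u b & ~~ ((u \in X) && (b \in X))]].
pose Bd := nb e V v :\: G.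
have cN : #|nb e V v| = #|G| + #|Bd|.
  rewrite -(cardsID G (nb e V v)); congr (_ + _); apply: eq_card => z; rewrite inE andb_idl //.
  by rewrite inE => /andP[].
have cBd : #|Bd| <= #|nb e V u :&: nb e V v| + 2.
  pose B3 := [set b in nb e V v | [&& b != u, ~~ e u b, u \in X & b \in X]].
  have c3 : #|B3| <= 1.
    apply/card_le1_eqP => x y; rewrite !inE => /and5P[_ h1 h2 h3 h4] /and5P[_ k1 k2 k3 k4].
    exact: (hpart h3).
  have sub : Bd \subset (nb e V u :&: nb e V v) :|: [set u] :|: B3.
    apply/subsetP => b; rewrite !inE => /andP[h /andP[bV evb]]; rewrite bV evb /= in h *.
    by move: h; case: (e u b); case: (b == u); case: (u \in X); case: (b \in X).
  apply: leq_trans (subset_leq_card sub) _; apply: leq_trans ((leq_card_setU _ _).1) _.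
  have := (leq_card_setU (nb e V u :&: nb e V v) [set u]).1; rewrite cards1; move: c3; clear; lia.
have up : arcs e V (V :\: X) <= #|A0| + 2 * #|nb e V v|.
  have sub : arcset e V (V :\: X) \subset A0 :|: [set (v, b) | b in nb e V v] :|: [set (b, v) | b in nb e V v].
    apply/subsetP => -[a b] h; have := h; rewrite inE /= => /and4P[aV bV eab _].
    rewrite !in_setU; have [Ea|av] := eqVneq a v.
      by rewrite Ea [X in _ || X || _]imset_f ?orbT // nbP bV -Ea.
    have [Eb|bv] := eqVneq b v; first by rewrite Eb [X in _ || X]imset_f ?orbT // nbP aV -Eb se.
    by rewrite inE h /= av bv.
  apply: leq_trans (subset_leq_card sub) _; apply: leq_trans ((leq_card_setU _ _).1) _.
  have := (leq_card_setU A0 [set (v, b) | b in nb e V v]).1.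
  have := leq_imset_card (fun b => (v, b)) (nb e V v); have := leq_imset_card (fun b => (b, v)) (nb e V v).
  move=> k1 k2 k3; apply: leq_trans (leq_add k3 k1) _.
  by rewrite -addnA leq_add2l mul2n -addnn leq_add2r.
have down : #|A0| + 2 * #|G| <= arcs e1 V1 (V1 :\: X).
  have c1 : #|[set (u, b) | b in G]| = #|G| by rewrite card_imset // => x y [].
  have c2 : #|[set (b, u) | b in G]| = #|G| by rewrite card_imset // => x y [].
  have GP b : b \in G -> [/\ b \in V, e v b, b != u, ~~ e u b & ~~ ((u \in X) && (b \in X))].
    by rewrite !inE => /andP[/andP[-> ->] /and3P[-> -> ->]].
  have d1 : [disjoint A0 & [set (u, b) | b in G]].
    apply/disjP => p + /imsetP[b /GP[_ _ _ /negP nub _] E]; rewrite E !inE /= => /andP[/and4P[_ _ h _] _]; exact: nub.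
  have d2 : [disjoint A0 :|: [set (u, b) | b in G] & [set (b, u) | b in G]].
    apply/disjP => p + /imsetP[b /GP[_ _ bu /negP nub _] E]; rewrite E => /setUP[|/imsetP[b' /GP[_ _ bu' _ _] [E1 E2]]].
      by rewrite !inE /= se => /andP[/and4P[_ _ h _] _]; apply: nub.
    by rewrite E1 eqxx in bu.
  have -> : #|A0| + 2 * #|G| = #|A0 :|: [set (u, b) | b in G] :|: [set (b, u) | b in G]|.
    rewrite cardsU (disjoint_setI0 d2) cards0 subn0 cardsU (disjoint_setI0 d1) cards0 subn0 c1 c2; clear; lia.
  apply/subset_leq_card/subsetP => p /setUP[/setUP[|]|].
  - rewrite inE => /andP[+ /andP[h1 h2]]; rewrite !inE /= => /and4P[aV bV eab ab].
    by rewrite h1 h2 aV bV [e1 _ _](ctr_e u v eab) /=; move: ab; rewrite aV bV.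
  - case/imsetP => b /GP[bV evb bu nub nX] ->; have bv : b != v by apply: contraTneq evb => ->; rewrite ie.
    have e1ub : e1 u b by rewrite /e1 /ctr /= [u == b]eq_sym bu eqxx evb orbT.
    by rewrite !inE /= e1ub uv uV bV bv /= !andbT -negb_and.
  - case/imsetP => b /GP[bV evb bu nub nX] ->; have bv : b != v by apply: contraTneq evb => ->; rewrite ie.
    have e1bu : e1 b u by rewrite /e1 /ctr /= bu eqxx evb !orbT.
    by rewrite !inE /= e1bu uv uV bV bv /= !andbT -negb_and andbC.
move: not1 up down cBd; rewrite cV1 cN; clear; lia.
Qed.

Lemma sum_deg (A : {set T}) :
  \sum_(w in A) #|nb e V w| = #|[set p : T * T | [&& p.1 \in A, p.2 \in V & e p.1 p.2]]|.
Proof.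
rewrite -sum1dep_card (eq_bigl (fun p : T * T => (p.1 \in A) && ((p.2 \in V) && e p.1 p.2))) //.
rewrite -(pair_big_dep (fun w => w \in A) (fun w b => (b \in V) && e w b) (fun _ _ => 1)) /=.
by apply: eq_bigr => w _; rewrite sum1dep_card; apply: eq_card => b; rewrite !inE.
Qed.

(** The closed neighbourhood [D] of a vertex of least degree outside [X] satisfies the hypotheses of
    [dense_linked]: all degrees in it are at least [delta] and it has at most [2 * delta + 1]
    vertices. The linked set in [D] then links [X] or yields a separation excluded by [no_rigid]. *)
Lemma not_massed K : 1 < K -> N = 2 * K -> c = 12 * K -> False.
Proof.
move=> K2 EN Ec; have [XV m1 m2] := ms.
have [v0 v0P] : exists v, v \in V :\: X.
  apply/card_gt0P; rewrite card_gt0; apply/eqP => E; move: m1; rewrite E arcs0; by rewrite ltn0.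
have [v vP vmin] := arg_minnP (fun v => #|nb e V v|) v0P.
have /setDP[vV vX] : v \in V :\: X by [].
pose y := arcs e V (V :\: X) - c * #|V :\: X|; pose n' := #|V :\: X|; pose d := #|nb e V v|.
have yE : arcs e V (V :\: X) = c * n' + y by move: m1; rewrite /y /n'; clear; lia.
have y1 : 0 < y by rewrite /y subn_gt0.
(* Half of what the excess [y] yields in [contract_count]: an edge at [v] has at least [delta - 1]
   common neighbours. *)
pose delta := (c + y - 1) %/ 2.
have cm u : u \in nb e V v -> delta <= #|nb e V u :&: nb e V v| + 1.
  rewrite nbP => /andP[uV evu]; have := contract_count uV vV vX ltac:(by rewrite se).
  rewrite yE -/n' /delta; move: y1 K2; rewrite Ec; clear; lia.
have [u uN] : exists u, u \in nb e V v.
  have [E|//] := set_0Vmem (nb e V v); [by case: (no_isolated vV vX E)|by case=> u; exists u].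
have dd : delta <= d.
  apply: leq_trans (cm u uN) _; rewrite /d (cardsD1 u (nb e V v)) uN addnC leq_add2l.
  apply/subset_leq_card/subsetP => z /setIP[zu zv]; rewrite in_setD1 zv andbT.
  by apply: contraTneq zu => ->; rewrite nbP ie andbF.
have d6 : 6 * K <= delta by rewrite /delta Ec; move: y1; clear; lia.
have dn : d * n' <= c * n' + y.
  rewrite -yE; apply: leq_trans (_ : \sum_(w in V :\: X) #|nb e V w| <= _).
    by rewrite mulnC -sum_nat_const; apply: leq_sum => w; apply: vmin.
  rewrite sum_deg; apply/subset_leq_card/subsetP => -[a b]; rewrite !inE /= => /and3P[/andP[-> ->] -> ->].
  by [].
have n3 : 3 <= n'.
  have k1 : d < #|V|.
    apply: proper_card; apply/properP; split; first by apply/subsetP => z; rewrite nbP => /andP[].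
    by exists v; rewrite // nbP ie andbF.
  have k2 : #|V| = n' + #|X| by rewrite addnC /n' cardsDS // subnKC // subset_leq_card.
  by move: k1 k2 dd d6 K2 hX; rewrite EN; clear; lia.
pose D := v |: nb e V v.
have cD : #|D| = d.+1 by rewrite cardsU1 nbP ie andbF.
have DV : D \subset V by rewrite subUset sub1set vV; apply/subsetP => z; rewrite nbP => /andP[].
(* The degree [d] is least, so [d * n'] is at most [c * n' + y]. A larger [d] would first force
   [n' <= y], and then [c + y <= d + 1] is too much for [n' >= 3]. *)
have d2 : d <= 2 * delta.
  rewrite leqNgt; apply/negP => big.
  have b1 : c + 1 <= d by move: big d6; rewrite Ec; clear; lia.
  have b2 : c + y <= d + 1 by move: big; rewrite /delta; clear; lia.
  have b3 : n' <= y by move: dn (leq_mul b1 (leqnn n')); clear; lia.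
  move: dn (leq_mul b2 (leqnn n')); move: n3 b3; clear; nia.
have [F [FD Fbig kF]] : exists F : {set T}, [/\ F \subset D, 2 * K < #|F| & klinked e F (2 * K)].
  apply: (@dense_linked _ _ D delta) => //; last 2 first.
  - by rewrite cD.
  - by rewrite cD; move: d2; clear; lia.
  move=> w /setU1P[->|wN].
    apply: leq_trans dd _; apply/subset_leq_card/subsetP => z zN; have := zN; rewrite !nbP => /andP[_ ->].
    by rewrite andbT in_setU1 zN orbT.
  apply: leq_trans (cm w wN) _.
  have -> : #|nb e V w :&: nb e V v| + 1 = #|v |: (nb e V w :&: nb e V v)|.
    by rewrite cardsU1 in_setI [v \in nb e V v]nbP ie !andbF addnC.
  apply/subset_leq_card/subsetP => z /setU1P[->|/setIP[zw zv]].
    by rewrite nbP setU11; move: wN; rewrite nbP se => /andP[].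
  by rewrite nbP in_setU1 zv orbT; move: zw; rewrite nbP => /andP[].
have [//|[W1 [S1 [sp1 dX1 lt1 lk1 sub1]]]] : linked e V X \/ exists W1 S1, [/\ sepn e V W1 S1, [disjoint X & W1], #|S1| < #|X|,
    linked e (W1 :|: S1) S1 & F :\: F :|: (F :\: S1) \subset W1].
  apply: linked_or_rigid => //; first exact: subset_trans DV.
  - by apply/disjP => z _; rewrite setDv inE.
  - by move=> a b; rewrite setDv inE.
  - by move=> Y YF YX; apply: kF => //; apply: leq_trans YX _; rewrite -EN.
apply: (no_rigid sp1 dX1 (ltnW lt1)) lk1.
move: sub1; rewrite setDv set0U => /subset_leq_card; apply: leq_trans.
rewrite cardsD subn_gt0; apply: leq_ltn_trans (_ : #|S1| < _); first by rewrite subset_leq_card ?subsetIr.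
by move: lt1 hX Fbig; rewrite EN; clear; lia.
Qed.

End Step.

(* Thomas and Wollan. Replacing the edges inside [X] by a complete graph minus the pairs to be
   linked changes neither massedness nor the available routings. *)
Theorem massed_linked (T : finType) (e : rel T) (V X : {set T}) K :
  symmetric e -> irreflexive e -> 1 < K -> #|X| <= 2 * K -> massed (12 * K) e V X -> linked e V X.
Proof.
move=> + + K2; have [n] := ubnP #|V|; elim: n V e X => // n IH V e X ltV se ie hX ms I s t pr.
apply: NNPP => no; have [is_ it st sX] := pr; have [XV m1 m2] := ms.
pose prt a b := [exists i, ((a == s i) && (b == t i)) || ((a == t i) && (b == s i))].
pose e1 := [rel a b | if (a \in X) && (b \in X) then (a != b) && ~~ prt a b else e a b].
have prtC a b : prt a b = prt b a.
  by apply: eq_existsb => i; rewrite orbC; congr (_ || _); apply: andbC.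
have se1 : symmetric e1 by move=> a b; rewrite /e1 /= andbC eq_sym prtC se.
have ie1 : irreflexive e1 by move=> a; rewrite /e1 /= eqxx ie; case: ifP.
have e1E a b : (a \notin X) || (b \notin X) -> e1 a b = e a b.
  by rewrite /e1 /= -negb_and => /negbTE->.
have arcsE (W : {set T}) : [disjoint X & W] -> arcs e1 V W = arcs e V W.
  move=> /disjP d; apply: eq_card => -[a b]; rewrite !inE /=; case: (boolP (a \in W)) => aW.
    have h : (a \notin X) || (b \notin X) by apply/orP; left; apply/negP => /d; apply.
    by have := e1E a b h; rewrite /e1 /= => ->.
  case: (boolP (b \in W)) => bW; last by rewrite !andbF.
  have h : (a \notin X) || (b \notin X) by apply/orP; right; apply/negP => /d; apply.
  by have := e1E a b h; rewrite /e1 /= => ->.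
have ms1 : massed (12 * K) e1 V X.
  split=> //; first by rewrite arcsE //; apply/disjP => z zX /setDP[_]; rewrite zX.
  move=> W S [WV SV dWS cl] dX lt; rewrite arcsE //; apply: (m2 W S) => //; split=> // a b aW bV eab.
  apply: (cl a b aW bV).
  have E : e1 a b = e a b by apply: e1E; apply/orP; left; apply/negP => aX; have /disjP/(_ a aX aW) := dX.
  exact: etrans E eab.
have nl1 : ~ linked e1 V X.
  move=> lk; have [C [CV CX con dis]] := lk I s t pr; apply: no; exists C; split=> // i.
  apply: connect_mono (con i) => // a b aC bC; rewrite /e1 /=; case: ifP => // /andP[aX bX] /andP[ab].
  have : a \in C i :&: X by rewrite inE aC.
  have : b \in C i :&: X by rewrite inE bC.
  rewrite CX /prt => b2 a2 /existsP[]; exists i.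
  by move: ab; case/set2P: a2 => ->; case/set2P: b2 => ->; rewrite ?eqxx ?orbT.
apply: (@not_massed T (12 * K) (2 * K) e1 V X se1 ie1 hX ms1 _ nl1 _ K) => //.
  by move=> V' e' X' lt' se' ie' hX' ms'; apply: IH => //; apply: leq_trans lt' _.
move=> u y z uX yX zX yu zu; rewrite /e1 /= uX yX zX /= ![u == _]eq_sym (negbTE yu) (negbTE zu) /= !negbK.
have h i y' : u = s i -> prt u y' -> y' = t i.
  move=> E /existsP[j /orP[]/andP[/eqP E1 /eqP ->]]; first by congr t; apply: is_; rewrite -E1.
  by have := st i j; rewrite -E E1 eqxx.
have h' i y' : u = t i -> prt u y' -> y' = s i.
  move=> E /existsP[j /orP[]/andP[/eqP E1 /eqP ->]]; last by congr s; apply: it; rewrite -E1.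
  by have := st j i; rewrite -E E1 eqxx.
move=> p1 p2; have /existsP[i /orP[]/andP[/eqP E _]] := p1; first by rewrite (h i y E p1) (h i z E p2).
by rewrite (h' i y E p1) (h' i z E p2).
Qed.

(** * The Tutte--Berge formula *)

Lemma even_invol (T : finType) (f : T -> T) (S : {set T}) :
  {in S, forall x, [/\ f x \in S, f (f x) = x & f x != x]} -> ~~ odd #|S|.
Proof.
have [n] := ubnP #|S|; elim: n S => // n IH S ltS h.
have [->|[x xS]] := set_0Vmem S; first by rewrite cards0.
have [fS ff fx] := h x xS.
have sub : [set x; f x] \subset S by apply/subsetP => z /set2P[]->.
have c2 : #|[set x; f x]| = 2 by rewrite cards2 eq_sym fx.
rewrite -(cardsID [set x; f x] S) (setIidPr sub) c2 add2n /= negbK; apply: IH.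
  by rewrite cardsDS // c2; move: ltS (subset_leq_card sub); rewrite c2; clear; lia.
move=> z /setDP[zS]; rewrite !inE negb_or => /andP[zx zf]; have [h1 h2 h3] := h z zS.
split=> //; rewrite h1 andbT negb_or; apply/andP; split.
  by apply: contraNneq zf => E; rewrite -E h2.
by apply: contraNneq zx => E; rewrite -h2 E ff.
Qed.

Section TutteBerge.
Variables (T : finType) (e : rel T).
Hypotheses (se : symmetric e) (ie : irreflexive e).
Implicit Types (V B : {set T}) (m : T -> T).

(** A matching is encoded as an involution whose fixed points are the uncovered vertices. *)
Definition mat V m := forall v, m (m v) = v /\ (m v <> v -> [/\ e v (m v), v \in V & m v \in V]).
Definition covered m := [set v | m v != v].
Definition maxmat V m := mat V m /\ forall m', mat V m' -> #|covered m'| <= #|covered m|.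

Lemma exists_maxmat V : exists m, maxmat V m.
Proof.
have ex0 : exists m, mat V m by exists id => v; split.
have bd m : mat V m -> #|covered m| <= #|T| by move=> _; apply: max_card.
by have [m [h1 h2]] := ex_max ex0 bd; exists m.
Qed.

Lemma covered_even V m : mat V m -> ~~ odd #|covered m|.
Proof.
move=> hm; apply: (even_invol (f := m)) => x; rewrite inE => mx; have [mm _] := hm x.
by rewrite inE mm eq_sym.
Qed.

Lemma add_edge V m x y : maxmat V m -> x \in V -> y \in V -> e x y -> m x = x -> m y = y -> False.
Proof.
move=> [hm mx] xV yV exy mxx myy.
have xy : x != y by apply: contraTneq exy => ->; rewrite ie.
pose m' w := if w == x then y else if w == y then x else m w.
have m'P : mat V m'.
  move=> w; rewrite /m'; case: (eqVneq w x) => [->|wx]; first by rewrite eqxx eq_sym (negbTE xy); split.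
  case: (eqVneq w y) => [->|wy]; first by rewrite eqxx se; split.
  have [mm hw] := hm w.
  have n1 : m w != x by apply: contraNneq wx => E; rewrite -mm E mxx.
  have n2 : m w != y by apply: contraNneq wy => E; rewrite -mm E myy.
  by rewrite (negbTE n1) (negbTE n2).
have := mx _ m'P; rewrite leqNgt => /negP; apply; apply: proper_card; apply/properP; split.
  apply/subsetP => w; rewrite !inE /m' => h; case: (eqVneq w x) => [->|_]; first by rewrite eq_sym.
  by case: (eqVneq w y) => [->|_].
by exists x; rewrite !inE ?mxx ?eqxx // /m' eqxx eq_sym.
Qed.

(** Gallai's lemma, by induction on the length of a path between two vertices missed by [M]. Among
    the maximum matchings that miss the second vertex [t] of the path choose [N] agreeing with [M]
    most often. Some vertex other than [t] is covered by [M] and not by [N], and matching it as [M]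
    does improves the agreement. *)
Lemma gallai V n u q : (forall v, v \in V -> exists m, maxmat V m /\ m v = v) ->
  size q <= n -> u \in V -> path (rstr e V) u q -> u != last u q ->
  forall m, maxmat V m -> m u = u -> m (last u q) = last u q -> False.
Proof.
move=> crit; elim: n u q => [|n IH] u [|t q] //=; rewrite ?eqxx // ltnS => sz uV.
move=> /andP[/and3P[eut _ tV] pq] uv M mM Mu Mv.
have ut : u != t by apply: contraTneq eut => ->; rewrite ie.
have [Et|tv] := eqVneq t (last t q).
  by apply: (add_edge mM uV tV eut Mu); rewrite Et.
set v := last t q in uv Mv tv *.
have vV : v \in V.
  rewrite /v; elim: (q) t tV {eut ut tv v uv Mv sz} pq => //= c r IHr t tV /andP[/and3P[_ _ cV] pr]; exact: IHr.
pose agree N := #|[set w | M w == N w]|.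
have bd N : maxmat V N /\ N t = t -> agree N <= #|T| by move=> _; apply: max_card.
have [N [[mN Nt] best]] := ex_max (crit t tV) bd.
have [hN xN] := mN; have [hM xM] := mM.
have Nu : N u != u by apply/eqP => Nu; apply: add_edge mN uV tV eut Nu Nt.
have Nv : N v != v by apply/eqP => Nv; apply: (IH t q sz tV pq tv N mN Nt Nv).
have Mt : M t != t by apply/eqP => Mt; apply: add_edge mM uV tV eut Mu Mt.
have eqc : #|covered M| = #|covered N| by apply/eqP; rewrite eqn_leq xM // xN.
(* [N] covers [u] and [v], which [M] misses, and both cover equally many vertices. So [M] covers at
   least two vertices missed by [N], and one of them is not [t]. *)
have [x [xt Mx Nx]] : exists x, [/\ x != t, M x != x & N x = x].
  apply: NNPP => no.
  have sub : covered M :\ t \subset covered N :\: [set u; v].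
    apply/subsetP => w; rewrite !inE => /andP[wt Mw]; rewrite negb_or; apply/andP; split.
      by apply/andP; split; apply: contraNneq Mw => ->; apply/eqP.
    by apply/eqP => Nw; apply: no; exists w.
  have := subset_leq_card sub; have c2 : #|[set u; v]| = 2 by rewrite cards2 uv.
  have sub2 : [set u; v] \subset covered N by apply/subsetP => w /set2P[]->; rewrite inE.
  rewrite (cardsDS sub2).
  have := cardsD1 t (covered M); rewrite inE Mt c2 eqc.
  have := subset_leq_card sub2.
  by rewrite c2; clear; lia.
set y := M x in Mx; have [MMx /(_ (elimN eqP Mx))[exy xV yV]] := hM x; rewrite -/y in MMx exy yV.
have Ny : N y != y by apply/eqP => Ny; apply: add_edge mN xV yV exy Nx Ny.
set z := N y in Ny; have [NNy hy] := hN y; rewrite -/z in NNy hy.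
have zx : z != x by apply: contraNneq Ny => E; have := NNy; rewrite E Nx => <-; rewrite -E.
(* The edge [yz] of [N] is traded for the edge [xy] of [M]; [t] stays uncovered. *)
pose N' w := if w == x then y else if w == y then x else if w == z then z else N w.
have xy : x != y by rewrite eq_sym.
have N'P : mat V N'.
  move=> w; rewrite /N'; case: (eqVneq w x) => [->|wx]; first by rewrite eqxx (negbTE Mx); split.
  case: (eqVneq w y) => [->|wy]; first by rewrite eqxx se; split.
  case: (eqVneq w z) => [->|wz]; first by rewrite (negbTE zx) (negbTE Ny) eqxx.
  have [mm hw] := hN w.
  have n1 : N w != x by apply: contraNneq wx => E; rewrite -mm E Nx.
  have n2 : N w != y by apply: contraNneq wz => E; rewrite -mm E.
  have n3 : N w != z by apply: contraNneq wy => E; rewrite -mm E NNy.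
  by rewrite (negbTE n1) (negbTE n2) (negbTE n3).
have ty : t != y by apply: contraNneq Ny => E; rewrite /z -E Nt.
have tz : t != z by apply: contraNneq Ny => E; rewrite -NNy -E Nt.
have N't : N' t = t by rewrite /N' eq_sym (negbTE xt) (negbTE ty) (negbTE tz).
have cN' : #|covered N'| = #|covered N|.
  apply/eqP; rewrite eqn_leq xN //=; have c1 : z \in covered N by rewrite inE NNy eq_sym.
  have c0 : x \notin covered N by rewrite inE Nx eqxx.
  have sub : x |: (covered N :\ z) \subset covered N'.
    apply/subsetP => w /setU1P[->|/setD1P[wz]]; rewrite !inE /N'; first by rewrite eqxx.
    by move=> Nw; case: (eqVneq w x) => [->//|_]; case: (eqVneq w y) => [->//|_]; rewrite (negbTE wz).
  have := subset_leq_card sub; rewrite cardsU1 !inE Nx eqxx andbF (cardsD1 z (covered N)) c1; by [].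
have mN' : maxmat V N' by split=> // m' /xN; rewrite cN'.
have := best N' (conj mN' N't); rewrite leqNgt => /negP; apply; apply: proper_card; apply/properP; split.
  apply/subsetP => w; rewrite !inE /N' => /eqP MN; case: (eqVneq w x) => [E|wx]; first by rewrite E.
  case: (eqVneq w y) => [E|wy]; first by rewrite E MMx.
  case: (eqVneq w z) => [E|wz]; last by rewrite MN.
  have [MMz _] := hM z; move: MN; rewrite E NNy => h; case/negP: zx.
  by rewrite -MMz h MMx.
by exists x; rewrite !inE /N' ?eqxx // Nx; apply: contraNneq Mx => <-.
Qed.

(** A vertex that every maximum matching covers goes into the barrier [B], and induction handles the
    rest. When there is none, Gallai's lemma puts the uncovered vertices into different components,
    each of them odd. The classes of [f] stand for the components of [V :\: B]; they may be unions
    of several. *)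
Lemma tutte_berge V : exists m B (f : T -> T), [/\ maxmat V m, B \subset V,
  forall a b, a \in V :\: B -> b \in V :\: B -> e a b -> f a = f b
  & #|V| + #|B| <= #|covered m| + #|[set y | odd #|[set a in V :\: B | f a == y]|]|].
Proof.
have [n] := ubnP #|V|; elim: n V => // n IH V ltV.
have [m mm] := exists_maxmat V; have [hm xm] := mm.
case: (classic (exists2 v, v \in V & forall m', maxmat V m' -> m' v <> v)) => [[v vV ess]|noess].
  have [m' [B [f [mm' BV fE le]]]] := IH (V :\ v) ltac:(by move: ltV; rewrite (cardsD1 v) vV; clear; lia).
  have sV : V :\ v \subset V := subsetDl _ _; have [hm' xm'] := mm'.
  have m'v : m' v = v.
    by apply: NNPP => h; have [_ /(_ h)[_]] := hm' v; rewrite in_setD1 eqxx.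
  have hm'V : mat V m'.
    move=> w; have [h1 h2] := hm' w; split=> // /h2[h3 h4 h5]; by split=> //; apply: (subsetP sV).
  have lt : #|covered m'| < #|covered m|.
    rewrite ltnNge; apply/negP => ge; apply: (ess m') => //; split=> // m2 /xm h; exact: leq_trans h ge.
  have e1 := covered_even hm; have e2 := covered_even hm'V.
  have vB : v \notin B by apply/negP => /(subsetP BV); rewrite in_setD1 eqxx.
  have DE : V :\: (v |: B) = V :\ v :\: B.
    by apply/setP => z; rewrite !inE negb_or; case: (z == v); rewrite ?andbF ?andbT.
  exists m, (v |: B), f; split=> //.
  - by rewrite subUset sub1set vV (subset_trans BV).
  - by rewrite DE.
  - rewrite DE cardsU1 vB (cardsD1 v V) vV.
    (* Both numbers are even, so the loss is at least two, which pays for [v] in [V] and in the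
       barrier. *)
    have : #|covered m'| + 2 <= #|covered m|.
      by move: lt e1 e2; move: #|covered m'| #|covered m| => a b; clear; lia.
    by move: le; clear; lia.
have crit v : v \in V -> exists m, maxmat V m /\ m v = v.
  move=> vV; apply: NNPP => no; apply: noess; exists v => // m' mm' E; apply: no; by exists m'.
have sc : connect_sym (rstr e V).
  by apply: sym_connect_sym => a b; rewrite /rstr /= se; congr (_ && _); apply: andbC.
exists m, set0, (root (rstr e V)); split=> //; first exact: sub0set.
  move=> a b; rewrite setD0 => aV bV eab; apply/eqP; rewrite root_connect //; exact: connect_step.
rewrite cards0 addn0 setD0.
pose Ex := [set u in V | m u == u].
have cV : #|V| <= #|covered m| + #|Ex|.
  apply: leq_trans (_ : #|covered m :|: Ex| <= _); last exact: (leq_card_setU _ _).1.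
  by apply/subset_leq_card/subsetP => z zV; rewrite !inE zV /=; case: (m z == z).
apply: leq_trans cV _; rewrite leq_add2l.
have gal u v : u \in Ex -> v \in V -> m v = v -> connect (rstr e V) u v -> u = v.
  rewrite inE => /andP[uV /eqP mu] vV mv /connectP[q pq E]; apply/eqP/negPn/negP => uv.
  by apply: (gallai (n := size q) crit _ uV pq _ mm mu); rewrite -?E.
have inj : {in Ex &, injective (root (rstr e V))}.
  move=> u v uE vE /eqP; rewrite root_connect //; move: (vE); rewrite inE => /andP[vV /eqP mv]; exact: gal.
rewrite -(card_in_imset inj); apply/subset_leq_card/subsetP => _ /imsetP[u uE ->].
(* All vertices of the component other than [u] are matched among themselves. *)
rewrite inE; set C := [set a in V | _]; have uC : u \in C.
  by move: uE; rewrite !inE eqxx => /andP[->].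
rewrite (cardsD1 u) uC add1n /=; apply: (even_invol (f := m)) => a; rewrite !inE => /and3P[au aV /eqP ra].
have ma : m a <> a.
  move=> E; case/eqP: au; apply/esym/gal => //; by rewrite -root_connect // ra.
have [mma /(_ ma)[eam _ mV]] := hm a; split=> //; last exact/eqP.
rewrite mV; apply/andP; split.
  by apply: contraNneq au => E; move: uE; rewrite inE -E mma => /andP[].
by rewrite /= -ra root_connect // sc; apply: connect_step.
Qed.

End TutteBerge.

(** * Paths of the wrong parity *)

Lemma closed_connect_in (T : finType) (r : rel T) (S : {set T}) x y :
  (forall a b, r a b -> a \in S -> b \in S) -> connect r x y -> x \in S -> y \in S.
Proof.
move=> cl /connectP[q]; elim: q x => [|z q IH] x /=; first by move=> _ ->.
by move=> /andP[xz pq] E xS; apply: IH pq E _; apply: cl xz xS.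
Qed.

Lemma card_pairs_bool (T : finType) (S : {set T * bool}) :
  #|S| = \sum_v (((v, true) \in S) + ((v, false) \in S)).
Proof.
rewrite -sum1_card big_mkcond.
transitivity (\sum_v \sum_(k : bool) ((v, k) \in S : nat)).
  by rewrite pair_big /=; apply: eq_bigr => -[v k] _ /=; case: (_ \in S).
by apply: eq_bigr => v _; rewrite big_bool.
Qed.

Lemma card_sum_bool (T : finType) (S : {set T}) : #|S| = \sum_v (v \in S).
Proof. by rewrite -sum1_card big_mkcond; apply: eq_bigr => v _; case: (v \in S). Qed.

Section Breaking.
Variables (T : finType) (e : rel T) (c : T -> bool) (A : {set T}).
Hypotheses (se : symmetric e) (ie : irreflexive e).
Implicit Types (W : {set T}) (p : seq T) (m : T * bool -> T * bool).

(* The parity is the opposite of that of a path with alternating colours and the same ends. *)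
Definition breaking p := exists a b, [/\ is_path e p a b, a \in A, b \in A, a != b &
  (forall z, z \in p -> z \in A -> z = a \/ z = b) /\ odd (size p).-1 = (c a == c b)].

(* Two copies of every vertex outside [A], joined by a rung, and one copy of every vertex of [A]. *)
Definition VG W : {set T * bool} := [set x | (x.1 \in W) && ((x.1 \notin A) || (x.2 == ~~ c x.1))].
Definition eG : rel (T * bool) :=
  [rel x y | (x.2 == y.2) && e x.1 y.1 || [&& x.1 == y.1, x.2 != y.2 & x.1 \notin A]].
Definition rung (x : T * bool) := (x.1, ~~ x.2).

Lemma rungK : involutive rung. Proof. by case=> v k; rewrite /rung /= negbK. Qed.
Lemma rung_neq x : rung x <> x. Proof. by case: x => v []; case. Qed.

Lemma VG_rung W x : x \in VG W -> x.1 \notin A -> rung x \in VG W.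
Proof. by rewrite !inE /= => /andP[-> _] ->. Qed.

Lemma eG_sym : symmetric eG.
Proof.
move=> [v k] [w l]; rewrite /eG /= se eq_sym; congr (_ || _).
by rewrite [v == w]eq_sym; case: eqP => //= ->.
Qed.

Lemma eG_irr : irreflexive eG.
Proof. by case=> v k; rewrite /eG /= ie !eqxx andbF. Qed.

Lemma VG_A W x y : x \in VG W -> y \in VG W -> x.1 \in A -> x.1 = y.1 -> x = y.
Proof.
case: x y => v k [w l]; rewrite !inE /= => /andP[_ h1] /andP[_ h2] vA E; subst w.
by rewrite vA /= in h1 h2; rewrite (eqP h1) (eqP h2).
Qed.

(* The alternating path that makes [m] better than the rungs projects to a breaking path. *)
Lemma find_breaking W m : mat eG (VG W) m -> 2 * #|W :\: A| < #|covered m| ->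
  exists p m', [/\ breaking p, {subset p <= W}, mat eG (VG (W :\: [set z in p])) m' &
    2 * #|W :\: [set z in p] :\: A| + #|covered m| <= 2 * #|W :\: A| + #|covered m'| + 2].
Proof.
move=> hm big.
have mm x : m (m x) = x by case: (hm x).
have covV x : m x != x -> x \in VG W by move/eqP => h; have [_ /(_ h)[]] := hm x.
have covm x : m x != x -> m (m x) != m x by rewrite mm eq_sym.
(* A matching edge followed by a rung: iterating [h] walks along the alternating path. *)
pose h x := if m x == x then x else rung (m x).
pose S0 := [set x in covered m | x.1 \in A].
pose Ux := [set x : T * bool | (x.1 \in W :\: A) && (m x == x)].
(* The surplus of [m] over the rungs in terms of ends: more walks start in [A] than can stop at an
   uncovered copy outside [A]. *)
have ltUS : #|Ux| < #|S0|.
  have c1 : #|[set x : T * bool | x.1 \in W :\: A]| = 2 * #|W :\: A|.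
    have -> : [set x : T * bool | x.1 \in W :\: A] = setX (W :\: A) [set: bool].
      by apply/setP => -[v k]; rewrite !inE andbT.
    by rewrite cardsX cardsT card_bool mulnC.
  have c2 : #|covered m| <= #|S0| + #|[set x : T * bool | x.1 \in W :\: A] :\: Ux|.
    apply: leq_trans (_ : #|S0 :|: ([set x : T * bool | x.1 \in W :\: A] :\: Ux)| <= _); last exact: (leq_card_setU _ _).1.
    apply/subset_leq_card/subsetP => x; rewrite !inE => mx; have := covV x mx; rewrite inE => /andP[xW _].
    by rewrite (negbTE mx) xW; case: (x.1 \in A).
  have sub : Ux \subset [set x : T * bool | x.1 \in W :\: A] by apply/subsetP => x; rewrite !inE => /andP[].
  rewrite cardsDS // c1 in c2; have := subset_leq_card sub; rewrite c1; move: big c2; clear; lia.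
(* If no walk came back to [A], then [h] would map the covered copies that are reached injectively
   to reached copies outside [S0], and the uncovered ones, all in [Ux], would be at least as many as
   [S0]. The least [n] keeps the interior of the walk out of [A]. *)
have [n [[x0 [x0S cn nA]] nmin]] : exists n, (exists x0, [/\ x0 \in S0, m (iter n h x0) != iter n h x0 & (m (iter n h x0)).1 \in A])
    /\ forall k, (exists x0, [/\ x0 \in S0, m (iter k h x0) != iter k h x0 & (m (iter k h x0)).1 \in A]) -> n <= k.
  apply: (@ex_min nat _ id); apply: NNPP => no.
  have no' x n : x \in S0 -> m (iter n h x) != iter n h x -> (m (iter n h x)).1 \notin A.
    by move=> h1 h2; apply/negP => h3; apply: no; exists n, x.
  pose D := [set y | [exists x in S0, fconnect h x y]].
  have DP y : reflect (exists2 x, x \in S0 & exists n, y = iter n h x) (y \in D).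
    rewrite inE; apply: (iffP existsP) => [[x /andP[xS /iter_findex E]]|[x xS [n ->]]].
      by exists x => //; exists (findex h x y).
    by exists x; rewrite xS fconnect_iter.
  have D1 y : y \in D -> y \in covered m -> (m y).1 \notin A.
    by move=> /DP[x xS [n ->]]; rewrite inE; apply: no'.
  have D2 y : y \in D -> y \notin covered m -> y \in Ux.
    move=> /DP[x xS [n ->]]; rewrite !inE negbK => cy; rewrite cy andbT.
    have : (iter n h x \in S0) || (iter n h x \in VG W) && ((iter n h x).1 \notin A).
      elim: n {cy} => [|n IHn] /=; first by rewrite xS.
      rewrite {1 3 5}/h; case: ifP => [//|/negbT cn]; apply/orP; right.
      have mA := no' x n xS cn; rewrite VG_rung ?mA //; exact/covV/covm.
    rewrite !inE cy /= => /andP[/andP[xW _] xA]; by rewrite xA xW.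
  have hinj : {in D :&: covered m &, injective h}.
    move=> y z /setIP[_]; rewrite inE => /negbTE cy /setIP[_]; rewrite inE => /negbTE cz.
    by rewrite /h cy cz => /(can_inj rungK)/(can_inj mm).
  have subD : S0 :|: h @: (D :&: covered m) \subset D.
    apply/subsetP => y /setUP[yS|/imsetP[z /setIP[/DP[x xS [n ->]] _] ->]].
      by apply/DP; exists y => //; exists 0.
    by apply/DP; exists x => //; exists n.+1.
  have dis : [disjoint S0 & h @: (D :&: covered m)].
    apply/disjP => y; rewrite !inE => /andP[_ yA] /imsetP[z /setIP[zD zc] E].
    move: (D1 z zD zc); rewrite -[(m z).1]/((rung (m z)).1); move: zc; rewrite inE => /negbTE zc.
    by move: E; rewrite /h zc => <-; rewrite yA.
  have := subset_leq_card subD; rewrite cardsU (disjoint_setI0 dis) cards0 subn0 card_in_imset //.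
  have : #|D :\: covered m| <= #|Ux| by apply/subset_leq_card/subsetP => y /setDP[]; apply: D2.
  have := cardsID (covered m) D; move: ltUS.
  move: #|Ux| #|S0| #|D :&: covered m| #|D :\: covered m| #|D| => *; lia.
pose x i := iter i h x0.
have xS i : m (x i) != x i -> x i.+1 = rung (m (x i)) by move=> /negbTE ci; rewrite /x /= /h ci.
have cov i : i <= n -> m (x i) != x i.
  move=> le; apply: contraNneq cn => E; rewrite -(subnK le) iterD -/(x i).
  have -> : iter (n - i) h (x i) = x i; last by rewrite E.
  by elim: (n - i) => //= k ->; rewrite /h E eqxx.
have xV i : i <= n -> x i \in VG W by move=> /cov/covV.
have mV i : i <= n -> m (x i) \in VG W by move=> /cov/covm/covV.
have x0A : (x 0).1 \in A by move: x0S; rewrite inE => /andP[].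
have mA i : i < n -> (m (x i)).1 \notin A.
  move=> lt; apply/negP => h1; suff: n <= i by rewrite leqNgt lt.
  by apply: nmin; exists x0; split=> //; apply: cov; apply: ltnW.
have nA' : (m (x n)).1 \in A := nA.
clearbody x.
have xA i : 0 < i <= n -> (x i).1 \notin A.
  by case: i => // i lt; rewrite xS; [apply: mA|apply: cov; apply: ltnW].
(* A matched rung would make the previous copy matched by its rung too, and so on back to the start,
   which lies in [A] and has no rung. *)
have norung i : i <= n -> m (x i) <> rung (x i).
  elim: i => [|i IHi] le E.
    have [_ /(_ (elimN eqP (cov 0 le)))[]] := hm (x 0); rewrite E /eG /= ie andbF /= eqxx x0A /=.
    by rewrite andbF.
  have le' := ltnW le; apply: (IHi le'); have E1 := xS i (cov i le').
  have E2 : m (x i.+1) = m (x i) by rewrite E E1 rungK.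
  have E3 := can_inj mm E2; by rewrite -[in RHS]E3 E1 rungK.
have edge i : i <= n -> (m (x i)).2 = (x i).2 /\ e (x i).1 (m (x i)).1.
  move=> le; have [_ /(_ (elimN eqP (cov i le)))[+ _ _]] := hm (x i).
  rewrite /eG /= => /orP[/andP[/eqP-> ->//]|/and3P[/eqP E1 E2 _]]; case: (norung i le).
  move: E1 E2; case: (m (x i)) => v k; case: (x i) => w l /= <-; rewrite /rung /=.
  by case: k; case: l.
have x1 i : i <= n -> (x i.+1).1 = (m (x i)).1 by move=> /cov/xS->.
(* If the walk met both copies of a vertex, the part between them would be symmetric, and in its
   middle a copy would be its own partner or its own rung. *)
have pairs d i j : j - i <= d -> 0 < i -> i < j -> j <= n -> x j <> rung (x i).
  elim: d i j => [|d IHd] i j; first by move=> *; lia.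
  case: j => // j le i0 ij jn E; have jn' := ltnW jn.
  have E1 : m (x j) = x i by apply: (can_inj rungK); rewrite -(xS j (cov j jn')).
  have E2 : x j = m (x i) by rewrite -E1 mm.
  have ii : i <= n by lia.
  have [Eij|ij'] : i = j \/ i < j by lia.
    by move: (cov j jn'); rewrite E1 Eij eqxx.
  have E3 : x i.+1 = rung (x j) by rewrite xS ?cov // E2.
  have [Ej|lt] : j = i.+1 \/ i.+1 < j by lia.
    by apply: (@rung_neq (x j)); rewrite -E3 Ej.
  by apply: (IHd i.+1 j) => //; [lia|rewrite E3 rungK].
have distinct i j : 0 < i -> i < j -> j <= n -> (x i).1 <> (x j).1.
  move=> i0 ij jn E; have [Eij|Eij] : x j = x i \/ x j = rung (x i).
    move: E; case: (x i) => v k; case: (x j) => w l /= ->; rewrite /rung /=.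
    by case: k; case: l; auto.
    have [k Ej] : exists k, j = i + k.+1 by exists (j - i).-1; lia.
    have : (x k.+1).1 \in A; last by apply/negP; apply: xA; lia.
    suff -> : x k.+1 = x 0 by [].
    move: Eij; rewrite Ej; have : i + k.+1 <= n by lia.
    elim: (i) => [|i' IHi'] // le'; have k1 : m (x (i' + k.+1)) != x (i' + k.+1) by apply: cov; lia.
    have k2 : m (x i') != x i' by apply: cov; lia.
    by rewrite addSn (xS _ k1) (xS _ k2) => /(can_inj rungK)/(can_inj mm); apply: IHi'; lia.
  by case: (pairs (j - i) i j).
have bA : (x n.+1).1 \in A by rewrite x1.
have ab : (x 0).1 != (x n.+1).1.
  apply/eqP; rewrite x1 // => E; have E1 : m (x n) = x 0.
    by apply: (VG_A (mV n _) (xV 0 _)).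
  have E2 : x n = m (x 0) by rewrite -E1 mm.
  case: (posnP n) => [n0|npos]; first by move: (cov 0 (leq0n n)); rewrite -E2 n0 eqxx.
  have E3 : x 1 = rung (x n) by rewrite xS ?cov // E2.
  have [n1|n1] : n = 1 \/ 1 < n by lia.
    by apply: (@rung_neq (x 1)); rewrite {2}E3 n1.
  by apply: (pairs n 1 n) => //; [lia|rewrite E3 rungK].
pose w i := (x i).1.
have winj i j : i < j -> j <= n.+1 -> w i <> w j.
  move=> ij jn; have [Ej|lt] : j = n.+1 \/ j <= n by lia.
    case: (posnP i) => [->|i0]; first by rewrite Ej; apply/eqP.
    move=> E; move: (xA i); rewrite -/(w i) E Ej /w bA => h'; by have : false by apply: h'; lia.
  case: (posnP i) => [->|i0]; last exact: distinct.
  by move=> E; move: (xA j); rewrite -/(w j) -E /w x0A => h'; have : false by apply: h'; lia.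
pose p := mkseq w n.+2.
have pP : is_path e p (x 0).1 (x n.+1).1.
  exists [seq w i | i <- iota 1 n.+1]; split => //.
  - have : forall k l, k + l <= n.+1 -> path e (w k) [seq w i | i <- iota k.+1 l].
      move=> k l; elim: l k => //= l IHl k le; rewrite IHl ?andbT; last by lia.
      by rewrite /w x1; [apply: (edge k _).2; lia|lia].
    by apply.
  - have : forall k l, last (w k) [seq w i | i <- iota k.+1 l] = w (k + l).
      by move=> k l; elim: l k => [|l IHl] k /=; rewrite ?addn0 // IHl addSnnS.
    by move=> ->.
  - rewrite map_inj_in_uniq ?iota_uniq // => i j; rewrite !mem_iota !add0n /= => il jl E.
    have [//|[lt|lt]] : i = j \/ i < j \/ j < i by lia.
      by case: (winj i j lt); [lia|].
    by case: (winj j i lt); [lia|].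
have memp z : reflect (exists2 i, i <= n.+1 & z = w i) (z \in p).
  apply: (iffP mapP) => [[i + ->]|[i le ->]]; first by rewrite mem_iota => h'; exists i => //; lia.
  by exists i => //; rewrite mem_iota; lia.
have up : uniq p by apply: is_path_uniq pP.
have szp : size p = n.+2 by apply: size_mkseq.
clearbody p.
have xW i : i <= n.+1 -> w i \in W.
  move=> le; have [le'|->] : i <= n \/ i = n.+1 by lia.
    by have := xV i le'; rewrite inE => /andP[].
  by rewrite /w x1 //; have := mV n (leqnn n); rewrite inE => /andP[].
have states z : z \in VG W -> z.1 \in p -> exists2 i, i <= n & z = x i \/ z = m (x i).
  move=> zV /memp[i le E].
  have [i0|[En|[i0 lt]]] : i = 0 \/ i = n.+1 \/ 0 < i /\ i <= n by lia.
  - exists 0 => //; left; apply/esym/(VG_A (xV 0 _) zV) => //; by rewrite E i0.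
  - exists n => //; right; apply/esym/(VG_A (mV n _) zV) => //; by rewrite E En /w x1.
  have [Ez|Ez] : z = x i \/ z = rung (x i).
    move: E; rewrite /w; case: (z) => v k; case: (x i) => u l /= ->; rewrite /rung /=.
    by case: k; case: l; auto.
  - by exists i; auto.
  exists i.-1; first by lia.
  by right; rewrite Ez -[in LHS](prednK i0) xS ?rungK ?prednK //; apply: cov; lia.
have xp i : i <= n -> (x i).1 \in p by move=> le; apply/memp; exists i; rewrite // leqW.
have mp i : i <= n -> (m (x i)).1 \in p by move=> le; apply/memp; exists i.+1; rewrite // /w x1.
have mstable z : z \in VG W -> z.1 \in p -> (m z).1 \in p.
  by move=> zV /(states z zV)[i le [->|->]]; rewrite ?mm; [apply: mp|apply: xp].
pose m' z := if z.1 \in p then z else m z.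
(* Each rung changes the level, and a vertex of [A] only exists on the level opposite to its colour.
   So the colours of the ends determine the parity of [n], and with it that of the [n + 1] edges of
   [p]. *)
have level i : i <= n -> (x i).2 = (x 0).2 (+) odd i.
  elim: i => [|i IHi] le; first by rewrite addbF.
  rewrite xS ?cov 1?ltnW //= (edge i _).1 1?ltnW // IHi 1?ltnW //.
  by case: (x 0).2; case: (odd i).
exists p, m'; split.
- exists (x 0).1, (x n.+1).1; split=> //; split.
    move=> z /memp[i le ->] zA; have [->|[->|lt]] : i = 0 \/ i = n.+1 \/ 0 < i <= n by lia.
    + by left.
    + by right.
    + by have := xA i lt; rewrite -/(w i) zA.
  rewrite szp /=; have := xV 0 (leq0n n); rewrite inE x0A /= => /andP[_ /eqP h0].
  have := mV n (leqnn n); rewrite inE nA' /= (edge n _).1 // level // h0 -x1 // => /andP[_ /eqP].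
  by case: (c _); case: (c _); case: (odd n).
- by move=> z /memp[i le ->]; apply: xW.
- move=> z; rewrite /m'; case: (boolP (z.1 \in p)) => zp; first by rewrite zp; split.
  case: (boolP (m z == z)) => [/eqP E|nz]; first by rewrite E (negbTE zp); split.
  have mzp : (m z).1 \notin p.
    by apply: contra zp => h1; rewrite -[z]mm; apply: mstable => //; apply/covV/covm.
  rewrite (negbTE mzp) mm; split=> // _; have [_ /(_ (elimN eqP nz))[ez zV mzV]] := hm z.
  by split=> //; move: zV mzV; rewrite !inE ?zp ?mzp.
(* The path takes away at most [2 * (n + 1)] covered copies and [n] inner vertices, each worth two,
   so the surplus drops by at most two. *)
have cSt : #|covered m| <= #|covered m'| + 2 * n.+1.
  pose Y1 := [set x (val i) | i : 'I_n.+1]; pose Y2 := [set m (x (val i)) | i : 'I_n.+1].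
  apply: leq_trans (_ : #|covered m' :|: (Y1 :|: Y2)| <= _).
    apply/subset_leq_card/subsetP => z; rewrite inE => mz; rewrite !in_setU.
    case: (boolP (z.1 \in p)) => zp; last by rewrite inE /m' (negbTE zp) mz.
    have [i le [E|E]] := states z (covV z mz) zp.
      by rewrite [z \in Y1](_ : _ = true) ?orbT // E; apply/imsetP; exists (Ordinal (n:=n.+1) (m:=i) le).
    by rewrite [z \in Y2](_ : _ = true) ?orbT // E; apply/imsetP; exists (Ordinal (n:=n.+1) (m:=i) le).
  apply: leq_trans (leq_card_setU _ _).1 _; rewrite leq_add2l.
  apply: leq_trans (leq_card_setU _ _).1 _; rewrite mul2n -addnn.
  by apply: leq_add; apply: leq_trans (leq_imset_card _ _) _; rewrite card_ord.
have cW : #|W :\: [set z in p] :\: A| + n <= #|W :\: A|.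
  have c1 : #|W :\: [set z in p] :\: A| + #|[set z in p] :\: A| <= #|W :\: A|.
    rewrite -cardsUI (_ : _ :&: _ = set0) ?cards0 ?addn0.
      apply/subset_leq_card/subsetP => z; rewrite !inE => /orP[/and3P[-> _ ->]//|/andP[-> zp]].
      by case/memp: zp => i le ->; rewrite xW.
    by apply/setP => z; rewrite !inE; case: (z \in p); case: (z \in A); case: (z \in W).
  have c2 : n.+2 <= #|[set z in p] :\: A| + 2.
    have -> : n.+2 = #|[set z in p]| by rewrite cardsE (card_uniqP up).
    rewrite -(cardsID A [set z in p]) addnC leq_add2l.
    apply: leq_trans (_ : #|[set (x 0).1; (x n.+1).1]| <= 2); last by rewrite cards2; case: (_ != _).
    apply/subset_leq_card/subsetP => z; rewrite in_setI inE => /andP[/memp[i le ->] zA].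
    have [->|[->|lt]] : i = 0 \/ i = n.+1 \/ 0 < i <= n by lia.
    + by rewrite set21.
    + by rewrite set22.
    + by have := xA i lt; rewrite -/(w i) zA.
  by move: c1 c2; clear; lia.
by move: cSt cW; clear; lia.
Qed.

(** The rungs cover [2 * #|W :\: A|] copies; each path uses up at most two of the surplus. *)
Lemma breaking_paths j W m : mat eG (VG W) m -> 2 * #|W :\: A| + 2 * j <= #|covered m| ->
  exists P : 'I_j -> seq T, (forall i, breaking (P i) /\ {subset P i <= W}) /\
    (forall i k z, z \in P i -> z \in P k -> i = k).
Proof.
elim: j W m => [|j IH] W m hm big.
  by exists (fun _ => [::]); split => [[]|[]].
have [p [m' [bp pW hm' le]]] := find_breaking hm ltac:(by move: big; clear; lia).
have [P [h1 h2]] := IH _ m' hm' ltac:(by move: big le; clear; lia).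
have h3 i z : z \in p -> z \in P i -> False.
  by move=> zp zP; have [_ /(_ z zP)] := h1 i; rewrite !inE zp.
exists (fun i : 'I_j.+1 => if unlift ord0 i is Some k then P k else p); split=> [i|i k z].
  case: unliftP => [k _|_]; last by [].
  by have [bk sk] := h1 k; split=> // z /sk /setDP[].
case: unliftP => [i' ->|->]; case: unliftP => [k' ->|->] // zi zk.
- by rewrite (h2 _ _ _ zi zk).
- by case: (h3 i' z).
- by case: (h3 k' z).
Qed.

(** If the matching is too small, there is a barrier [B]. A vertex with both copies outside [B] has
    them in one class because of its rung, and by connectivity such vertices would spread to [A],
    where there is only one copy. So every vertex outside [Z] keeps exactly one copy, and its level
    is a proper colouring. *)
Lemma breaking_paths_or_bipartite j : 0 < j -> (forall X : {set T}, #|X| < 2 * j -> connected_minus e X) -> 2 * j <= #|A| ->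
  (exists P : 'I_j -> seq T, (forall i, breaking (P i)) /\ (forall i k z, z \in P i -> z \in P k -> i = k))
  \/ exists Z : {set T}, #|Z| <= 2 * j - 2 /\ bipartite_minus e Z.
Proof.
move=> j0 con bigA; have [m [B [f [mm BV fE le]]]] := tutte_berge eG_sym eG_irr (VG [set: T]).
set V := VG [set: T] in mm BV fE le; have [hm xm] := mm.
have [big|small] := leqP (2 * #|[set: T] :\: A| + 2 * j) #|covered m|.
  by left; have [P [h1 h2]] := breaking_paths hm big; exists P; split=> // i; case: (h1 i).
right; have ev := covered_even hm.
pose free v k := ((v, k) \in V) && ((v, k) \notin B).
have freeD v k : free v k = ((v, k) \in V :\: B) by rewrite in_setD andbC.
have VP v k : ((v, k) \in V) = (v \notin A) || (k == ~~ c v) by rewrite !inE.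
clearbody V.
pose kap v := free v true; pose cl v := f (v, kap v).
pose full v := free v true && free v false.
pose one v := free v true (+) free v false.
have oneP v : one v -> free v (kap v) /\ forall k, free v k -> k = kap v.
  by rewrite /one /kap; case: (boolP (free v true)) => h1 h2; split => //; case => //; rewrite ?(negbTE h1) //; move: h2; case: (free v false).
pose On := [set v | one v]; pose Z0 := [set v | ~~ free v true && ~~ free v false].
pose r y := [pick v | one v && (cl v == y)].
(* Deleted are the vertices with no copy left and, in each class, all but one of those with a single
   copy. An odd class has such a vertex, so the odd classes of the formula account for the vertices
   kept. *)
pose Z := Z0 :|: [set v in On | r (cl v) != Some v].
pose Rp := [set v in On | r (cl v) == Some v].
pose Odd := [set y | odd #|[set a in V :\: B | f a == y]|].
have rung_class v k : v \notin A -> free v k -> free v (~~ k) -> f (v, k) = f (v, ~~ k).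
  by move=> vA; rewrite !freeD => h1 h2; apply: fE => //; rewrite /eG /= eqxx vA /= ie andbF; case: (k).
have cOdd : #|Odd| <= #|Rp|.
  apply: leq_trans (leq_imset_card cl Rp); apply/subset_leq_card/subsetP => y; rewrite inE => oy.
  case E : (r y) => [v|].
    move: (E); rewrite /r; case: pickP => // v' /andP[o1 /eqP c1] [Ev]; subst v'.
    by apply/imsetP; exists v => //; rewrite !inE o1 c1 E eqxx.
  exfalso; move: E; rewrite /r; case: pickP => // none _; move: oy; apply/negP.
  apply: (even_invol (f := rung)) => -[v k]; rewrite inE => /andP[vkD /eqP fy]; rewrite -freeD in vkD.
  have fk : free v (~~ k).
    apply: NNPP => /negP nf; have ov : one v by move: vkD nf; rewrite /one; case: (k) => /= ->; [move=> /negbTE->|move=> /negbTE->].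
    by have := none v; rewrite ov /cl; have [_ h] := oneP v ov; rewrite -(h k vkD) fy eqxx.
  have vA : v \notin A.
    move: vkD fk; rewrite /free !VP => /andP[/orP[//|/eqP->] _] /andP[/orP[//|]].
    by case: (c v).
  split; [|exact: rungK|by apply/eqP => -[]; case: (k)].
  by rewrite inE /rung /= -freeD fk -(rung_class v k vA vkD fk) fy eqxx.
have cZ : #|Z| + #|Rp| <= #|Z0| + #|On|.
  apply: leq_trans (leq_add (leq_card_setU _ _).1 (leqnn _)) _; rewrite -addnA leq_add2l.
  rewrite -cardsUI (_ : _ :&: _ = set0) ?cards0 ?addn0.
    by apply/subset_leq_card/subsetP => v; rewrite !inE => /orP[]/andP[].
  by apply/setP => v; rewrite !inE; case: (r _ == _); rewrite ?andbF.
have cBA : 2 * #|Z0| + #|On| <= #|A| + #|B|.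
  rewrite (card_pairs_bool B) !card_sum_bool big_distrr -!big_split /=; apply: leq_sum => v _.
  have := VP v true; have := VP v false.
  have := subsetP BV (v, true); have := subsetP BV (v, false).
  rewrite !inE /one /free; case: ((v, true) \in B); case: ((v, false) \in B);
    case: ((v, true) \in V); case: ((v, false) \in V) => //; rewrite ?andbT ?andbF /=;
    case: (v \in A) => //=; case: (c v) => //=; by move=> h1 h2; try (have := h1 isT); try (have := h2 isT).
have cV : #|V| = 2 * #|[set: T] :\: A| + #|A|.
  rewrite card_pairs_bool !card_sum_bool big_distrr -big_split /=; apply: eq_bigr => v _.
  by rewrite !VP !inE; case: (v \in A); case: (c v).
have leZ : #|Z| <= 2 * j - 2.
  have small' : #|covered m| + 2 <= 2 * #|[set: T] :\: A| + 2 * j.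
    by move: small ev j0; move: #|covered m| => k; clear; lia.
  by move: le cOdd cZ cBA small'; rewrite -/Odd cV; clear; lia.
have fullA v : full v -> v \notin A.
  by move=> /andP[]; rewrite /free !VP; case: (v \in A) => //=; case: (c v).
have nofull v : full v -> False.
  move=> fv; have [/andP[ft ff] cf] : full v /\ f (v, true) = f (v, false).
    by split=> //; have /andP[h1 h2] := fv; apply: (rung_class v true) => //; apply: fullA.
  pose y := f (v, true).
  (* Removing the kept vertex of the class as well cuts its full vertices off from the rest of the
     graph, and this is still fewer than [2 * j] vertices. *)
  pose X := if r y is Some u then u |: Z else Z.
  have XZ : Z \subset X by rewrite /X; case: (r y) => // u; apply: subsetUr.
  have cX : #|X| < 2 * j.
    apply: leq_ltn_trans (_ : #|Z| + 1 < _); last by move: leZ j0; clear; lia.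
    by rewrite /X; case: (r y) => [u|]; rewrite ?cardsU1 ?leq_addr // addnC leq_add2l leq_b1.
  pose F := [set w | full w && (f (w, true) == y)].
  have fullX w : full w -> w \notin X.
    move=> /andP[h1 h2]; have nZ : w \notin Z by rewrite !inE /one h1 h2.
    rewrite /X; case E : (r y) => [u|//]; rewrite in_setU1 (negbTE nZ) orbF; apply/eqP => wu.
    by move: E; rewrite /r; case: pickP => // u' /andP[o1 _] [Eu]; move: o1; rewrite Eu -wu /one h1 h2.
  have clF a b : [rel a b | [&& e a b, a \notin X & b \notin X]] a b -> a \in F -> b \in F.
    rewrite /= => /and3P[eab _ bX]; rewrite !inE => /andP[fa /eqP fay].
    have bZ : b \notin Z by apply: contra bX; apply: (subsetP XZ).
    have /andP[a1 a2] := fa; have af : f (a, false) = y.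
      by rewrite -fay; apply/esym/(rung_class a true) => //; apply: fullA.
    have ak k : free a k by case: k.
    have fak k : f (a, k) = y by case: k.
    have step k : free b k -> f (b, k) = y.
      move=> bk; rewrite -(fak k); apply/esym/fE; rewrite -?freeD //; by rewrite /eG /= eqxx eab.
    case: (boolP (one b)) => ob.
      exfalso; have [h1 h2] := oneP b ob; have clb : cl b = y by apply: step.
      have rb : r (cl b) = Some b.
        by apply/eqP; move: bZ; rewrite !inE ob /= negb_or negbK => /andP[].
      by move: bX; rewrite /X -clb rb setU11.
    have fb : full b.
      move: bZ ob; rewrite !inE negb_or /one /full => /andP[+ _].
      by case: (free b true); case: (free b false).
    by have /andP[b1 _] := fb; rewrite fb (step true b1) eqxx.
  have [a aA aX] : exists2 a, a \in A & a \notin X.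
    apply: NNPP => no; have : #|A| <= #|X|; last by move: cX bigA; clear; lia.
    apply/subset_leq_card/subsetP => a aA; apply/negPn/negP => aX; apply: no; by exists a.
  have vF : v \in F by rewrite inE fv /y eqxx.
  have := closed_connect_in clF (con X cX v a (fullX v fv) aX) vF.
  by rewrite inE /full /free !VP aA /=; case: (c a); rewrite ?andbF.
exists Z; split=> //; exists kap => v w vZ wZ evw.
have oneZ u : u \notin Z -> one u /\ r (cl u) = Some u.
  move=> uZ; have ou : one u.
    move: uZ (@nofull u); rewrite !inE negb_or /one /full => /andP[+ _].
    by case: (free u true); case: (free u false) => // _ h; case: h.
  by split=> //; apply/eqP; move: uZ; rewrite !inE ou /= negb_or negbK => /andP[].
have [ov rv] := oneZ v vZ; have [ow rw] := oneZ w wZ.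
have [fv hv] := oneP v ov; have [fw hw] := oneP w ow.
apply/eqP => E; have : cl v = cl w.
  by apply: fE; rewrite -?freeD // /eG /= E eqxx evw.
by move=> Ec; move: rv; rewrite Ec rw => -[Evw]; move: evw; rewrite Evw ie.
Qed.

End Breaking.

(** * A linked bipartite subgraph *)

Lemma pad_set (T : finType) (X W : {set T}) n : X \subset W -> #|X| <= n -> n <= #|W| ->
  exists Y : {set T}, [/\ X \subset Y, Y \subset W & #|Y| = n].
Proof.
move=> XW; elim: n => [|n IH] Xn nW.
  by exists X; split=> //; apply/eqP; rewrite -leqn0.
have [E|lt] : #|X| = n.+1 \/ #|X| <= n by lia.
  by exists X.
have [Y [XY YW cY]] := IH lt (ltnW nW).
have [z zW zY] : exists2 z, z \in W & z \notin Y.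
  apply: NNPP => no; have : #|W| <= #|Y|; last by rewrite cY; move: nW; clear; lia.
  apply/subset_leq_card/subsetP => z zW; apply/negPn/negP => zY; apply: no; by exists z.
exists (z |: Y); split; [exact: subset_trans (subsetUr _ _)| |by rewrite cardsU1 zY cY].
by rewrite subUset sub1set zW.
Qed.

Lemma arcs_deg (T : finType) (e : rel T) (W : {set T}) : arcs e W W = \sum_(w in W) #|nb e W w|.
Proof.
rewrite (sum_deg e W W); apply: eq_card => -[a b]; rewrite !inE /=.
by case: (a \in W); case: (b \in W); rewrite ?andbT.
Qed.

Lemma min_degree (T : finType) (e : rel T) n v : irreflexive e -> k_connected e n -> n <= #|nb e [set: T] v|.
Proof.
move=> ie [nT con]; rewrite leqNgt; apply/negP => lt.
have [w wv wN] : exists2 w, w != v & w \notin nb e [set: T] v.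
  apply: NNPP => no; have : #|[set: T]| <= #|v |: nb e [set: T] v|.
    apply/subset_leq_card/subsetP => w _; rewrite in_setU1; apply/negPn/negP; rewrite negb_or => /andP[h1 h2].
    by apply: no; exists w.
  by rewrite cardsT cardsU1 nbP ie andbF; move: nT lt; clear; lia.
have vN : v \notin nb e [set: T] v by rewrite nbP ie andbF.
have := closed_connect_in (S := [set v]) _ (con _ lt v w vN wN).
rewrite !inE eqxx (negbTE wv) => h; have : false; last by [].
apply: h => // a b /and3P[eab _ bN]; rewrite !inE => /eqP av.
by move: bN; rewrite nbP in_setT -av eab.
Qed.

Lemma max_cut (T : finType) (e : rel T) : symmetric e -> irreflexive e ->
  exists c : T -> bool, forall v, #|nb e [set: T] v| <= 2 * #|nb [rel x y | e x y && (c x != c y)] [set: T] v|.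
Proof.
move=> se ie; pose g (c : T -> bool) x y : nat := e x y && (c x != c y).
pose F (c : {ffun T -> bool}) := \sum_x \sum_y g c x y.
have [c _ cmax] := arg_maxnP (fun c => F c) (erefl : predT ([ffun=> true] : {ffun T -> bool})).
exists c => v; pose c' : {ffun T -> bool} := [ffun x => if x == v then ~~ c v else c x].
have FE (d : {ffun T -> bool}) : F d = 2 * \sum_y g d v y + \sum_(x | x != v) \sum_(y | y != v) g d x y.
  rewrite /F (bigD1 v) //= mul2n -addnn -addnA; congr (_ + _).
  rewrite (eq_bigr (fun x => g d x v + \sum_(y | y != v) g d x y)); last first.
    by move=> x _; rewrite (bigD1 v).
  rewrite big_split /=; congr (_ + _); rewrite [RHS](bigD1 v) //= {2}/g ie add0n.
  by apply: eq_bigr => x _; rewrite /g se eq_sym.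
have E1 : \sum_(x | x != v) \sum_(y | y != v) g c' x y = \sum_(x | x != v) \sum_(y | y != v) g c x y.
  apply: eq_bigr => x /negbTE xv; apply: eq_bigr => y /negbTE yv.
  by rewrite /g !ffunE xv yv.
have E2 : \sum_y g c v y = #|nb [rel x y | e x y && (c x != c y)] [set: T] v|.
  by rewrite card_sum_bool; apply: eq_bigr => y _; rewrite !inE.
have E3 : \sum_y g c v y + \sum_y g c' v y = #|nb e [set: T] v|.
  rewrite card_sum_bool -big_split; apply: eq_bigr => y _; rewrite /g !inE /= !ffunE eqxx.
  by case: (eqVneq y v) => [->|_]; rewrite ?ie //; case: (e v y); case: (c v); case: (c y).
have := cmax c' isT; rewrite /geq /= !FE E1 leq_add2r leq_pmul2l // => le.
by rewrite -E3 -E2 mul2n -addnn leq_add2l.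
Qed.

(** In a smallest [W] with [25 * k] arcs per vertex, up to the correction [4 * k - 1], all degrees
    exceed [25 * k / 2], and there is no separation of order below [4 * k]: one of its sides would
    have as many arcs as required. Thinness is then vacuous, and the excess over [24 * k] covers the
    arcs inside [X]. *)
Lemma mader_core (T : finType) (h : rel T) (c : T -> bool) k : symmetric h -> 0 < k ->
  (forall x y, h x y -> c x != c y) -> (forall x, 25 * k <= #|nb h [set: T] x|) -> 5 * k <= #|T| ->
  exists W : {set T}, 25 * k <= #|W| /\ forall X : {set T}, X \subset W -> #|X| <= 4 * k -> linked h W X.
Proof.
move=> sh k0 hc hdeg hT; have ih : irreflexive h by move=> x; apply/negP => /hc; rewrite eqxx.
pose Q (W : {set T}) := 5 * k <= #|W| /\ 25 * k * (#|W| - (4 * k - 1)) <= arcs h W W.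
have QT : Q [set: T].
  split; first by rewrite cardsT.
  rewrite arcs_deg; apply: leq_trans (_ : \sum_(w in [set: T]) 25 * k <= _); last exact: leq_sum.
  by rewrite sum_nat_const mulnC leq_mul2r; apply/orP; right; apply: leq_subr.
have [W [[cW dW] mn]] := ex_min (fun W : {set T} => #|W|) (ex_intro _ _ QT).
have small (W' : {set T}) : #|W'| < #|W| -> 5 * k <= #|W'| -> arcs h W' W' < 25 * k * (#|W'| - (4 * k - 1)).
  by move=> lt h5; rewrite ltnNge; apply/negP => h6; have := mn W' (conj h5 h6); rewrite leqNgt lt.
have arcs_sq (X Y : {set T}) : #|[set p : T * T | [&& p.1 \in X, p.2 \in Y & h p.1 p.2]]| <= #|X| * #|Y|.
  by rewrite -cardsX; apply/subset_leq_card/subsetP => p; rewrite !inE => /and3P[-> -> _].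
(* On [5 * k] vertices the bound would ask for [25 * k * (k + 1)] arcs, more than the square of
   their number. *)
have cW1 : 5 * k < #|W|.
  rewrite ltn_neqAle cW andbT; apply/eqP => E.
  have : arcs h W W <= #|W| * #|W|.
    by apply: leq_trans (arcs_sq W W); apply/subset_leq_card/subsetP => p; rewrite !inE => /and4P[-> -> -> _].
  by move: dW k0; rewrite -E; clear; nia.
have degW w : w \in W -> 25 * k < 2 * #|nb h W w|.
  move=> wW; rewrite ltnNge; apply/negP => le.
  have c1 := cardsD1 w W; rewrite wW in c1.
  have : arcs h W W <= arcs h (W :\ w) (W :\ w) + 2 * #|nb h W w|.
    pose A1 := [set (w, y) | y in nb h W w]; pose A2 := [set (y, w) | y in nb h W w].
    apply: leq_trans (_ : #|arcset h (W :\ w) (W :\ w) :|: (A1 :|: A2)| <= _).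
      apply/subset_leq_card/subsetP => -[a b]; rewrite inE /= => /and4P[aW bW hab _]; rewrite !in_setU.
      have [E|aw] := eqVneq a w.
        by rewrite [_ \in A1](_ : _ = true) ?orbT // E; apply/imsetP; exists b; rewrite // nbP bW -E.
      have [E|bw] := eqVneq b w.
        by rewrite [_ \in A2](_ : _ = true) ?orbT // E; apply/imsetP; exists a; rewrite // nbP aW -E sh.
      by rewrite inE /= !in_setD1 aw bw aW bW hab.
    apply: leq_trans (leq_card_setU _ _).1 _; rewrite leq_add2l; apply: leq_trans (leq_card_setU _ _).1 _.
    by rewrite mul2n -addnn; apply: leq_add; apply: leq_imset_card.
  have lt : #|W :\ w| < #|W| by move: c1; clear; lia.
  have h5 : 5 * k <= #|W :\ w| by move: c1 cW1; clear; lia.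
  have := small _ lt h5; move: dW le; have E : #|W| - (4 * k - 1) = (#|W :\ w| - (4 * k - 1)).+1 by lia.
  by rewrite E mulnS; clear; lia.
(* Adjacent vertices have disjoint neighbourhoods because [h] is bipartite. *)
have W25 : 25 * k <= #|W|.
  have [w wW] : exists w, w \in W by apply/card_gt0P; lia.
  have [w' w'N] : exists w', w' \in nb h W w by apply/card_gt0P; have := degW w wW; lia.
  have := w'N; rewrite nbP => /andP[w'W hww'].
  have dis : [disjoint nb h W w & nb h W w'].
    apply/disjP => z; rewrite !nbP => /andP[_ /hc h1] /andP[_ /hc h2]; have := hc _ _ hww'.
    by move: h1 h2; case: (c w); case: (c w'); case: (c z).
  have : #|nb h W w :|: nb h W w'| <= #|W|.
    by apply/subset_leq_card/subsetP => z /setUP[]; rewrite nbP => /andP[].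
  rewrite cardsU (disjoint_setI0 dis) cards0 subn0; have := degW w wW; have := degW w' w'W; clear; lia.
have nosep W1 S z : sepn h W W1 S -> #|S| < 4 * k -> z \in W -> z \notin W1 :|: S -> W1 = set0.
  move=> [W1W SW d cl] lS zW zWS; apply/eqP; rewrite -cards_eq0; apply/eqP; have [->|[y y1]] := set_0Vmem W1; first by rewrite cards0.
  exfalso; have /disjP d' := d.
  have s1 : 5 * k <= #|W1 :|: S|.
    have : #|nb h W y| <= #|W1 :|: S|.
      by apply/subset_leq_card/subsetP => b; rewrite nbP => /andP[bW]; apply: cl.
    have := degW y (subsetP W1W y y1); clear; lia.
  have s2 : 5 * k <= #|W :\: W1|.
    have : #|nb h W z| <= #|W :\: W1|.
      apply/subset_leq_card/subsetP => b; rewrite nbP in_setD => /andP[bW hzb]; rewrite bW andbT; apply/negP => b1.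
      by move: zWS; rewrite (cl b z b1 zW) // sh.
    have := degW z zW; clear; lia.
  have cWS : #|W1 :|: S| = #|W1| + #|S| by rewrite cardsU (disjoint_setI0 d) cards0 subn0.
  have cD : #|W| = #|W1| + #|W :\: W1| by rewrite -(cardsID W1 W) (setIidPr W1W).
  have l1 : #|W1 :|: S| < #|W|.
    by apply: proper_card; apply/properP; split; [rewrite subUset W1W|exists z].
  have l2 : #|W :\: W1| < #|W|.
    have : 0 < #|W1| by apply/card_gt0P; exists y.
    by move: cD; clear; lia.
  have up : arcs h W W <= arcs h (W1 :|: S) (W1 :|: S) + arcs h (W :\: W1) (W :\: W1).
    apply: leq_trans (leq_card_setU _ _).1; apply/subset_leq_card/subsetP => -[a b].
    rewrite inE /= => /and4P[aW bW hab _]; rewrite in_setU [_ \in arcset _ _ _]inE [X in _ || X]inE /=.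
    case: (boolP (a \in W1)) => a1.
      by rewrite (cl a b a1 bW hab) in_setU a1 hab.
    case: (boolP (b \in W1)) => b1; last by rewrite !in_setD a1 b1 aW bW hab orbT.
    have aS : a \in W1 :|: S by apply: (cl b a b1 aW); rewrite sh.
    by rewrite aS in_setU b1 hab.
  have := small _ l1 s1; have := small _ l2 s2; move: up dW lS s1 s2 k0; rewrite cD cWS.
  move: #|W1| #|S| #|W :\: W1| (arcs _ (W1 :|: S) _) (arcs _ (W :\: W1) _) (arcs _ W _) => a s b x y' z' *.
  (* The vertices of [S] count on both sides; as there are at most [4 * k - 1] of them, the
     correction term makes up for it. *)
  have E1 : 25 * k * (a + b - (4 * k - 1)) >= 25 * k * (a + s - (4 * k - 1)) + 25 * k * (b - (4 * k - 1)).
    by rewrite -mulnDr leq_mul2l; apply/orP; right; lia.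
  lia.
exists W; split=> // X0 X0W cX0.
have [X [X0X XW cX]] := pad_set X0W cX0 ltac:(by move: W25; clear; lia).
apply: (linked_sub X0X); apply: (massed_linked (K := 2 * k)) => //; [by lia|by rewrite cX; lia|].
have -> : 12 * (2 * k) = 24 * k by lia.
have cD : #|W| = #|X| + #|W :\: X| by rewrite -(cardsID X W) (setIidPr XW).
split=> //.
  have up : arcs h W W <= arcs h W (W :\: X) + #|X| * #|X|.
    apply: leq_trans (_ : #|arcset h W (W :\: X) :|: [set p : T * T | [&& p.1 \in X, p.2 \in X & h p.1 p.2]]| <= _).
      apply/subset_leq_card/subsetP => -[a b]; rewrite !inE /= => /and4P[-> -> -> _] /=; rewrite !andbT.
      by case: (a \in X); case: (b \in X).
    by apply: leq_trans (leq_card_setU _ _).1 _; rewrite leq_add2l; apply: arcs_sq.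
  by move: up dW W25 k0 cD; rewrite cX; clear; nia.
move=> W1 S sp dX lt.
have [z zX zS] : exists2 z, z \in X & z \notin S.
  apply: NNPP => no; have : #|X| <= #|S|; last by rewrite leqNgt lt.
  apply/subset_leq_card/subsetP => z zX; apply/negPn/negP => zS; apply: no; by exists z.
rewrite (nosep W1 S z sp) ?arcs0 //; first by rewrite -cX.
  exact: (subsetP XW).
by rewrite in_setU (negbTE zS) orbF; apply/negP; have /disjP := dX; apply.
Qed.

(** * Correcting parities *)

Lemma path_length_join (T : finType) (e : rel T) p q a b d :
  is_path e p a b -> is_path e q b d -> path_length (p ++ behead q) = path_length p + path_length q.
Proof. by move=> [p' [-> _ _ _]] [q' [-> _ _ _]]; rewrite /path_length /= size_cat. Qed.

Lemma path_length_rev (T : Type) (p : seq T) : path_length (rev p) = path_length p.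
Proof. by rewrite /path_length size_rev. Qed.

Lemma bipartite_parity (T : finType) (h : rel T) (c : T -> bool) p a b :
  (forall x y, h x y -> c x != c y) -> is_path h p a b -> odd (path_length p) = c a (+) c b.
Proof.
move=> hc [q [-> pq <- _]]; rewrite /path_length /=; elim: q a pq => [|x q IH] a /=.
  by rewrite addbb.
by move=> /andP[/hc hax /IH ->]; move: hax; case: (c a); case: (c x); case: (c _).
Qed.

(** Joining [l i] to [r i] inside [h] gives a parity that the colours determine. When it is wrong,
    the route goes from [l i] to [a i], along [Q i], and from [b i] to [r i]; this changes the
    parity since [Q i] has the one that [h] cannot realise between its ends. *)
Lemma assemble (T : finType) (e h : rel T) (c : T -> bool) (W : {set T}) (k : nat)
    (s t : 'I_k -> T) (p : 'I_k -> bool) (L R Q : 'I_k -> seq T) (l r a b : 'I_k -> T)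
    (flex : 'I_k -> bool) :
  symmetric e -> subrel h e -> (forall x y, h x y -> c x != c y) ->
  (forall X : {set T}, X \subset W -> #|X| <= 4 * k -> linked h W X) ->
  (forall i, is_path e (L i) (s i) (l i)) -> (forall i, is_path e (R i) (t i) (r i)) ->
  (forall i, ~~ flex i -> [/\ is_path e (Q i) (a i) (b i), a i != b i,
     odd (path_length (Q i)) = (c (a i) == c (b i)) &
     forall z, z \in Q i -> z \notin L i /\ z \notin R i]) ->
  (forall i, flex i ->
     odd (path_length (L i) + path_length (R i)) (+) (c (l i) (+) c (r i)) = p i) ->
  (forall i j z, z \in L i ++ R i ++ Q i -> z \in L j ++ R j ++ Q j -> i = j) ->
  (forall i z, z \in L i -> z \in R i -> False) ->
  (forall i, [/\ l i \in W, r i \in W, a i \in W & b i \in W]) ->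
  (forall i z, z \in L i ++ R i ++ Q i -> z \in W -> z \in [:: l i; r i; a i; b i]) ->
  exists P : 'I_k -> seq T,
    (forall i, is_path e (P i) (s i) (t i) /\ odd (path_length (P i)) = p i) /\
    (forall i j, i != j -> [disjoint P i & P j]).
Proof.
move=> se he hc lk pL pR pQ pF dF dLR inW FW.
pose F i := L i ++ R i ++ Q i.
pose mis i := odd (path_length (L i) + path_length (R i)) (+) (c (l i) (+) c (r i)) != p i.
have misflex i : mis i -> ~~ flex i by apply: contra => /pF E; apply/eqP.
pose X := [set l i | i : 'I_k] :|: [set r i | i : 'I_k] :|: [set a i | i : 'I_k] :|: [set b i | i : 'I_k].
have inX i z : z \in [:: l i; r i; a i; b i] -> z \in X.
  by rewrite !inE -!orbA => /or4P[]/eqP->; rewrite imset_f ?orbT.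
have XW : X \subset W.
  by apply/subsetP => z; rewrite !inE -!orbA => /or4P[]/imsetP[i _ ->]; case: (inW i).
have cX : #|X| <= 4 * k.
  have im (f : 'I_k -> T) : #|[set f i | i : 'I_k]| <= k by rewrite -[X in _ <= X]card_ord; apply: leq_imset_card.
  have U (A B : {set T}) n m : #|A| <= n -> #|B| <= m -> #|A :|: B| <= n + m.
    by move=> h1 h2; apply: leq_trans (leq_card_setU _ _).1 (leq_add h1 h2).
  have -> : 4 * k = k + k + k + k by lia.
  exact: (U _ _ _ _ (U _ _ _ _ (U _ _ _ _ (im l) (im r)) (im a)) (im b)).
have lF i : l i \in F i by rewrite mem_cat; case: (is_path_mem (pL i)) => _ ->.
have rF i : r i \in F i by rewrite !mem_cat; case: (is_path_mem (pR i)) => _ ->; rewrite orbT.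
have abF i : ~~ flex i -> a i \in F i /\ b i \in F i.
  by move=> /pQ[/is_path_mem[h1 h2] _ _ _]; rewrite !mem_cat h1 h2 !orbT.
(* The demand [(i, false)] starts at [l i] and [(i, true)] at [b i]. Their other ends are [r i] and
   [a i], exchanged when the parity of [i] has to be changed. *)
pose J := {x : 'I_k * bool | ~~ x.2 || ~~ flex x.1}.
pose S' (j : J) := if (val j).2 then b (val j).1 else l (val j).1.
pose T' (j : J) := if (val j).2 (+) mis (val j).1 then (if (val j).2 then a (val j).1 else a (val j).1) else r (val j).1.
have nf (j : J) : (val j).2 -> ~~ flex (val j).1 by case: j => -[i []].
have S'F j : S' j \in F (val j).1.
  by rewrite /S'; case: ifP => [/nf/abF[]|_].
have T'F j : T' j \in F (val j).1.
  rewrite /T' if_same; case: ifP => // hx.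
  have : ~~ flex (val j).1; last by case/abF.
  by move: hx; case: (boolP (val j).2) => [/nf//|_ /= /misflex].
have S'X j : S' j \in X by rewrite /S'; case: ifP => _; apply: (inX (val j).1); rewrite !inE eqxx ?orbT.
have T'X j : T' j \in X by rewrite /T' if_same; case: ifP => _; apply: (inX (val j).1); rewrite !inE eqxx ?orbT.
have lr i : l i != r i.
  by apply/eqP => E; apply: (dLR i (l i)); [case: (is_path_mem (pL i))|rewrite E; case: (is_path_mem (pR i))].
have abn i : ~~ flex i -> [/\ a i != b i, a i != l i, a i != r i, b i != l i & b i != r i].
  move=> /pQ[/is_path_mem[h1 h2] ab _ dQ]; have [k1 k2] := dQ _ h1; have [k3 k4] := dQ _ h2.
  have [_ k5] := is_path_mem (pL i); have [_ k6] := is_path_mem (pR i).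
  by split=> //; [apply: contraNneq k1 => ->|apply: contraNneq k2 => ->|apply: contraNneq k3 => ->|apply: contraNneq k4 => ->].
have jE (i j : J) : (val i).1 = (val j).1 -> (val i).2 = (val j).2 -> i = j.
  by move=> h1 h2; apply: val_inj; case: (val i) (val j) h1 h2 => ? ? [? ?] /= -> ->.
have prX : pairing X S' T'.
  split; last by [].
  - move=> i j E; have Eij : (val i).1 = (val j).1 by apply: dF (S'F i) _; rewrite E; apply: S'F.
    apply: jE => //; move: E (nf i) (nf j); rewrite /S' Eij.
    case: (val i).2; case: (val j).2 => // E h1 h2.
      by have [_ _ _ + _] := abn _ (h1 isT); rewrite E eqxx.
    by have [_ _ _ + _] := abn _ (h2 isT); rewrite E eqxx.
  - move=> i j E; have Eij : (val i).1 = (val j).1 by apply: dF (T'F i) _; rewrite E; apply: T'F.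
    apply: jE => //; move: E (nf i) (nf j); rewrite /T' !if_same Eij.
    case: (val i).2; case: (val j).2 => //= E h1 h2.
      have [_ _ + _ _] := abn _ (h1 isT); move: E; case: (mis _) => /= ->; rewrite eqxx //.
    have [_ _ + _ _] := abn _ (h2 isT); move: E; case: (mis _) => /= ->; rewrite eqxx //.
  - move=> i j; apply/eqP => E; have Eij : (val i).1 = (val j).1 by apply: dF (S'F i) _; rewrite E; apply: T'F.
    move: E (nf i) (nf j) (@misflex (val j).1) (lr (val j).1); rewrite /T' /S' !if_same Eij.
    case: (val i).2; case: (val j).2; case: (mis _) => /= E h1 h2 h3 h4;
      first [by rewrite E eqxx in h4 | have := abn _ (h1 isT) | have := abn _ (h2 isT) | have := abn _ (h3 isT)];
      by case; rewrite E ?eqxx.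
have [C [CW CX con dis]] := lk X XW cX J S' T' prX.
have CF j i z : z \in C j -> z \in F i -> z \in [set S' j; T' j].
  by move=> zC zF; rewrite -CX in_setI zC (inX i) // FW // (subsetP (CW j)).
have CFi j i z : z \in C j -> z \in F i -> (val j).1 = i.
  by move=> zC zF; case/set2P: (CF j i z zC zF) => E; apply: dF zF; rewrite E.
have exH (j : J) : exists q, is_path h q (S' j) (T' j) /\ {subset q <= C j}.
  by have [_ _ st _] := prX; have [q pq sq] := connect_rstr (con j) (st j j); exists q.
have [H hH] := fin_all_exists exH.
have hHe j : is_path e (H j) (S' j) (T' j) by apply: is_path_sub (hH j).1 => x y _ _ /he.
pose j1 i : J := exist _ (i, false) isT.
have key i : exists P, [/\ is_path e P (s i) (t i), odd (path_length P) = p i &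
    forall z, z \in P -> z \in F i \/ exists j, (val j).1 = i /\ z \in C j].
  have pRr := is_path_rev se (pR i); have [_ HC1] := hH (j1 i).
  have inC z : z \in H (j1 i) -> exists j, (val j).1 = i /\ z \in C j by move=> /HC1; exists (j1 i).
  have LF z : z \in L i -> z \in F i by move=> zL; rewrite mem_cat zL.
  have RF z : z \in R i -> z \in F i by move=> zR; rewrite !mem_cat zR !orbT.
  have QF z : z \in Q i -> z \in F i by move=> zQ; rewrite !mem_cat zQ !orbT.
  case: (boolP (mis i)) => mi.
    have nfi := misflex i mi; have [pQi ab oQ dQ] := pQ i nfi.
    pose j2 : J := exist _ (i, true) nfi.
    have Es1 : S' (j1 i) = l i by []. have Et1 : T' (j1 i) = a i by rewrite /T' /= mi.
    have Es2 : S' j2 = b i by []. have Et2 : T' j2 = r i by rewrite /T' /= mi.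
    have h1 := hHe (j1 i); have h2 := hHe j2; have [_ HC2] := hH j2.
    have b1 := bipartite_parity hc (hH (j1 i)).1; have b2 := bipartite_parity hc (hH j2).1.
    rewrite Es1 Et1 in h1 b1; rewrite Es2 Et2 in h2 b2.
    have [aQ bQ] := is_path_mem pQi.
    have P1 : is_path e (L i ++ behead (H (j1 i))) (s i) (a i).
      apply: is_path_join (pL i) h1 _ => z zL zH; have := CF _ i z (HC1 z zH) (LF z zL).
      by rewrite Es1 Et1 => /set2P[//|E]; have [] := dQ _ aQ; rewrite -E zL.
    have m1 z := mem_join (p1 := L i) z h1 (is_path_mem (pL i)).2.
    have P2 : is_path e ((L i ++ behead (H (j1 i))) ++ behead (Q i)) (s i) (b i).
      apply: is_path_join P1 pQi _ => z; rewrite m1 => /orP[zL|zH] zQ; first by have [] := dQ z zQ; rewrite zL.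
      have := CF _ i z (HC1 z zH) (QF z zQ); rewrite Es1 Et1 => /set2P[E|//].
      by have [] := dQ z zQ; rewrite E (is_path_mem (pL i)).2.
    have m2 z := mem_join (p1 := L i ++ behead (H (j1 i))) z pQi (is_path_mem P1).2.
    have P3 : is_path e (((L i ++ behead (H (j1 i))) ++ behead (Q i)) ++ behead (H j2)) (s i) (r i).
      apply: is_path_join P2 h2 _ => z; rewrite m2 m1 => /orP[/orP[zL|zH]|zQ] zH2.
      - have := CF _ i z (HC2 z zH2) (LF z zL); rewrite Es2 Et2 => /set2P[//|E].
        by case: (dLR i z) => //; rewrite E (is_path_mem (pR i)).2.
      - have ne : j1 i != j2 by rewrite -val_eqE /= xpair_eqE andbF.
        by have /disjP := dis _ _ ne => /(_ z (HC1 z zH) (HC2 z zH2)).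
      - have := CF _ i z (HC2 z zH2) (QF z zQ); rewrite Es2 Et2 => /set2P[//|E].
        by have [_] := dQ z zQ; rewrite E (is_path_mem (pR i)).2.
    have m3 z := mem_join (p1 := (L i ++ behead (H (j1 i))) ++ behead (Q i)) z h2 (is_path_mem P2).2.
    have P4 : is_path e ((((L i ++ behead (H (j1 i))) ++ behead (Q i)) ++ behead (H j2)) ++ behead (rev (R i))) (s i) (t i).
      apply: is_path_join P3 pRr _ => z; rewrite m3 m2 m1 mem_rev => /orP[/orP[/orP[zL|zH]|zQ]|zH2] zR.
      - by case: (dLR i z).
      - have := CF _ i z (HC1 z zH) (RF z zR); rewrite Es1 Et1 => /set2P[]E.
          by case: (dLR i z) => //; rewrite E (is_path_mem (pL i)).2.
        by have [_] := dQ _ aQ; rewrite -E zR.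
      - by have [_] := dQ z zQ; rewrite zR.
      - have := CF _ i z (HC2 z zH2) (RF z zR); rewrite Es2 Et2 => /set2P[E|//].
        by have [_] := dQ _ bQ; rewrite -E zR.
    eexists; split; first exact: P4.
      rewrite (path_length_join P3 pRr) (path_length_join P2 h2) (path_length_join P1 pQi) (path_length_join (pL i) h1).
      rewrite path_length_rev !oddD b1 b2 oQ; move: mi; rewrite /mis oddD.
      by case: (odd _); case: (odd _); case: (c (l i)); case: (c (r i)); case: (c (a i)); case: (c (b i)); case: (p i).
    move=> z; rewrite (mem_join _ pRr (is_path_mem P3).2) m3 m2 m1 mem_rev.
    move=> /orP[/orP[/orP[/orP[/LF|/inC]|/QF]|/HC2]|/RF]; auto.
    by right; exists j2.
  have Es1 : S' (j1 i) = l i by []. have Et1 : T' (j1 i) = r i by rewrite /T' /= (negbTE mi).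
  have h1 := hHe (j1 i); have b1 := bipartite_parity hc (hH (j1 i)).1; rewrite Es1 Et1 in h1 b1.
  have P1 : is_path e (L i ++ behead (H (j1 i))) (s i) (r i).
    apply: is_path_join (pL i) h1 _ => z zL zH; have := CF _ i z (HC1 z zH) (LF z zL).
    by rewrite Es1 Et1 => /set2P[//|E]; case: (dLR i z) => //; rewrite E (is_path_mem (pR i)).2.
  have m1 z := mem_join (p1 := L i) z h1 (is_path_mem (pL i)).2.
  have P4 : is_path e ((L i ++ behead (H (j1 i))) ++ behead (rev (R i))) (s i) (t i).
    apply: is_path_join P1 pRr _ => z; rewrite m1 mem_rev => /orP[zL|zH] zR; first by case: (dLR i z).
    have := CF _ i z (HC1 z zH) (RF z zR); rewrite Es1 Et1 => /set2P[E|//].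
    by case: (dLR i z) => //; rewrite E (is_path_mem (pL i)).2.
  eexists; split; first exact: P4.
    rewrite (path_length_join P1 pRr) (path_length_join (pL i) h1) path_length_rev !oddD b1.
    move: mi; rewrite /mis negbK oddD => /eqP <-.
    by case: (odd _); case: (odd _); case: (c (l i)); case: (c (r i)).
  move=> z; rewrite (mem_join _ pRr (is_path_mem P1).2) m1 mem_rev.
  by move=> /orP[/orP[/LF|/inC]|/RF]; auto.
have [P hP] := fin_all_exists key.
exists P; split=> [i|i j ij]; first by case: (hP i).
rewrite disjoint_has; apply/hasPn => z zi /=; apply/negP => zj.
have [_ _ /(_ z zi) ki] := hP i; have [_ _ /(_ z zj) kj] := hP j.
case/eqP: ij; case: ki => [zF|[x [<- zC]]]; case: kj => [zF'|[y [<- zC']]].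
- exact: dF zF zF'.
- by rewrite (CFi y i z zC' zF).
- exact: CFi zC zF'.
- have [->//|ne] := eqVneq x y; by have /disjP := dis _ _ ne => /(_ z zC zC').
Qed.

(* [Q] is inserted between [L] and [R] when they would give the wrong parity; [flex] says that
   they do not. *)
Definition plan (T : finType) (e : rel T) (c : T -> bool) (W F : {set T}) (s t : T) (p : bool)
    (L R Q : seq T) (l r a b : T) (flex : bool) :=
  [/\ [/\ is_path e L s l, is_path e R t r & {subset L ++ R ++ Q <= F}],
      ~~ flex -> [/\ is_path e Q a b, a != b, odd (path_length Q) = (c a == c b) &
        forall z, z \in Q -> z \notin L /\ z \notin R],
      flex -> odd (path_length L + path_length R) (+) (c l (+) c r) = p,
      (forall z, z \in L -> z \in R -> False) /\ [/\ l \in W, r \in W, a \in W & b \in W] &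
      forall z, z \in L ++ R ++ Q -> z \in W -> z \in [:: l; r; a; b]].

Lemma assemble_plans (T : finType) (e h : rel T) (c : T -> bool) (W : {set T}) (k : nat)
    (s t : 'I_k -> T) (p : 'I_k -> bool) (F : 'I_k -> {set T}) :
  symmetric e -> subrel h e -> (forall x y, h x y -> c x != c y) ->
  (forall X : {set T}, X \subset W -> #|X| <= 4 * k -> linked h W X) ->
  (forall i j z, z \in F i -> z \in F j -> i = j) ->
  (forall i, exists L R Q l r a b flex, plan e c W (F i) (s i) (t i) (p i) L R Q l r a b flex) ->
  exists P : 'I_k -> seq T,
    (forall i, is_path e (P i) (s i) (t i) /\ odd (path_length (P i)) = p i) /\
    (forall i j, i != j -> [disjoint P i & P j]).
Proof.
move=> se he hc lk dF /fin_all_exists[L] /fin_all_exists[R] /fin_all_exists[Q] /fin_all_exists[l].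
move=> /fin_all_exists[r] /fin_all_exists[a] /fin_all_exists[b] /fin_all_exists[fl] H.
apply: (assemble (L := L) (R := R) (Q := Q) (l := l) (r := r) (a := a) (b := b) (flex := fl) se he hc lk).
- by move=> i; case: (H i) => -[].
- by move=> i; case: (H i) => -[].
- by move=> i; case: (H i).
- by move=> i; case: (H i).
- move=> i j z zi zj; have [[_ _ Fi] _ _ _ _] := H i; have [[_ _ Fj] _ _ _ _] := H j.
  exact: dF (Fi z zi) (Fj z zj).
- by move=> i; case: (H i) => _ _ _ [].
- by move=> i; case: (H i) => _ _ _ [].
- by move=> i; case: (H i).
Qed.

(** * Many breaking paths *)

Definition cost (T : Type) (g : rel T) (p : seq T) :=
  if p is a :: q then sumn (pairmap (fun x y => nat_of_bool (~~ g x y)) a q) else 0.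

Lemma cost_join (T : finType) (e g : rel T) p q a v b :
  is_path e p a v -> is_path e q v b -> cost g (p ++ behead q) = cost g p + cost g q.
Proof. by move=> [p' [-> _ <- _]] [q' [-> _ _ _]] /=; rewrite pairmap_cat sumn_cat. Qed.

Lemma cost0 (T : finType) (g : rel T) p a b : is_path g p a b -> cost g p = 0.
Proof.
by case=> q [-> pq _ _] /=; elim: q a pq => //= x q IH a /andP[-> /IH ->].
Qed.

Lemma cost0_path (T : finType) (e g : rel T) p a b : is_path e p a b -> cost g p = 0 -> is_path g p a b.
Proof.
case=> q [-> _ lq uq] /= E; exists q; split=> //; move: E; clear; elim: q a => //= x q IH a.
by case: (g a x) => //= /IH.
Qed.

Lemma split_path (T : finType) (e g : rel T) q q1 q2 a v b :
  is_path g q a b -> is_path e q1 a v -> is_path e q2 v b -> q = q1 ++ behead q2 ->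
  is_path g q1 a v /\ is_path g q2 v b.
Proof.
move=> [o [-> po _ uo]] [u1 [-> _ l1 k1]] [u2 [-> _ l2 k2]] [E]; subst o.
by move: po; rewrite cat_path l1 => /andP[h1 h2]; split; [exists u1|exists u2].
Qed.

(** In [g] every vertex of [q] separates the earlier ones from the later ones, so a path inside [q]
    cannot skip a vertex between [v] and [b]. *)
Lemma cut_cover (T : finType) (g : rel T) q a b p v :
  is_path g p v b -> {subset p <= q} -> is_path g q a b ->
  (forall p1 z p2, q = p1 ++ z :: p2 -> forall x y, x \in p1 -> y \in p2 -> ~~ g x y) ->
  forall q1 q2, is_path g q1 a v -> is_path g q2 v b -> q = q1 ++ behead q2 -> {subset q2 <= p}.
Proof.
move=> [p' [Ep pp lp _]] pq [q' [Eq _ lq uq]] cut q1 q2 [u1 [E1 _ l1 _]] [u2 [E2 _ l2 _]] E z.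
subst p q1 q2; rewrite /= in E; rewrite inE => /predU1P[->|zu]; first exact: mem_head.
apply: contraT => zp.
have [w1 [w2 Eu]] : exists w1 w2, u2 = w1 ++ z :: w2 by case/splitPr: zu => w1 w2; exists w1, w2.
rewrite Eq in uq.
have Es : q = ((a :: u1) ++ w1) ++ z :: w2 by rewrite E Eu -catA.
have inv : forall r x, path g x r -> x \in (a :: u1) ++ w1 -> {subset r <= q} -> z \notin r -> last x r \in (a :: u1) ++ w1.
  elim=> [//|y r IH] x /= /andP[gxy pr] xin sub; rewrite inE negb_or => /andP[zy zr].
  apply: IH => //; last by move=> o or; apply: sub; rewrite inE or orbT.
  have : y \in q by apply: sub; rewrite mem_head.
  rewrite Es mem_cat inE eq_sym (negbTE zy) /= => /orP[//|yw].
  by have := cut _ _ _ Es x y xin yw; rewrite gxy.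
move: zp; rewrite inE negb_or => /andP[zv zp].
have vin : v \in (a :: u1) ++ w1 by rewrite mem_cat -l1 mem_last.
have sub : {subset p' <= q} by move=> o oo; apply: pq; rewrite inE oo orbT.
have := inv _ _ pp vin sub zp; rewrite lp => bin.
have bz : b \in z :: w2 by move: l2; rewrite Eu last_cat /= => <-; apply: mem_last.
have : uniq q by rewrite Eq.
by rewrite Es cat_uniq => /and3P[_ /hasPn/(_ _ bz)]; rewrite /= bin.
Qed.

Section Rerouting.
Variables (T I : finType) (e g : rel T) (W : {set T}) (sv : I -> T).
Hypotheses (se : symmetric e) (sg : symmetric g).

Definition goodfam (P : I -> seq T) :=
  (forall x, exists w, [/\ is_path e (P x) (sv x) w, w \in W & forall z, z \in P x -> z \in W -> z = w])
  /\ (forall x y z, z \in P x -> z \in P y -> x = y).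

(* Leaving [P x] at its first common vertex with [q] and following [q] backwards to [a] costs
   nothing, so by minimality [P x] already follows [q] from there on. *)
Lemma first_hit P q a b :
  goodfam P -> (forall P', goodfam P' -> \sum_x cost g (P x) <= \sum_x cost g (P' x)) ->
  is_path e q a b -> is_path g q a b -> a \in W -> b \in W -> a != b ->
  (forall z, z \in q -> z \in W -> z = a \/ z = b) ->
  (forall x y, x \in q -> g x y -> y \in q) ->
  (forall p1 z p2, q = p1 ++ z :: p2 -> forall x y, x \in p1 -> y \in p2 -> ~~ g x y) ->
  (exists x z, z \in q /\ z \in P x) ->
  (exists x, a \in P x) \/ exists x, b \in P x /\ forall y z, z \in q -> z \in P y -> y = x.
Proof.
move=> gP minP pq gq aW bW ab qW clo cut [x0 [z0 [z0q z0P]]]; have [P1 P2] := gP.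
pose A := [pred z | [exists x, z \in P x]].
have hA : has A q by apply/hasP; exists z0 => //; apply/existsP; exists x0.
have [v [q1 [q2 [pq1 pq2 Eq /existsP[x vx] fst]]]] := is_path_first pq hA.
have [gq1 gq2] := split_path gq pq1 pq2 Eq.
have inq z : (z \in q) = (z \in q1) || (z \in q2) by rewrite Eq (mem_join z pq2) // (is_path_mem pq1).2.
have [aq1 vq1] := is_path_mem pq1; have [vq2 bq2] := is_path_mem pq2.
have q12 z : z \in q1 -> z \in q2 -> z = v.
  have := is_path_uniq pq; have [u2 [E2 _ _ _]] := pq2; rewrite Eq E2 /= cat_uniq => /and3P[_ /hasPn h _] z1.
  by rewrite inE => /predU1P[//|/h]; rewrite /= z1.
case: (eqVneq v a) => [Ev|va]; first by left; exists x; rewrite -Ev.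
case: (eqVneq v b) => [Ev|vb].
  right; exists x; split; first by rewrite -Ev.
  move=> y z; rewrite inq => /orP[z1 zy|z2 zy].
    have Ez : z = v by apply: fst z1 _; apply/existsP; exists y.
    by apply: P2 zy _; rewrite Ez.
  have Ez : z = v by move: pq2 z2; rewrite Ev => /is_path_loop ->; rewrite inE => /eqP.
  by apply: P2 zy _; rewrite Ez.
have vW : v \notin W by apply/negP => vW; case: (qW v) => //; [rewrite inq vq1|move/eqP; rewrite (negbTE va)|move/eqP; rewrite (negbTE vb)].
have [w [px wW xW]] := P1 x.
have [p1 [p2 [pp1 pp2 Ep p12]]] := is_path_split px vx.
have inP z : (z \in P x) = (z \in p1) || (z \in p2) by rewrite Ep (mem_join z pp2) // (is_path_mem pp1).2.
have prv := is_path_rev se pq1.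
have pnew : is_path e (p1 ++ behead (rev q1)) (sv x) a.
  apply: is_path_join pp1 prv _ => z zp; rewrite mem_rev => zq; apply: fst zq _.
  by apply/existsP; exists x; rewrite inP zp.
have innew z : (z \in p1 ++ behead (rev q1)) = (z \in p1) || (z \in q1).
  by rewrite (mem_join z prv) ?mem_rev // (is_path_mem pp1).2.
pose P' y := if y == x then p1 ++ behead (rev q1) else P y.
have gP' : goodfam P'.
  split=> [y|].
    rewrite /P'; case: eqP => [->|_]; last exact: P1.
    exists a; split=> // z; rewrite innew => /orP[zp zW|zq zW].
      have Ez : z = w by apply: xW zW; rewrite inP zp.
      have Ev : z = v by apply: p12 zp _; rewrite Ez; case: (is_path_mem pp2).
      by rewrite -Ev zW in vW.
    case: (qW z) => // [|Ez]; first by rewrite inq zq.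
    have Ev : z = v by apply: q12 zq _; rewrite Ez.
    by rewrite -Ev zW in vW.
  have kk y z : y != x -> z \in p1 ++ behead (rev q1) -> z \in P y -> False.
    move=> yx; rewrite innew => /orP[zp zy|zq zy].
      by case/eqP: yx; apply: P2 zy _; rewrite inP zp.
    have Ez : z = v by apply: fst zq _; apply/existsP; exists y.
    by case/eqP: yx; apply: P2 zy _; rewrite Ez.
  move=> y y' z; rewrite /P'; case: (eqVneq y x) => [->|yx]; case: (eqVneq y' x) => [->|yx'] //.
  - by move=> h1 h2; case: (kk _ _ yx' h1 h2).
  - by move=> h1 h2; case: (kk _ _ yx h2 h1).
  - exact: P2.
have c2 : cost g p2 = 0.
  have := minP _ gP'; rewrite (bigD1 x) //= [X in _ <= X](bigD1 x) //=.
  rewrite [X in _ <= _ + X](eq_bigr (fun y => cost g (P y))); last by move=> y yx; rewrite /P' (negbTE yx).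
  rewrite leq_add2r /P' eqxx Ep (cost_join _ pp1 pp2) (cost_join _ pp1 prv).
  by rewrite (cost0 (is_path_rev sg gq1)); clear; lia.
have g2 := cost0_path pp2 c2.
have p2q : {subset p2 <= q}.
  case: g2 => u [-> pu _ _]; have : v \in q by rewrite inq vq1.
  elim: u (v) pu => [|y u IH] o /=; first by move=> _ oq z; rewrite inE => /eqP->.
  by move=> /andP[goy pu] oq z; rewrite inE => /predU1P[->//|]; apply: IH => //; apply: clo goy.
have [_ wp2] := is_path_mem pp2.
case: (qW w (p2q _ wp2) wW) => Ew.
  by case/eqP: va; rewrite (fst a aq1) //; apply/existsP; exists x; rewrite -Ew inP wp2 orbT.
subst w; right; exists x; split; first by rewrite inP wp2 orbT.
have cov := cut_cover g2 p2q gq cut gq1 gq2 Eq.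
move=> y z; rewrite inq => /orP[z1 zy|z2 zy].
  have Ez : z = v by apply: fst z1 _; apply/existsP; exists y.
  by apply: P2 zy _; rewrite Ez.
by apply: P2 zy _; rewrite inP cov ?orbT.
Qed.

End Rerouting.

(** Fewer than [2 * k] vertices miss a terminal and a vertex of [W], and by connectivity do not
    separate them. *)
Lemma terminal_family (T : finType) (e : rel T) (W : {set T}) (k : nat) (s t : 'I_k -> T) :
  injective s -> injective t -> (forall i j, s i != t j) ->
  (forall X : {set T}, #|X| < 2 * k -> connected_minus e X) -> 2 * k <= #|W| ->
  exists P, goodfam e W (fun x : 'I_k * bool => if x.2 then t x.1 else s x.1) P.
Proof.
move=> is_ it st con cW; pose sv (x : 'I_k * bool) := if x.2 then t x.1 else s x.1.
have isv : injective sv.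
  move=> [i a] [j b]; rewrite /sv /=; case: a; case: b => E.
  - by rewrite (it _ _ E).
  - by have := st j i; rewrite E eqxx.
  - by have := st i j; rewrite E eqxx.
  - by rewrite (is_ _ _ E).
pose S := [set sv x | x : 'I_k * bool].
have cS : #|S| = 2 * k by rewrite card_imset // card_prod card_ord card_bool mulnC.
have pick (A X : {set T}) : #|X| < 2 * k -> 2 * k <= #|A| -> exists2 z, z \in A & z \notin X.
  move=> cX cA; case: (set_0Vmem (A :\: X)) => [E|[z]]; last by rewrite inE => /andP[]; exists z.
  have/subset_leq_card le : A \subset X by rewrite -setD_eq0 E.
  by move: le cX cA; clear; lia.
have [X sep|P [P1 P2]] := @menger T e S W (2 * k).
  rewrite leqNgt; apply/negP => ltX; have [x xS xX] := pick S X ltX ltac:(by rewrite cS).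
  have [w wW wX] := pick W X ltX cW.
  case: (eqVneq x w) => [E|xw].
    have [z] := sep _ _ _ (is_path1 e x) xS ltac:(by rewrite E).
    by rewrite inE => /eqP->; rewrite (negbTE xX).
  have cc : connect (rstr e (~: X)) x w.
    by apply: connect_sub (con X ltX x w xX wX) => a b ab; apply: connect1; rewrite /rstr /= !in_setC.
  have [q pq sq] := connect_rstr cc xw; have [z zq zX] := sep _ _ _ pq xS wW.
  by have := sq z zq; rewrite inE zX.
have Ps i : exists x, exists w, [/\ is_path e (P i) (sv x) w, w \in W & forall z, z \in P i -> z \in W -> z = w].
  by have [a [b [h1 /imsetP[x _ E] h3 _ h5]]] := P1 i; exists x, b; rewrite -E.
have [f hf] := fin_all_exists Ps.
have fi : injective f.
  move=> i j E; have [w [/is_path_mem[h1 _] _ _]] := hf i; have [w' [/is_path_mem[h2 _] _ _]] := hf j.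
  by rewrite E in h1; apply: P2 h1 h2.
have fo x : exists i, x = f i.
  apply: (@injK_onto _ _ f setT fi) => //; last by rewrite cardsT card_prod !card_ord card_bool; lia.
have [g hg] := fin_all_exists fo.
exists (fun x => P (g x)); split=> [x|x y z h1 h2].
  by have := hf (g x); rewrite -hg.
by rewrite (hg x) (hg y) (P2 _ _ _ h1 h2).
Qed.

(** From its first vertex on [q] the path can turn to either end of [q]. Relative to the colour of
    the end reached the two parities differ, because [q] is breaking. *)
Lemma two_routes (T : finType) (e : rel T) (c : T -> bool) p q s w a b par : symmetric e ->
  is_path e p s w -> is_path e q a b -> odd (path_length q) = (c a == c b) -> has [in q] p ->
  exists r v, [/\ is_path e r s v, v = a \/ v = b, odd (path_length r) (+) c v = par &
    forall z, z \in r -> z \in p \/ z \in q].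
Proof.
move=> se pp pq oq hq; have [y [p1 [p2 [pp1 pp2 Ep yq fst]]]] := is_path_first pp hq.
have [q1 [q2 [pq1 pq2 Eq q12]]] := is_path_split pq yq.
have inp z : z \in p1 -> z \in p by rewrite Ep mem_cat => ->.
have inq z : (z \in q) = (z \in q1) || (z \in q2) by rewrite Eq (mem_join z pq2) // (is_path_mem pq1).2.
have pr1 := is_path_rev se pq1.
have rA : is_path e (p1 ++ behead (rev q1)) s a.
  by apply: is_path_join pp1 pr1 _ => z zp; rewrite mem_rev => zq; apply: fst zp _; rewrite /= inq zq.
have rB : is_path e (p1 ++ behead q2) s b.
  by apply: is_path_join pp1 pq2 _ => z zp zq; apply: fst zp _; rewrite /= inq zq orbT.
have [_ y1] := is_path_mem pp1.
have sA z : z \in p1 ++ behead (rev q1) -> z \in p \/ z \in q.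
  by rewrite (mem_join z pr1 y1) mem_rev inq => /orP[/inp|->]; auto.
have sB z : z \in p1 ++ behead q2 -> z \in p \/ z \in q.
  by rewrite (mem_join z pq2 y1) inq => /orP[/inp|->]; rewrite ?orbT; auto.
have lA := path_length_join pp1 pr1; have lB := path_length_join pp1 pq2.
have {}oq : odd (path_length q1) (+) odd (path_length q2) = (c a == c b).
  by rewrite -oq {1}Eq (path_length_join pq1 pq2) oddD.
case: (eqVneq (odd (path_length (p1 ++ behead (rev q1))) (+) c a) par) => hA.
  by exists (p1 ++ behead (rev q1)), a; split; auto.
exists (p1 ++ behead q2), b; split; auto; move: hA; rewrite lA lB path_length_rev !oddD; move: oq.
by case: (odd _); case: (odd _); case: (odd _); case: (c a); case: (c b); case: par.
Qed.

Lemma plan_swap (T : finType) (e : rel T) c W F (s t : T) p L R Q l r a b fl :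
  plan e c W F s t p L R Q l r a b fl -> plan e c W F t s p R L Q r l a b fl.
Proof.
move=> [[pL pR sub] h1 h2 [h3 [h4 h5 h6 h7]] h8]; split; first split=> //.
- by move=> z; rewrite !mem_cat => h; apply: sub; rewrite !mem_cat orbCA.
- by move=> /h1[k1 k2 k3 k4]; split=> // z /k4[].
- by move=> /h2 <-; rewrite addnC; congr (_ (+) _); rewrite addbC.
- by split=> // z zR zL; apply: h3 zL zR.
- move=> z zR zW; have : z \in [:: l; r; a; b] by apply: h8 => //; move: zR; rewrite !mem_cat orbCA.
  by rewrite !inE orbCA.
Qed.

Lemma link_via_breakers (T : finType) (e h : rel T) (c : T -> bool) (W : {set T}) (k : nat)
    (s t : 'I_k -> T) (p : 'I_k -> bool) (Q : 'I_(2 * k) -> seq T) :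
  symmetric e -> subrel h e -> (forall x y, h x y -> c x != c y) ->
  (forall X : {set T}, X \subset W -> #|X| <= 4 * k -> linked h W X) ->
  injective s -> injective t -> (forall i j, s i != t j) ->
  (forall X : {set T}, #|X| < 2 * k -> connected_minus e X) -> 2 * k <= #|W| ->
  (forall j, breaking e c W (Q j)) -> (forall i j z, z \in Q i -> z \in Q j -> i = j) ->
  exists P : 'I_k -> seq T,
    (forall i, is_path e (P i) (s i) (t i) /\ odd (path_length (P i)) = p i) /\
    (forall i j, i != j -> [disjoint P i & P j]).
Proof.
move=> se he hc lk is_ it st con cW brk dQ.
(* Defined by positions and not by [e], so that chords of a breaking path do not belong to it. *)
pose g : rel T := fun u v => [exists j, [&& u \in Q j, v \in Q j &
  (index u (Q j) == (index v (Q j)).+1) || (index v (Q j) == (index u (Q j)).+1)]].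
have sg : symmetric g.
  by move=> u v; apply: eq_existsb => j; rewrite andbCA; congr [&& _, _ & _]; rewrite orbC.
have [a /fin_all_exists[b ab]] := fin_all_exists brk.
have gq j : is_path g (Q j) (a j) (b j).
  have [[q [E _ lq uq]] _ _ _ _] := ab j; exists q; split=> //.
  apply/(pathP (a j)) => i iq; apply/existsP; exists j; rewrite E.
  have i1 : i < size (a j :: q) by rewrite /= ltnS ltnW.
  have i2 : i.+1 < size (a j :: q) by rewrite /= ltnS.
  have E2 : nth (a j) q i = nth (a j) (a j :: q) i.+1 by [].
  rewrite E in uq; rewrite E2 (mem_nth _ i1) (mem_nth _ i2).
  by rewrite (index_uniq _ i1 uq) (index_uniq _ i2 uq) eqxx orbT.
have clo j x y : x \in Q j -> g x y -> y \in Q j.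
  by move=> xj /existsP[j' /and3P[xj' yj' _]]; rewrite (dQ _ _ _ xj xj').
have cut j p1 z p2 : Q j = p1 ++ z :: p2 -> forall x y, x \in p1 -> y \in p2 -> ~~ g x y.
  move=> E x y xp yp; apply/negP => /existsP[j' /and3P[xj' yj' ix]].
  have xj : x \in Q j by rewrite E mem_cat xp.
  have Ej := dQ _ _ _ xj' xj; subst j'.
  have := is_path_uniq (gq j); rewrite E cat_uniq => /and3P[_ /hasPn u2 /andP[u3 _]].
  have yp1 : y \notin p1 by apply: u2; rewrite inE yp orbT.
  have zy : z != y by apply: contraNneq u3 => ->.
  move: ix; rewrite E !index_cat xp (negbTE yp1) /= (negbTE zy).
  have ix : index x p1 < size p1 by rewrite index_mem.
  move: ix; generalize (index x p1) (index y p2) (size p1); clear; lia.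
have [P0 hP0] := terminal_family is_ it st con cW.
have [P [gP minP]] := @ex_min _ _ (fun P => \sum_x cost g (P x)) (ex_intro _ P0 hP0).
have [P1 P2] := gP.
have PW x z z' : z \in P x -> z' \in P x -> z \in W -> z' \in W -> z = z'.
  have [w [_ _ hw]] := P1 x; move=> z1 z2 zW zW'; by rewrite (hw _ z1 zW) (hw _ z2 zW').
have onePath j x : a j \in P x -> b j \in P x -> False.
  by have [_ aW bW /eqP nab _] := ab j => ax bx; apply: nab; apply: PW ax bx aW bW.
(* Apply [first_hit] from both ends of [Q j]. Either both ends are used, by different paths because
   a path has only one vertex in [W], or a single path meets [Q j] and it contains an end. *)
have side j : (exists x z, z \in Q j /\ z \in P x) ->
    (exists x y, [/\ x != y, a j \in P x & b j \in P y]) \/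
    (exists x, (a j \in P x \/ b j \in P x) /\ forall y z, z \in Q j -> z \in P y -> y = x).
  move=> tj; have [pj aW bW nab [Wj _]] := ab j; have gj := gq j.
  have h1 := first_hit se sg gP minP pj gj aW bW nab Wj (@clo j) (@cut j) tj.
  have h2 : (exists x, b j \in P x) \/ exists x, a j \in P x /\ forall y z, z \in Q j -> z \in P y -> y = x.
    have : (exists x, b j \in P x) \/ exists x, a j \in P x /\ forall y z, z \in rev (Q j) -> z \in P y -> y = x.
      apply: (first_hit se sg gP minP (is_path_rev se pj) (is_path_rev sg gj) bW aW); first by rewrite eq_sym.
      - by move=> z; rewrite mem_rev => zj zW; case: (Wj z zj zW); auto.
      - by move=> x y; rewrite !mem_rev; apply: clo.
      - move=> p1 z p2 E x y xp yp; rewrite sg; apply: (@cut j (rev p2) z (rev p1)); rewrite ?mem_rev //.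
        by rewrite -[Q j]revK E rev_cat rev_cons cat_rcons.
      - by have [x [z [zj zx]]] := tj; exists x, z; rewrite mem_rev.
    by case=> [|[x [ax on]]]; [left|right; exists x; split=> // y z zj; apply: on; rewrite mem_rev].
  case: h1 => [[x ax]|[x [bx on]]]; last by right; exists x; auto.
  case: h2 => [[y yb]|[y [ay on]]]; last by right; exists y; auto.
  left; exists x, y; split=> //; apply/eqP => E; rewrite -E in yb; exact: onePath ax yb.
pose N j := [set x | (a j \in P x) || (b j \in P x)].
pose beta j x := (x \in N j) && [forall y, has [in P y] (Q j) ==> (y == x)].
(* The pairs with a path that is alone in touching some breaking path; there [two_routes] offers
   both parities. *)
pose Fx := [set i | [exists j, [exists d, beta j (i, d)]]].
pose Tj := [set j | [exists x, has [in P x] (Q j)]].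
pose G : {set 'I_k * bool} := [set x | x.1 \in Fx].
have cG : #|G| = 2 * #|Fx|.
  have -> : G = setX Fx setT by apply/setP => -[i d]; rewrite !inE andbT.
  by rewrite cardsX cardsT card_bool mulnC.
have abQ j : a j \in Q j /\ b j \in Q j by apply: is_path_mem (gq j).
have NQ j x : x \in N j -> exists z, [/\ z \in P x, z \in W & z \in Q j].
  have [_ aW bW _ _] := ab j; have [h1 h2] := abQ j.
  by rewrite inE => /orP[]; [exists (a j)|exists (b j)].
have dN i j : i != j -> [disjoint N i & N j].
  move=> ij; apply/disjP => x /NQ[z [z1 z2 z3]] /NQ[z' [z1' z2' z3']].
  by case/eqP: ij; apply: dQ z3 _; rewrite (PW x z z').
(* A touched breaking path contains the ends of two paths, or the end of one path belonging to
   a pair in [Fx]. *)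
have count : 2 * #|Tj| <= 2 * k + 2 * #|Fx|.
  have s1 : \sum_j #|N j| <= 2 * k.
    by rewrite -(card_bigcup_disj dN); apply: leq_trans (max_card _) _; rewrite card_prod card_ord card_bool; clear; lia.
  have s2 : \sum_j #|N j :&: G| <= 2 * #|Fx|.
    rewrite -cG -card_bigcup_disj; last first.
      by move=> i j /dN/disjP d; apply/disjP => z; rewrite !in_setI => /andP[z1 _] /andP[z2 _]; apply: d z1 z2.
    by apply/subset_leq_card/subsetP => z /bigcupP[i _]; rewrite in_setI => /andP[].
  apply: leq_trans _ (leq_add s1 s2); rewrite -big_split /= card_sum_bool big_distrr /=.
  apply: leq_sum => j _; case: (boolP (j \in Tj)) => [|_]; last by rewrite muln0.
  rewrite inE => /existsP[x0 /hasP[z0 z0Q z0x]].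
  case: (side j) => [|[x [y [xy ax yb]]]|[x [hx on]]]; first by exists x0, z0.
    have : [set x; y] \subset N j by apply/subsetP => o /set2P[]->; rewrite inE ?ax ?yb ?orbT.
    by move/subset_leq_card; rewrite cards2 xy muln1 => le; apply: leq_trans le (leq_addr _ _).
  have xN : x \in N j by rewrite inE; apply/orP.
  have xG : x \in G.
    rewrite !inE; apply/existsP; exists j; apply/existsP; exists x.2; rewrite /beta -surjective_pairing xN /=.
    by apply/forallP => y; apply/implyP => /hasP[z zQ zy]; apply/eqP; apply: on zQ zy.
  have n1 : 0 < #|N j| by apply/card_gt0P; exists x.
  have n2 : 0 < #|N j :&: G| by apply/card_gt0P; exists x; rewrite in_setI xN.
  exact: (leq_add n1 n2).
have f0 (i : 'I_k) : 'I_(2 * k) by apply: widen_ord i; clear; lia.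
(* At most [k + #|Fx|] of the [2 * k] breaking paths are touched, which leaves one for each pair
   outside [Fx]. *)
have [ju [juU jui]] : exists ju : 'I_k -> 'I_(2 * k), {in ~: Fx, forall i, ju i \in ~: Tj} /\ {in ~: Fx &, injective ju}.
  apply: (sdr_large f0 (N := fun=> ~: Tj)) => i _; rewrite -(leq_add2l #|Tj|) cardsC card_ord.
  have := cardsC Fx; rewrite card_ord => E; rewrite -(leq_add2r #|Fx|) -addnA [#|~: Fx| + _]addnC E.
  by move: count; clear; lia.
have exj i : exists jd : 'I_(2 * k) * bool, i \in Fx -> beta jd.1 (i, jd.2).
  case: (boolP (i \in Fx)) => [|_]; last by exists (f0 i, true).
  by rewrite inE => /existsP[j /existsP[d h']]; exists (j, d).
have [jf hf] := fin_all_exists exj.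
have bOn i y z : i \in Fx -> z \in Q (jf i).1 -> z \in P y -> y = (i, (jf i).2).
  by move=> /hf/andP[_ /forallP/(_ y)/implyP on] zQ zy; apply/eqP/on/hasP; exists z.
pose J i := if i \in Fx then (jf i).1 else ju i.
have only i y z : z \in Q (J i) -> z \in P y -> y.1 = i.
  rewrite /J; case: ifP => iF zQ zy; first by rewrite (bOn i y z).
  have : ju i \in ~: Tj by apply: juU; rewrite inE iF.
  by rewrite !inE => /negP[]; apply/existsP; exists y; apply/hasP; exists z.
have bT i : i \in Fx -> (jf i).1 \in Tj.
  move=> /hf/andP[/NQ[z [z1 _ z2]] _]; rewrite inE; apply/existsP; exists (i, (jf i).2).
  by apply/hasP; exists z.
have Ji i i' : J i = J i' -> i = i'.
  rewrite /J; case: ifP => iF; case: ifP => iF' E.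
  - have := hf i iF; rewrite E => /andP[/NQ[z [z1 _ z2]] _].
    by have [] := bOn i' _ z iF' z2 z1.
  - have := bT i iF; rewrite E; have : ju i' \in ~: Tj by apply: juU; rewrite inE iF'.
    by rewrite inE => /negbTE->.
  - have := bT i' iF'; rewrite -E; have : ju i \in ~: Tj by apply: juU; rewrite inE iF.
    by rewrite inE => /negbTE->.
  - by apply: jui => //; rewrite inE ?iF ?iF'.
pose F i := [set z | [|| z \in P (i, false), z \in P (i, true) | z \in Q (J i)]].
have PF i d z : z \in P (i, d) -> z \in F i by rewrite inE; case: d => ->; rewrite ?orbT.
have QF i z : z \in Q (J i) -> z \in F i by rewrite inE => ->; rewrite ?orbT.
have inF i z : z \in F i -> (exists d, z \in P (i, d)) \/ z \in Q (J i).
  by rewrite inE => /or3P[]; auto; left; [exists false|exists true].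
apply: (assemble_plans (F := F) se he hc lk).
  move=> i j z /inF[[d zi]|zi] /inF[[d' zj]|zj].
  - by have [] := P2 _ _ _ zi zj.
  - by rewrite -(only _ _ _ zj zi).
  - by rewrite -(only _ _ _ zi zj).
  - by apply: Ji; apply: dQ zi zj.
move=> i; case: (boolP (i \in Fx)) => iF; last first.
  have [l [pl lW Pl]] := P1 (i, false); have [r [pr rW Pr]] := P1 (i, true).
  have EJ : J i = ju i by rewrite /J (negbTE iF).
  have nt y z : z \in Q (J i) -> z \notin P y.
    move=> zQ; apply/negP => zy; have : ju i \in ~: Tj by apply: juU; rewrite inE.
    by rewrite !inE => /negP[]; apply/existsP; exists y; apply/hasP; exists z; rewrite -?EJ.
  have [pj aW bW nab [Wj oj]] := ab (J i).
  exists (P (i, false)), (P (i, true)), (Q (J i)), l, r, (a (J i)), (b (J i)), false; split.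
  - by split=> // z; rewrite !mem_cat => /or3P[/PF|/PF|/QF].
  - by move=> _; split=> // z zQ; split; apply: nt.
  - by [].
  - by split=> // z z1 z2; have := P2 _ _ _ z1 z2.
  - move=> z; rewrite !mem_cat !inE => /or3P[z1 /(Pl _ z1)->|z1 /(Pr _ z1)->|z1 /(Wj _ z1)[]->]; by rewrite eqxx ?orbT.
have EJ : J i = (jf i).1 by rewrite /J iF.
have bi := hf i iF; set d := (jf i).2 in bi; rewrite -EJ in bi.
have [w [pw wW Pw]] := P1 (i, d); have [r [pr rW Pr]] := P1 (i, ~~ d).
have [pj aW bW nab [Wj oj]] := ab (J i).
have wab : w = a (J i) \/ w = b (J i).
  have /andP[] := bi; rewrite inE => /orP[]h1 _; [left|right]; by rewrite (Pw _ h1).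
have hq : has [in Q (J i)] (P (i, d)).
  have /andP[/NQ[z [z1 _ z2]] _] := bi; by apply/hasP; exists z.
have [L [v [pL vE oL sL]]] := two_routes (p i (+) odd (path_length (P (i, ~~ d))) (+) c r) se pw pj oj hq.
have vW : v \in W by case: vE => ->.
have key : plan e c W (F i) (if d then t i else s i) (if ~~ d then t i else s i) (p i) L (P (i, ~~ d)) [::]
    v r (a (J i)) (b (J i)) true.
  split=> //.
  - by split=> // z; rewrite !mem_cat orbF => /orP[/sL[/PF|/QF]|/PF].
  - move=> _; rewrite oddD; move: oL.
    by case: (odd _); case: (odd _); case: (c v); case: (c r); case: (p i).
  - split=> // z /sL[z1 z2|z1 z2].
      by have := P2 _ _ _ z1 z2; case: (d).
    by have := z1; rewrite EJ => z1'; have := bOn i _ z iF z1' z2; rewrite -/d; case: (d).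
  - move=> z; rewrite !mem_cat orbF !inE => /orP[/sL[z1 /(Pw _ z1)->|z1 /(Wj _ z1)[]->]|z1 /(Pr _ z1)->].
    + by case: wab => ->; rewrite eqxx ?orbT.
    + by rewrite eqxx ?orbT.
    + by rewrite eqxx ?orbT.
    + by rewrite eqxx ?orbT.
case: (d) key => key; last by exists L, (P (i, true)), [::], v, r, (a (J i)), (b (J i)), true.
by exists (P (i, false)), L, [::], r, v, (a (J i)), (b (J i)), true; apply: plan_swap.
Qed.

(** * Nearly bipartite graphs *)

Definition bichrom (T : finType) (e : rel T) (c : T -> bool) : rel T := [rel x y | e x y && (c x != c y)].

(** Without [Y] all degrees are at least [42 * k], well above the [24 * k] that [massed_linked]
    wants for [4 * k] terminals. Thinness is vacuous, since [Y] and a separator of fewer than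
    [4 * k] vertices do not disconnect the graph. *)
Lemma near_linked (T : finType) (e : rel T) (c : T -> bool) k (Z Y X : {set T}) :
  symmetric e -> irreflexive e -> 0 < k -> k_connected e (50 * k) -> Z \subset Y -> #|Y| <= 8 * k ->
  (forall x y, x \notin Z -> y \notin Z -> e x y -> c x != c y) ->
  X \subset ~: Y -> #|X| <= 4 * k -> linked (bichrom e c) (~: Y) X.
Proof.
move=> se ie k0 con ZY cY col XW cX; set h := bichrom e c; set W := ~: Y.
have [nT conn] := con.
have eh a b : a \in W -> b \in W -> e a b -> h a b.
  rewrite !in_setC => aW bW ab; rewrite /h /bichrom /= ab /=.
  by apply: col ab; [apply: contra aW|apply: contra bW]; apply: (subsetP ZY).
have deg a : a \in W -> 42 * k <= #|nb h W a|.
  move=> aW; have := min_degree a ie con.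
  have le : #|nb e setT a| <= #|nb h W a| + #|Y|.
    apply: leq_trans (leq_card_setU _ _); apply/subset_leq_card/subsetP => b; rewrite in_setU !nbP in_setT /=.
    by case: (boolP (b \in W)) => [bW /(eh _ _ aW bW)->|] //; rewrite in_setC negbK => ->; rewrite orbT.
  by move: le cY; clear; lia.
apply: (@massed_linked _ _ _ _ (2 * k)).
- by move=> x y; rewrite /h /bichrom /= se eq_sym.
- by move=> x; rewrite /h /bichrom /= ie.
- by move: k0; clear; lia.
- by move: cX; clear; lia.
split=> //.
  have big : #|W :\: X| * (42 * k) <= arcs h W (W :\: X).
    rewrite -sum_nat_const; apply: (@leq_trans (\sum_(a in W :\: X) #|nb h W a|)).
      by apply: leq_sum => a; rewrite inE => /andP[_ aW]; apply: deg aW.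
    rewrite /arcs (eq_bigr (fun a => \sum_(b | b \in nb h W a) 1)); last by move=> a _; rewrite sum1_card.
    rewrite pair_big_dep /= sum1_card; apply/subset_leq_card/subsetP => -[a b].
    by rewrite unfold_in /= !inE => /andP[/andP[-> ->] /andP[-> ->]].
  have pos : 0 < #|W :\: X|.
    have := cardsC Y; have := cardsID X W; have := subset_leq_card (subsetIr W X); rewrite -/W.
    by move: cY cX nT k0; clear; lia.
  apply: leq_trans big; rewrite mulnC ltn_pmul2l //; move: k0; clear; lia.
move=> U S [UW SW dUS clo] dXU ltS.
case: (set_0Vmem U) => [->|[u uU]]; first by rewrite arcs0.
have [x xX xS] : exists2 x, x \in X & x \notin S.
  case: (set_0Vmem (X :\: S)) => [E|[x]]; last by rewrite inE => /andP[]; exists x.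
  by have/subset_leq_card : X \subset S by [rewrite -setD_eq0 E]; rewrite leqNgt ltS.
have xU : x \notin U by apply/negP => xU; move/disjP: dXU => /(_ x xX xU).
have lt : #|Y :|: S| < 50 * k.
  by apply: leq_ltn_trans (leq_card_setU _ _) _; move: cY ltS cX k0; clear; lia.
have uW := subsetP UW _ uU; have xW := subsetP XW _ xX.
have uS : u \notin S by apply/negP => uS; move/disjP: dUS => /(_ u uU uS).
have uY : u \notin Y :|: S by rewrite in_setU negb_or uS andbT -in_setC.
have xY : x \notin Y :|: S by rewrite in_setU negb_or xS andbT -in_setC.
case/negP: xU; apply: closed_connect_in (conn _ lt u x uY xY) uU.
move=> a b /= /and3P[ab _]; rewrite in_setU negb_or -in_setC => /andP[bW bS] aU.
by have := clo a b aU bW (eh _ _ (subsetP UW _ aU) bW ab); rewrite in_setU (negbTE bS) orbF.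
Qed.

(** A vertex of [Z] takes the colour opposite to the majority of its neighbours outside [Z], of
    which there are at least [46 * k]. *)
Lemma majority_extension (T : finType) (e : rel T) k (Z : {set T}) :
  irreflexive e -> k_connected e (50 * k) -> #|Z| <= 4 * k -> bipartite_minus e Z ->
  exists c, (forall x y, x \notin Z -> y \notin Z -> e x y -> c x != c y) /\
    forall v, 23 * k <= #|nb (bichrom e c) (~: Z) v|.
Proof.
move=> ie con cZ [c0 col].
pose n v b := #|[set y in ~: Z | e v y && (c0 y == b)]|.
pose c v := if v \in Z then n v true < n v false else c0 v.
have deg v : 46 * k <= n v true + n v false.
  have := min_degree v ie con.
  have le : #|nb e setT v| <= #|Z| + (n v true + n v false).
    apply: leq_trans (leq_add (leqnn _) (leq_card_setU _ _)); apply: leq_trans (leq_card_setU _ _).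
    apply/subset_leq_card/subsetP => y; rewrite nbP in_setT !inE /= => ->.
    by case: (y \in Z); case: (c0 y).
  by move: le cZ; clear; lia.
exists c; split=> [x y xZ yZ|v]; first by rewrite /c (negbTE xZ) (negbTE yZ); apply: col.
have E : nb (bichrom e c) (~: Z) v = [set y in ~: Z | e v y && (c0 y == ~~ c v)].
  apply/setP => y; rewrite !inE /=; case: (boolP (y \in Z)) => //= yZ.
  have cy : c y = c0 y by rewrite /c (negbTE yZ).
  by rewrite /bichrom /= cy; case: (e v y) => //=; case: (c0 y); case: (c v).
rewrite E -/(n v (~~ c v)); case: (boolP (v \in Z)) => vZ.
  by have := deg v; rewrite /c vZ; case: ltnP => /=; clear; lia.
have : n v (c v) = 0.
  apply/eqP; rewrite cards_eq0; apply/eqP/setP => y; rewrite !inE.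
  apply/negbTE/negP => /and3P[yZ vy /eqP yc]; have := col v y vZ yZ vy.
  by rewrite yc /c (negbTE vZ) eqxx.
by have := deg v; case: (c v) => /=; clear; lia.
Qed.

Lemma half_matching (T : finType) (V : {set T}) (e : rel T) m k : mat e V m -> 2 * k <= #|covered m| ->
  exists u : 'I_k -> T, forall i j, m (u i) != u i /\ (i != j -> u i != u j /\ u i != m (u j)).
Proof.
move=> hm; elim: k => [|k IH] big; first by have u : 'I_0 -> T by [case]; exists u; case.
have [u hu] := IH ltac:(by move: big; clear; lia).
pose A := [set u i | i : 'I_k] :|: [set m (u i) | i : 'I_k].
have cA : #|A| <= k + k.
  by apply: leq_trans (leq_card_setU _ _) (leq_add _ _); rewrite -[X in _ <= X]card_ord; apply: leq_imset_card.
case: (set_0Vmem (covered m :\: A)) => [E|[v]].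
  have/subset_leq_card : covered m \subset A by rewrite -setD_eq0 E.
  by move: big cA; clear; lia.
rewrite !inE negb_or => /andP[/andP[v1 v2] vm].
have n1 j : v != u j by apply: contraNneq v1 => ->; apply: imset_f.
have n2 j : v != m (u j) by apply: contraNneq v2 => ->; apply: imset_f.
have mm w : m (m w) = w by case: (hm w).
exists (fun i => if unlift ord_max i is Some j then u j else v) => i j.
case: (unliftP ord_max i) => [i'|] ->; case: (unliftP ord_max j) => [j'|] ->.
- have [h1 h2] := hu i' j'; split=> // ne; apply: h2; apply: contraNneq ne => ->; exact: eqxx.
- have [h1 _] := hu i' i'; split=> // _; rewrite eq_sym n1; split=> //.
  by apply: contraNneq (n2 i') => ->; rewrite mm.
- by split=> // _.
- by split=> //; rewrite eqxx.
Qed.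

(** * Monochromatic edges after the identification of the terminals of each pair *)

Section Folding.
Variables (T : finType) (k : nat) (s t : 'I_k -> T).
Hypotheses (is_ : injective s) (it : injective t) (st : forall i j, s i != t j).

Definition fold v := if [pick i | t i == v] is Some i then s i else v.

Lemma fold_t i : fold (t i) = s i.
Proof. by rewrite /fold; case: pickP => [j /eqP/it->|/(_ i)]; rewrite ?eqxx. Qed.

Lemma fold_id v : (forall i, v != t i) -> fold v = v.
Proof. by rewrite /fold; case: pickP => // i /eqP <- /(_ i); rewrite eqxx. Qed.

Lemma fold_s i : fold (s i) = s i.
Proof. exact: fold_id. Qed.

Lemma fold_cases v : fold v = v \/ exists2 i, v = t i & fold v = s i.
Proof.
rewrite /fold; case: pickP => [i /eqP E|_]; last by left.
by right; exists i.
Qed.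

Lemma fold_not_t v i : fold v != t i.
Proof.
rewrite /fold; case: pickP => [j _|/(_ i)]; first exact: st.
by rewrite eq_sym => ->.
Qed.

Lemma fold_inv v i : fold v = s i -> v = s i \/ v = t i.
Proof. by case: (fold_cases v) => [->|[j -> ->]]; [left|move/is_ ->; right]. Qed.

Definition term v := [exists i, (v == s i) || (v == t i)].

Lemma term_s i : term (s i). Proof. by apply/existsP; exists i; rewrite eqxx. Qed.
Lemma term_t i : term (t i). Proof. by apply/existsP; exists i; rewrite eqxx orbT. Qed.

Lemma term_fold v : term (fold v) = term v.
Proof. by case: (fold_cases v) => [->|[i -> ->]]; rewrite ?term_s ?term_t. Qed.

Lemma fold_nterm v : ~~ term v -> fold v = v.
Proof. by move=> nt; apply: fold_id => i; apply: contraNneq nt => ->; apply: term_t. Qed.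

(** The Tutte-Berge formula for the monochromatic edges after the identification. Independence is
    used twice: no edge becomes a loop, and a class may keep all of its terminals, there being no
    edges among them. *)
Lemma odd_edges_alternative (e : rel T) (c : T -> bool) : 0 < k ->
  symmetric e -> irreflexive e -> (forall u v, term u -> term v -> ~~ e u v) ->
  (exists x y : 'I_k -> T, (forall j, e (x j) (y j) /\ c (x j) = c (y j)) /\
     forall i j u v, u \in [:: x i; y i] -> v \in [:: x j; y j] -> fold u = fold v -> i = j)
  \/ exists D : {set T}, #|D| <= 2 * k - 2 /\ bipartite_minus e D.
Proof.
move=> k0 se ie ind.
pose e' : rel T := fun u v => [exists xy : T * T,
  [&& fold xy.1 == u, fold xy.2 == v, e xy.1 xy.2 & c xy.1 == c xy.2]].
have e'P u v : e' u v -> exists x y, [/\ fold x = u, fold y = v, e x y & c x = c y].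
  by move=> /existsP[[x y] /and4P[/eqP h1 /eqP h2 h3 /eqP h4]]; exists x, y.
have se' : symmetric e'.
  by move=> u v; apply/idP/idP => /e'P[x [y [h1 h2 h3 h4]]]; apply/existsP; exists (y, x);
    rewrite /= h1 h2 h4 se h3 !eqxx.
have ie' : irreflexive e'.
  move=> u; case E: (e' u u) => //; have [x [y [h1 h2 h3 _]]] := e'P u u E.
  have xy : x != y by apply: contraTneq h3 => ->; rewrite ie.
  case: (boolP (term x)) => tx.
    by have : term y by [rewrite -term_fold h2 -h1 term_fold]; move=> ty; have := ind _ _ tx ty; rewrite h3.
  have ty : ~~ term y by rewrite -term_fold h2 -h1 term_fold.
  by case/eqP: xy; rewrite -(fold_nterm tx) -(fold_nterm ty) h1 h2.
pose V := [set v | [forall i, v != t i]].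
have [m [B [f [[hm _] BV fE le]]]] := tutte_berge se' ie' V.
have fV v : fold v \in V by rewrite inE; apply/forallP => i; apply: fold_not_t.
case: (leqP (2 * k) #|covered m|) => big.
  left; have [u hu] := half_matching hm big.
  have ex j : exists xy : T * T, [/\ fold xy.1 = u j, fold xy.2 = m (u j), e xy.1 xy.2 & c xy.1 = c xy.2].
    have [/eqP nm _] := hu j j; have [_ /(_ nm)[ee _ _]] := hm (u j).
    by have [x [y h]] := e'P _ _ ee; exists (x, y).
  have [xy hxy] := fin_all_exists ex.
  exists (fun j => (xy j).1), (fun j => (xy j).2); split=> [j|i j w v]; first by case: (hxy j).
  have [i1 i2 _ _] := hxy i; have [j1 j2 _ _] := hxy j.
  move=> hw hv E; apply/eqP; apply: contraT => ij; have [_ /(_ ij)[n1 n2]] := hu i j.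
  have mm w' : m (m w') = w' by case: (hm w').
  move: hw hv E; rewrite !inE => /orP[]/eqP-> /orP[]/eqP->; rewrite ?i1 ?i2 ?j1 ?j2 => /eqP E.
  - by rewrite (negbTE n1) in E.
  - by rewrite (negbTE n2) in E.
  - by move: E n2 => /eqP <-; rewrite mm eqxx.
  - by move: E n1 => /eqP/(congr1 m); rewrite !mm => ->; rewrite eqxx.
(* [D1] unfolds the barrier; [D2] leaves in each class its terminals, or else one vertex if the
   class is odd and none if it is even. *)
right; have cov : #|covered m| <= 2 * k - 2.
  by have := covered_even hm; move: big; clear; lia.
pose C y := [set a in V :\: B | f a == y].
pose hasT y := [exists i, s i \in C y].
pose keep v := [&& ~~ hasT (f v), odd #|C (f v)| & [pick w in C (f v)] == Some v].
pose D1 := [set v | fold v \in B].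
pose D2 := [set v in V :\: B | ~~ term v & ~~ keep v].
have cD1 : #|D1| <= 2 * #|B|.
  pose sw u := if [pick i | s i == u] is Some i then t i else u.
  have : D1 \subset B :|: [set sw u | u in B].
    apply/subsetP => v; rewrite inE; case: (fold_cases v) => [->|[i Ev ->]] hB; first by rewrite inE hB.
    rewrite inE; apply/orP; right; apply/imsetP; exists (s i) => //; rewrite /sw.
    by case: pickP => [j /eqP/is_ ->|/(_ i)]; rewrite ?eqxx.
  move/subset_leq_card => h; apply: leq_trans h _; apply: leq_trans (leq_card_setU _ _) _.
  by rewrite mul2n -addnn leq_add2l; apply: leq_imset_card.
(* An odd class keeps at least one vertex: a terminal if it has one, and the picked vertex
   otherwise. *)
have CD y : #|C y :&: D2| + odd #|C y| <= #|C y|.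
  have [out|] := boolP (odd #|C y|); last by rewrite addn0 => _; apply/subset_leq_card/subsetIl.
  have [z zC zD] : exists2 z, z \in C y & z \notin D2.
    case: (boolP (hasT y)) => [/existsP[i iC]|nT].
      by exists (s i) => //; rewrite inE term_s /= andbF.
    have : 0 < #|C y| by case: #|_| out.
    move=> /card_gt0P[w wC]; case E : [pick w in C y] => [z|]; last first.
      by move: E; case: pickP => // /(_ w); rewrite wC.
    have zC : z \in C y by move: E; case: pickP => // z' h [<-].
    exists z => //; have fz : f z = y by move: zC; rewrite inE => /andP[_ /eqP].
    by rewrite inE /keep fz nT out E eqxx /= !andbF.
  rewrite addn1; apply: proper_card; apply/properP; split; first exact: subsetIl.
  by exists z => //; rewrite inE (negbTE zD) andbF.
have dC y y' : y != y' -> [disjoint C y & C y'].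
  move=> ne; apply/disjP => z; rewrite !inE => /andP[_ /eqP->] /andP[_ /eqP E].
  by rewrite E eqxx in ne.
have cD2 : #|D2| + #|[set y | odd #|C y|]| <= #|V :\: B|.
  have E1 : \bigcup_y C y = V :\: B.
    apply/setP => v; apply/bigcupP/idP => [[y _]|h]; first by rewrite inE => /andP[].
    by exists (f v) => //; rewrite inE h eqxx.
  have E2 : \bigcup_y (C y :&: D2) = D2.
    rewrite -big_distrl /= E1; apply/setIidPr/subsetP => v; by rewrite inE => /andP[].
  rewrite -{1}E2 -E1 card_bigcup_disj; last first.
    by move=> y y' /dC/disjP d; apply/disjP => z; rewrite !in_setI => /andP[z1 _] /andP[z2 _]; apply: d z1 z2.
  rewrite card_bigcup_disj // card_sum_bool -big_split /=; apply: leq_sum => y _.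
  by rewrite inE; apply: CD.
exists (D1 :|: D2); split.
  (* A folded vertex of [B] opens into at most two. By the formula [2 * #|B| + #|V :\: B|] minus the
     number of odd classes is at most [#|covered m|]. *)
  apply: leq_trans (leq_card_setU _ _) _.
  have := cardsID B V; have -> : V :&: B = B by apply/setIidPr.
  have le' : #|V| + #|B| <= #|covered m| + #|[set y | odd #|C y|]| := le.
  move: cD1 cD2 le' cov; generalize #|[set y | odd #|C y|]|; clear; lia.
exists c => x y; rewrite !in_setU !negb_or => /andP[x1 x2] /andP[y1 y2] xy; apply/negP => /eqP cxy.
have exy : e' (fold x) (fold y) by apply/existsP; exists (x, y); rewrite /= xy cxy !eqxx.
have xV : fold x \in V :\: B by rewrite inE fV andbT; move: x1; rewrite inE.
have yV : fold y \in V :\: B by rewrite inE fV andbT; move: y1; rewrite inE.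
have fxy := fE _ _ xV yV exy.
have inC v : fold v \in V :\: B -> fold v \in C (f (fold v)) by move=> h; rewrite inE h eqxx.
have kp v : fold v \in V :\: B -> v \notin D2 -> term v \/ keep v.
  case: (boolP (term v)) => tv; [by left|rewrite (fold_nterm tv) => h].
  by rewrite inE h tv /= negbK; right.
have nT : hasT (f (fold x)) = false.
  case hT: (hasT _) => //; have kt v : fold v \in V :\: B -> v \notin D2 -> f (fold v) = f (fold x) -> term v.
    move=> v1 v2 Ev; case: (boolP (term v)) => // tv; case: (kp v v1 v2); [by rewrite (negbTE tv)|move=> /and3P[]].
    by rewrite -[in hasT _](fold_nterm tv) Ev hT.
  by have := ind x y (kt x xV x2 erefl) (kt y yV y2 (esym fxy)); rewrite xy.
have nterm v : fold v \in V :\: B -> f (fold v) = f (fold x) -> ~~ term v.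
  move=> h Ev; apply/negP => /existsP[i tv]; have E : fold v = s i.
    by case/orP: tv => /eqP->; rewrite ?fold_s ?fold_t.
  by suff : hasT (f (fold x)) by [rewrite nT]; apply/existsP; exists i; rewrite -E -Ev; apply: inC.
have nx := nterm x xV erefl; have ny := nterm y yV (esym fxy).
case: (kp x xV x2); rewrite ?(negbTE nx) // => /and3P[_ _ /eqP px].
case: (kp y yV y2); rewrite ?(negbTE ny) // => /and3P[_ _ /eqP py].
move: fxy py; rewrite (fold_nterm nx) (fold_nterm ny) => <-; rewrite px => -[E].
by rewrite E ie in xy.
Qed.

End Folding.

(** The terminal [u] can enter [W] directly or by way of [v]. The second route is longer by one edge
    but enters at the same colour, since [c u = c v], so one of the two has the right parity. *)
Lemma touched_plan (T : finType) (e : rel T) (c : T -> bool) (W F Y : {set T}) (f : T -> T) p u u' v :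
  [disjoint W & Y] -> (forall z, z \in Y -> [/\ f z \in W, e z (f z) & c z != c (f z)]) ->
  {in Y &, injective f} -> u \in Y -> u' \in Y -> v \in Y -> u != u' -> v != u -> v != u' ->
  e u v -> c u = c v -> {subset [:: u; u'; v; f u; f u'; f v] <= F} ->
  exists L R Q l r a b flex, plan e c W F u u' p L R Q l r a b flex.
Proof.
move=> /disjP dWY hf fi uY uY' vY nuu nvu nvu' uv cuv sub.
have fW z : z \in Y -> f z \in W by case/hf.
have ef z : z \in Y -> e z (f z) by case/hf.
have cf z : z \in Y -> c (f z) = ~~ c z by case/hf => _ _; case: (c z); case: (c _).
have nf z z' : z \in Y -> z' \in Y -> (z == f z') = false.
  by move=> zY zY'; apply/negbTE/eqP => E; apply: (dWY z) => //; rewrite E fW.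
have ff z z' : z \in Y -> z' \in Y -> (f z == f z') = (z == z').
  by move=> zY zY'; apply/eqP/eqP => [|->//]; apply: fi.
have YW z : z \in Y -> (z \in W) = false by move=> zY; apply/negP => zW; apply: dWY zW zY.
have p2 z : z \in Y -> is_path e [:: z; f z] z (f z).
  by move=> zY; exists [:: f z]; rewrite /= (ef z zY) inE nf.
have inF z : z \in [:: u; u'; v; f u; f u'; f v] -> z \in F := sub z.
case: (boolP (c (f u) (+) c (f u') == p)) => hp.
  exists [:: u; f u], [:: u'; f u'], [::], (f u), (f u'), (f u'), (f u'), true; split=> //.
  - split; [exact: p2|exact: p2|].
    by move=> z; rewrite !inE => h; apply: inF; rewrite !inE; case/or4P: h => ->; rewrite ?orbT.
  - by move=> _; apply/eqP.
  - split; last by split; apply: fW.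
    move=> z; rewrite !inE => /orP[]/eqP-> /orP[].
    + by rewrite (negbTE nuu).
    + by rewrite nf.
    + by rewrite eq_sym nf.
    + by rewrite ff // (negbTE nuu).
  - move=> z; rewrite !inE => /or4P[]/eqP-> zW; first [by rewrite eqxx ?orbT | by rewrite YW in zW].
exists [:: u; v; f v], [:: u'; f u'], [::], (f v), (f u'), (f u'), (f u'), true; split=> //.
- split; [|exact: p2|].
    by exists [:: v; f v]; rewrite /= uv (ef v vY) !inE [u == v]eq_sym (negbTE nvu) !nf.
  by move=> z; rewrite !inE => h; apply: inF; rewrite !inE; case/orP: h => [->|/or4P[]->]; rewrite ?orbT.
- by move=> _ /=; move: hp; rewrite (cf v vY) (cf u uY) -cuv; case: (c u); case: (c _); case: p.
- split; last by split; apply: fW.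
  move=> z; rewrite !inE => /or3P[]/eqP-> /orP[].
  + by rewrite (negbTE nuu).
  + by rewrite nf.
  + by rewrite (negbTE nvu').
  + by rewrite nf.
  + by rewrite eq_sym nf.
  + by rewrite ff // (negbTE nvu').
- move=> z; rewrite !inE => /orP[|/or4P[]]/eqP-> zW; first [by rewrite eqxx ?orbT | by rewrite YW in zW].
Qed.

(** A monochromatic edge away from the pair, extended by the private neighbours of its ends, is a
    path with three edges whose ends have the same colour, hence a breaking path. *)
Lemma untouched_plan (T : finType) (e : rel T) (c : T -> bool) (W F Y : {set T}) (f : T -> T) p u u' x y :
  symmetric e -> [disjoint W & Y] -> (forall z, z \in Y -> [/\ f z \in W, e z (f z) & c z != c (f z)]) ->
  {in Y &, injective f} -> {subset [:: u; u'; x; y] <= Y} -> uniq [:: u; u'; x; y] ->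
  e x y -> c x = c y -> {subset [:: u; u'; x; y; f u; f u'; f x; f y] <= F} ->
  exists L R Q l r a b flex, plan e c W F u u' p L R Q l r a b flex.
Proof.
move=> se /disjP dWY hf fi subY; rewrite /= !inE !negb_or => /and4P[/and3P[uu ux uy] /andP[u'x u'y] xy _] exy cxy sub.
have uY : u \in Y by apply: subY; rewrite !inE eqxx.
have uY' : u' \in Y by apply: subY; rewrite !inE eqxx orbT.
have xY : x \in Y by apply: subY; rewrite !inE eqxx !orbT.
have yY : y \in Y by apply: subY; rewrite !inE eqxx !orbT.
have fW z : z \in Y -> f z \in W by case/hf.
have ef z : z \in Y -> e z (f z) by case/hf.
have cf z : z \in Y -> c (f z) = ~~ c z by case/hf => _ _; case: (c z); case: (c _).
have nf z z' : z \in Y -> z' \in Y -> (z == f z') = false.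
  by move=> zY zY'; apply/negbTE/eqP => E; apply: (dWY z) => //; rewrite E fW.
have fn z z' : z \in Y -> z' \in Y -> (f z == z') = false by move=> *; rewrite eq_sym nf.
have ff z z' : z \in Y -> z' \in Y -> (f z == f z') = (z == z').
  by move=> zY zY'; apply/eqP/eqP => [|->//]; apply: fi.
have YW z : z \in Y -> (z \in W) = false by move=> zY; apply/negP => zW; apply: dWY zW zY.
have p2 z : z \in Y -> is_path e [:: z; f z] z (f z).
  by move=> zY; exists [:: f z]; rewrite /= (ef z zY) inE nf.
exists [:: u; f u], [:: u'; f u'], [:: f x; x; y; f y], (f u), (f u'), (f x), (f y), false; split=> //.
- split; [exact: p2|exact: p2|].
  move=> z; rewrite !inE => h; apply: sub; rewrite !inE; move: h.
  by do 7 (case/orP => [->|]; rewrite ?orbT //); move=> ->; rewrite !orbT.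
- move=> _; split=> //.
  + exists [:: x; y; f y]; rewrite /= !inE se (ef x xY) exy (ef y yY) (fn x x) // (fn x y) // (ff x y) // (nf x y) // (nf y y) // (negbTE xy); by split.
  + by rewrite ff.
  + by rewrite /= !cf // cxy eqxx.
  + have sep z : z \in Y -> z \notin [:: u; u'] ->
        [/\ z \notin [:: u; f u], z \notin [:: u'; f u'], f z \notin [:: u; f u] & f z \notin [:: u'; f u']].
      move=> zY; rewrite !inE !negb_or => /andP[zu zu'].
      by rewrite (nf z u) // (nf z u') // (fn z u) // (fn z u') // (ff z u) // (ff z u') // zu zu'.
    have [x1 x2 x3 x4] := sep x xY ltac:(by rewrite !inE ![x == _]eq_sym negb_or ux).
    have [y1 y2 y3 y4] := sep y yY ltac:(by rewrite !inE ![y == _]eq_sym negb_or uy).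
    have q4 z : z \in [:: f x; x; y; f y] -> [\/ z = f x, z = x, z = y | z = f y].
      by rewrite !inE => /or4P[]/eqP; [constructor 1|constructor 2|constructor 3|constructor 4].
    by move=> z /q4[]->.
- split; last by split; apply: fW.
  move=> z; rewrite !inE => /orP[]/eqP-> /orP[].
  + by rewrite (negbTE uu).
  + by rewrite nf.
  + by rewrite fn.
  + by rewrite ff // (negbTE uu).
- move=> z; rewrite !inE => h zW; move: h.
  do 7 (case/orP => [/eqP E|]; first by [rewrite E in zW *; first [by rewrite eqxx ?orbT | by rewrite YW in zW]]).
  by move=> /eqP->; rewrite eqxx ?orbT.
Qed.

(** The terminals and the ends of the odd edges, at most [4 * k] vertices, get distinct neighbours
    [f z] of the other colour in [W]; each has at least [19 * k] to choose from. A pair touched by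
    an odd edge uses that edge, and the others get untouched ones. *)
Lemma link_via_odd_edges (T : finType) (e : rel T) (c : T -> bool) (Z : {set T}) k (s t : 'I_k -> T)
    (p : 'I_k -> bool) (x y : 'I_k -> T) :
  symmetric e -> irreflexive e -> 0 < k -> k_connected e (50 * k) -> #|Z| <= 4 * k ->
  (forall u v, u \notin Z -> v \notin Z -> e u v -> c u != c v) ->
  (forall v, 23 * k <= #|nb (bichrom e c) (~: Z) v|) ->
  injective s -> injective t -> (forall i j, s i != t j) ->
  (forall u v, term s t u -> term s t v -> ~~ e u v) ->
  (forall j, e (x j) (y j) /\ c (x j) = c (y j)) ->
  (forall i j u v, u \in [:: x i; y i] -> v \in [:: x j; y j] -> fold s t u = fold s t v -> i = j) ->
  exists P : 'I_k -> seq T,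
    (forall i, is_path e (P i) (s i) (t i) /\ odd (path_length (P i)) = p i) /\
    (forall i j, i != j -> [disjoint P i & P j]).
Proof.
move=> se ie k0 con cZ col maj is_ it st ind exy dxy.
pose Y := [set s i | i : 'I_k] :|: [set t i | i : 'I_k] :|: [set x i | i : 'I_k] :|: [set y i | i : 'I_k].
have cY : #|Y| <= 4 * k.
  have im (f : 'I_k -> T) : #|[set f i | i : 'I_k]| <= k by rewrite -[X in _ <= X]card_ord; apply: leq_imset_card.
  have U (A B : {set T}) n m : #|A| <= n -> #|B| <= m -> #|A :|: B| <= n + m.
    by move=> h1 h2; apply: leq_trans (leq_card_setU _ _).1 (leq_add h1 h2).
  have -> : 4 * k = k + k + k + k by lia.
  exact: (U _ _ _ _ (U _ _ _ _ (U _ _ _ _ (im s) (im t)) (im x)) (im y)).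
have sY i : s i \in Y by rewrite !inE imset_f.
have tY i : t i \in Y by rewrite !inE imset_f ?orbT.
have xY i : x i \in Y by rewrite !inE imset_f ?orbT.
have yY i : y i \in Y by rewrite !inE imset_f ?orbT.
have cZY : #|Z :|: Y| <= 8 * k.
  by apply: leq_trans (leq_card_setU _ _) _; move: cZ cY; clear; lia.
pose W := ~: (Z :|: Y).
have dWY : [disjoint W & Y] by apply/disjP => z; rewrite !in_setC in_setU negb_or => /andP[_ /negP].
have lk (X : {set T}) : X \subset W -> #|X| <= 4 * k -> linked (bichrom e c) W X.
  by move=> XW cX; apply: (near_linked se ie k0 con (subsetUl Z Y)).
have big : {in Y, forall v, #|Y| <= #|nb (bichrom e c) W v|}.
  move=> v _; have le : #|nb (bichrom e c) (~: Z) v| <= #|nb (bichrom e c) W v| + #|Y|.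
    apply: leq_trans (leq_card_setU _ _); apply/subset_leq_card/subsetP => z.
    by rewrite in_setU !nbP !in_setC in_setU => /andP[/negbTE-> ->]; case: (z \in Y); rewrite ?orbT.
  by have := maj v; move: le cY; clear; lia.
have [f [fN fi]] := sdr_large id big.
have hf z : z \in Y -> [/\ f z \in W, e z (f z) & c z != c (f z)].
  by move=> /fN; rewrite nbP => /andP[h /andP[]].
have fst : forall i, fold s t (s i) = s i := fold_s st.
have ftt : forall i, fold s t (t i) = s i := fold_t s it.
pose touch j i := (fold s t (x j) == s i) || (fold s t (y j) == s i).
have trm u i : fold s t u = s i -> term s t u by move=> E; rewrite -(term_fold s t) E term_s.
(* An edge touching two pairs would join two terminals. *)
have touch1 j i i' : touch j i -> touch j i' -> i = i'.
  have no a b : fold s t (x j) = s a -> fold s t (y j) = s b -> False.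
    by move=> /trm ta /trm tb; have := ind _ _ ta tb; rewrite (exy j).1.
  move=> /orP[]/eqP E /orP[]/eqP E'.
  - by apply: is_; rewrite -E -E'.
  - by case: (no _ _ E E').
  - by case: (no _ _ E' E).
  - by apply: is_; rewrite -E -E'.
have touchE j i : touch j i -> exists2 u, u \in [:: x j; y j] & fold s t u = s i.
  by move=> /orP[]/eqP E; [exists (x j)|exists (y j)]; rewrite ?inE ?eqxx ?orbT.
have Etouch j i u : u \in [:: x j; y j] -> fold s t u = s i -> touch j i.
  by rewrite !inE /touch => /orP[]/eqP-> ->; rewrite eqxx ?orbT.
have touch2 j j' i : touch j i -> touch j' i -> j = j'.
  by move=> /touchE[u uj E] /touchE[u' uj' E']; apply: dxy uj uj' _; rewrite E E'.
pose Fp := [set i | [exists j, touch j i]].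
pose Te := [set j | [exists i, touch j i]].
have ext j : exists i, j \in Te -> touch j i.
  by case: (boolP (j \in Te)) => [|_]; [rewrite inE => /existsP[i h]; exists i|exists j].
have [tj htj] := fin_all_exists ext.
(* Different touched edges touch different pairs, so the untouched edges suffice for the untouched
   pairs. *)
have cT : #|Te| <= #|Fp|.
  have <- : #|[set tj j | j in Te]| = #|Te|.
    by apply: card_in_imset => j j' h h' E; apply: (touch2 _ _ (tj j)); [exact: htj|rewrite E; apply: htj].
  apply/subset_leq_card/subsetP => _ /imsetP[j h ->]; rewrite inE; apply/existsP; exists j; exact: htj.
have [ju [juU jui]] : exists ju : 'I_k -> 'I_k, {in ~: Fp, forall i, ju i \in ~: Te} /\ {in ~: Fp &, injective ju}.
  apply: (sdr_large id (N := fun=> ~: Te)) => i _; have := cardsC Fp; have := cardsC Te.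
  by move: cT; clear; lia.
have exf i : exists j, i \in Fp -> touch j i.
  by case: (boolP (i \in Fp)) => [|_]; [rewrite inE => /existsP[j h]; exists j|exists i].
have [jf hjf] := fin_all_exists exf.
pose J i := if i \in Fp then jf i else ju i.
have Jt i i' : touch (J i) i' -> i' = i /\ i \in Fp.
  rewrite /J; case: ifP => [/hjf h h'|iF h]; first by split=> //; apply: touch1 h' h.
  have : ju i \in ~: Te by apply: juU; rewrite inE iF.
  by rewrite !inE => /negP[]; apply/existsP; exists i'.
have Ji i i' : J i = J i' -> i = i'.
  case: (boolP (i \in Fp)) => iF.
    have h : touch (J i) i by rewrite /J iF; apply: hjf.
    by move=> E; rewrite E in h; case: (Jt _ _ h).
  case: (boolP (i' \in Fp)) => iF'.
    have h : touch (J i') i' by rewrite /J iF'; apply: hjf.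
    by move=> E; rewrite -E in h; case: (Jt _ _ h).
  by rewrite /J (negbTE iF) (negbTE iF') => E; apply: jui => //; rewrite inE.
pose D i := [:: s i; t i; x (J i); y (J i)].
have DY i z : z \in D i -> z \in Y by rewrite !inE => /or4P[]/eqP->; rewrite -?in_setU //; rewrite ?sY ?tY ?xY ?yY //;
  rewrite imset_f ?orbT.
have Dc i z : z \in D i -> fold s t z = s i \/ z \in [:: x (J i); y (J i)].
  by rewrite !inE => /or4P[]/eqP->; rewrite ?fst ?ftt ?eqxx ?orbT; auto.
have dD i i' z : z \in D i -> z \in D i' -> i = i'.
  move=> /Dc[E|h] /Dc[E'|h'].
  - by apply: is_; rewrite -E -E'.
  - by case: (Jt i' i (Etouch _ _ _ h' E)).
  - by case: (Jt i i' (Etouch _ _ _ h E')).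
  - by apply: Ji; apply: dxy h h' _.
pose F i := [set z in D i] :|: [set f z | z in D i].
have FD i z : z \in D i -> z \in F i by rewrite !in_setU inE => ->.
have Ff i z : z \in D i -> f z \in F i by move=> h; rewrite in_setU imset_f ?orbT.
have heh : subrel (bichrom e c) e by move=> u v /andP[].
have hc u v : bichrom e c u v -> c u != c v by case/andP.
apply: (assemble_plans (F := F) se heh hc lk).
  move=> i i' z; rewrite !in_setU !in_set => /orP[z1|/imsetP[u u1 E]] /orP[z2|/imsetP[u' u2 E']].
  - exact: dD z1 z2.
  - by have [h _ _] := hf u' (DY _ _ u2); move/disjP: dWY => /(_ z); rewrite {1}E' h (DY _ _ z1) => /(_ isT isT).
  - by have [h _ _] := hf u (DY _ _ u1); move/disjP: dWY => /(_ z); rewrite {1}E h (DY _ _ z2) => /(_ isT isT).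
  - have Eu : u = u' by apply: fi; [exact: DY u1|exact: DY u2|rewrite -E -E'].
    by rewrite -Eu in u2; apply: dD u1 u2.
move=> i; have sD : s i \in D i by rewrite !inE eqxx.
have tD : t i \in D i by rewrite !inE eqxx orbT.
have xD : x (J i) \in D i by rewrite !inE eqxx !orbT.
have yD : y (J i) \in D i by rewrite !inE eqxx !orbT.
have [eJ cJ] := exy (J i).
have nxy : x (J i) != y (J i) by apply: contraTneq eJ => ->; rewrite ie.
case: (boolP (i \in Fp)) => iF; last first.
  have nt u i' : u \in [:: x (J i); y (J i)] -> fold s t u != s i'.
    by move=> h; apply/eqP => /(Etouch _ _ _ h)/Jt[_ h']; rewrite h' in iF.
  have nx := nt (x (J i)) i ltac:(by rewrite !inE eqxx).
  have ny := nt (y (J i)) i ltac:(by rewrite !inE eqxx orbT).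
  apply: (@untouched_plan _ e c W (F i) Y f (p i) _ _ (x (J i)) (y (J i))) => //.
  - by move=> z; apply: DY.
  - rewrite /= !inE !negb_or st nxy /= !andbT -!andbA; apply/and4P; split.
    + by apply: contraNneq nx => <-; rewrite fst.
    + by apply: contraNneq ny => <-; rewrite fst.
    + by apply: contraNneq nx => <-; rewrite ftt.
    + by apply: contraNneq ny => <-; rewrite ftt.
  - move=> z; rewrite !in_cons in_nil orbF; do 7 (case/orP => [/eqP->|]; first by first [exact: FD|exact: Ff]).
    by move=> /eqP->; apply: Ff.
have [u [v [uxy vxy tu [euv cuv nvt]]]] : exists u v, [/\ u \in [:: x (J i); y (J i)], v \in [:: x (J i); y (J i)],
    fold s t u = s i & [/\ e u v, c u = c v & ~~ term s t v]].
  have : touch (J i) i by rewrite /J iF; apply: hjf.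
  have nn u v : e u v -> fold s t u = s i -> ~~ term s t v.
    by move=> uv /trm tu; apply/negP => tv; have := ind _ _ tu tv; rewrite uv.
  move=> /orP[]/eqP E; [exists (x (J i)), (y (J i))|exists (y (J i)), (x (J i))]; split;
    rewrite ?inE ?eqxx ?orbT //; split=> //; rewrite ?[e (y _) _]se //; apply: nn E; by rewrite // se.
have vD : v \in D i by move: vxy; rewrite !inE => /orP[]/eqP->; rewrite eqxx !orbT.
have nv w : term s t w -> v != w by move=> tw; apply: contraNneq nvt => ->.
have vs := nv _ (term_s s t i); have vt := nv _ (term_t s t i).
have sub w w' : w \in D i -> w' \in D i -> {subset [:: w; w'; v; f w; f w'; f v] <= F i}.
  move=> wD wD' z; rewrite !in_cons in_nil orbF; do 5 (case/orP => [/eqP->|]; first by first [exact: FD|exact: Ff]).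
  by move=> /eqP->; apply: Ff.
case: (fold_inv is_ tu) => Eu; rewrite Eu in euv cuv.
  by apply: (@touched_plan _ e c W (F i) Y f (p i) _ _ v) => //; [exact: DY vD|exact: sub].
have [L [R [Q [l [r [a [b [fl H]]]]]]]] : exists L R Q l r a b fl, plan e c W (F i) (t i) (s i) (p i) L R Q l r a b fl.
  by apply: (@touched_plan _ e c W (F i) Y f (p i) _ _ v) => //; [exact: DY vD|rewrite eq_sym|exact: sub].
by exists R, L, Q, r, l, a, b, fl; apply: plan_swap.
Qed.

Theorem theorem7 (T : finType) (e : rel T) (k : nat) :
  simple_graph e -> 0 < k -> k_connected e (50 * k) ->
  parity_linked_indep e k \/
  (exists X : {set T}, #|X| <= 2 * k - 2 /\ bipartite_minus e X).
Proof.
move=> [se ie] k0 con; have [nT conn] := con.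
case: (classic (exists X : {set T}, #|X| <= 2 * k - 2 /\ bipartite_minus e X)) => [h|no]; first by right.
left=> s t p is_ it st ind0.
have ind u v : term s t u -> term s t v -> ~~ e u v.
  move=> /existsP[i hu] /existsP[j hv]; apply: ind0.
    by case/orP: hu => /eqP->; rewrite codom_f ?orbT.
  by case/orP: hv => /eqP->; rewrite codom_f ?orbT.
have [c hc] := max_cut se ie.
have sh : symmetric (bichrom e c) by move=> u v; rewrite /bichrom /= se eq_sym.
have hcol u v : bichrom e c u v -> c u != c v by case/andP.
have dh v : 25 * k <= #|nb (bichrom e c) [set: T] v|.
  by have := hc v; have := min_degree v ie con; rewrite -/(bichrom e c); clear; lia.
have [W [cW lk]] := mader_core sh k0 hcol dh ltac:(by move: nT; clear; lia).
have j0 : 0 < 2 * k by move: k0; clear; lia.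
have conn2 (X : {set T}) : #|X| < 2 * (2 * k) -> connected_minus e X.
  by move=> h; apply: conn; move: h; clear; lia.
have cW2 : 2 * (2 * k) <= #|W| by move: cW; clear; lia.
case: (breaking_paths_or_bipartite c se ie j0 conn2 cW2) => [[Q [brk dQ]]|[Z [cZ bip]]].
  have heh : subrel (bichrom e c) e by move=> u v /andP[].
  apply: (link_via_breakers p se heh hcol lk is_ it st _ _ brk dQ).
    by move=> X h; apply: conn; move: h; clear; lia.
  by move: cW; clear; lia.
have cZ' : #|Z| <= 4 * k by move: cZ; clear; lia.
have [c' [col maj]] := majority_extension ie con cZ' bip.
case: (odd_edges_alternative is_ it st c' k0 se ie ind) => [[x [y [exy dxy]]]|//].
exact: (link_via_odd_edges p se ie k0 con cZ' col maj is_ it st ind exy dxy).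
Qed.
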